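(* Let $G$ be a finitely presented group that acts properly on a finite dimensional CAT(0) cube complex $X'$ such that the stabilizer in $G$ of every hyperplane of $X'$ is finitely generated. Suppose that one of the following holds: (1) the group $G$ is a surface group or a free group, or (2) the complex $X'$ is $2$-dimensional. Then the orbit maps $G\to X'$ are quasi-isometric embeddings.
   Context: $G$ acts by cubical automorphisms. $G$ is endowed with the word metric of a finite generating set and $X'$ with its $L^1$ (combinatorial) metric. An orbit map is a map $g\mapsto g\cdot x$ for a fixed $x\in X'$. Hyperplane stabilizers are setwise stabilizers. *)

(* Defs.v *)
From HB Require Import structures.
From mathcomp Require Import all_boot all_order all_algebra.
From mathcomp Require Import all_classical all_reals all_analysis.
From Stdlib Require Import Relations.
Set Implicit Arguments.
Unset Strict Implicit.
Unset Printing Implicit Defensive.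
Import Order.TTheory GRing.Theory Num.Theory.
Import numFieldNormedType.Exports.
Local Open Scope classical_set_scope.
Local Open Scope ring_scope.

(* * Group presentations *)

(* A letter (x, b) stands for x if b = false and for x^-1 if b = true. *)
Definition word (A : Type) := seq (A * bool).

Definition weval (G : groupType) (A : Type) (f : A -> G) (w : word A) : G :=
  (\big[*%g/1]_(l <- w) (if l.2 then (f l.1)^-1 else f l.1))%g.

Inductive word_step (A : Type) (rel : set (word A)) : word A -> word A -> Prop :=
| step_cancel (u v : word A) (x : A) (b : bool) :
    word_step rel (u ++ [:: (x, b); (x, ~~ b)] ++ v) (u ++ v)
| step_relator (u r v : word A) :
    rel r -> word_step rel (u ++ r ++ v) (u ++ v).

(* The map from the free group on A to G induced by f is onto, and its kernel
   is the normal closure of rel. *)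
Definition presents (G : groupType) (A : Type) (f : A -> G)
    (rel : set (word A)) : Prop :=
  (forall g, exists w, weval f w = g) /\
  (forall w1 w2, weval f w1 = weval f w2 <->
     clos_refl_sym_trans _ (word_step rel) w1 w2).

Definition finitely_presented (G : groupType) : Prop :=
  exists (n : nat) (f : 'I_n -> G) (rels : seq (word 'I_n)),
    presents f [set` rels].

Definition free_group (G : groupType) : Prop :=
  exists (A : Type) (f : A -> G), presents f set0.

(* [a_0, b_0] ... [a_(g-1), b_(g-1)], where a_i is the generator (i, false) and
   b_i is the generator (i, true). *)
Definition orientable_relator (g : nat) : word ('I_g * bool) :=
  flatten [seq [:: ((i, false), false); ((i, true), false);
                   ((i, false), true); ((i, true), true)] | i <- enum 'I_g].

(* a_0^2 ... a_(k-1)^2 *)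
Definition nonorientable_relator (k : nat) : word 'I_k :=
  flatten [seq [:: (i, false); (i, false)] | i <- enum 'I_k].

(* Fundamental groups of closed connected surfaces: orientable of genus g
   (g = 0 is the sphere), or a connected sum of k >= 1 projective planes. *)
Definition surface_group (G : groupType) : Prop :=
  (exists (g : nat) (f : 'I_g * bool -> G),
      presents f [set orientable_relator g]) \/
  (exists (k : nat) (f : 'I_k -> G),
      (0 < k)%N /\ presents f [set nonorientable_relator k]).

(* * Finite generation and word metrics *)

Definition spelled (G : groupType) (S : seq G) (g : G) (w : word G) : Prop :=
  all (fun l => l.1 \in S) w /\ weval id w = g.

Definition generates (G : groupType) (S : seq G) (H : set G) : Prop :=
  H = [set g | exists w, spelled S g w].

Definition finitely_generated (G : groupType) (H : set G) : Prop :=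
  exists S : seq G, generates S H.

Definition word_dist (R : realType) (G : groupType) (S : seq G) (g h : G) : R :=
  inf [set (size w)%:R | w in spelled S (g^-1 * h)%g].

(* * Cube complexes *)

Definition corner (n : nat) := {ffun 'I_n -> bool}.
Definition origin n : corner n := [ffun => false].
Definition antipode n : corner n := [ffun => true].
Definition axis n (i : 'I_n) : corner n := [ffun j => j == i].

(* The m-face of the n-cube through b with edge directions s 0, ..., s (m-1). *)
Definition face_map m n (b : corner n) (s : 'I_m -> 'I_n) (x : corner m) :
    corner n :=
  [ffun i => b i (+) [exists j, (s j == i) && x j]].

Definition is_face m n (phi : corner m -> corner n) : Prop :=
  exists b s, injective s /\ phi = face_map b s.

(* Cubical complexes in the sense of Bridson-Haefliger (I.7.32): each cube is
   embedded, and two cubes that meet do so in exactly one common face.  Such a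
   complex is recorded by the restrictions to the corners of the
   characteristic maps of its cubes; each n-cube occurs with all of its
   parametrizations by {0,1}^n (cube_face with m = n). *)
Record cubeComplex := CubeComplex {
  vertex :> choiceType;
  cube : forall n, (corner n -> vertex) -> Prop;
  cube_vertex : forall v, cube (fun _ : corner 0 => v);
  cube_inj : forall n (c : corner n -> vertex), cube c -> injective c;
  cube_face : forall m n (c : corner n -> vertex) (phi : corner m -> corner n),
    cube c -> is_face phi -> cube (c \o phi);
  cube_meet : forall n n' (c : corner n -> vertex) (c' : corner n' -> vertex),
    cube c -> cube c' -> (exists x x', c x = c' x') ->
    exists k (phi : corner k -> corner n) (phi' : corner k -> corner n'),
      [/\ is_face phi, is_face phi', c \o phi = c' \o phi' &
          forall x x', c x = c' x' -> exists z, x = phi z /\ x' = phi' z]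
}.

Definition dim_le (X : cubeComplex) (d : nat) : Prop :=
  forall n (c : corner n -> X), cube c -> (n <= d)%N.

Definition finite_dimensional (X : cubeComplex) : Prop := exists d, dim_le X d.

Definition dimension (X : cubeComplex) (d : nat) : Prop :=
  dim_le X d /\ exists c : corner d -> X, cube c.

(* The edges from v to u 0, ..., u (n-1) span a simplex of the link of v. *)
Definition link_simplex (X : cubeComplex) (v : X) n (u : 'I_n -> X) : Prop :=
  exists c : corner n -> X,
    [/\ cube c, c (origin n) = v & forall i, c (axis i) = u i].

Definition flag_links (X : cubeComplex) : Prop :=
  forall (v : X) n (u : 'I_n -> X),
    (forall i, link_simplex v (fun _ : 'I_1 => u i)) ->
    (forall i j, i != j ->
       link_simplex v (fun k : 'I_2 => if k == ord0 then u i else u j)) ->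
    link_simplex v u.

(* * Geometric realization *)

Definition unit_cube (R : realType) n : set 'rV[R]_n :=
  [set t | forall i, 0 <= t ord0 i <= 1].

(* The point with coordinates t in the cube c is encoded by its multilinear
   weights on the vertices of c.  These are supported on the smallest face
   containing the point, and determine its coordinates there, so that points
   of different cubes have the same weights exactly when the gluing of the
   cubes along their common face identifies them. *)
Definition bary (R : realType) (X : cubeComplex) n (c : corner n -> X)
    (t : 'rV[R]_n) : X -> R :=
  fun v => \sum_(e : corner n | c e == v)
             \prod_(i < n) (if e i then t ord0 i else 1 - t ord0 i).

Definition is_point (R : realType) (X : cubeComplex) (p : X -> R) : Prop :=
  exists n (c : corner n -> X) t, [/\ cube c, unit_cube t & p = bary c t].

Definition realization (R : realType) (X : cubeComplex) :=
  {p : X -> R | is_point p}.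

HB.instance Definition _ (R : realType) (X : cubeComplex) :=
  gen_eqMixin (realization R X).
HB.instance Definition _ (R : realType) (X : cubeComplex) :=
  gen_choiceMixin (realization R X).

Definition chart_preimage (R : realType) (X : cubeComplex) n
    (c : corner n -> X) (U : set (realization R X)) : set 'rV[R]_n :=
  [set t | exists2 p, U p & sval p = bary c t].

(* Weak topology: U is open when its trace on every closed cube is open. *)
Definition weak_open (R : realType) (X : cubeComplex)
    (U : set (realization R X)) : Prop :=
  forall n (c : corner n -> X), cube c ->
    open (chart_preimage c U : set (subspace (@unit_cube R n))).

Lemma sval_inj_realization (R : realType) (X : cubeComplex)
  (p q : realization R X) : sval p = sval q -> p = q.
Proof. by case: p q => [p hp] [q hq] /= e; exact: eq_exist. Qed.

Lemma chart_preimageT_sub (R : realType) (X : cubeComplex) n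
    (c : corner n -> X) : cube c ->
  @unit_cube R n `<=` chart_preimage c setT.
Proof.
move=> cc t ht; have hp : is_point (bary c t) by exists n, c, t.
by exists (exist _ _ hp).
Qed.

Lemma weak_openT (R : realType) (X : cubeComplex) :
  weak_open [set: realization R X].
Proof.
move=> n c cc; apply/open_subspaceP; exists setT; first exact: openT.
by rewrite setTI setIidr//; exact: chart_preimageT_sub.
Qed.

Lemma weak_openI (R : realType) (X : cubeComplex) (U V : set (realization R X)) :
  weak_open U -> weak_open V -> weak_open (U `&` V).
Proof.
move=> oU oV n c cc.
rewrite (_ : chart_preimage c _ = chart_preimage c U `&` chart_preimage c V).
  by apply: openI; [exact: oU | exact: oV].
apply/seteqP; split=> t.
  by case=> p [Up Vp] e; split; exists p.
case=> -[p Up ep] [q Vq eq]; exists p => //; split=> //.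
by rewrite (sval_inj_realization (etrans ep (esym eq))).
Qed.

Lemma weak_open_bigU (R : realType) (X : cubeComplex) (I : Type)
    (F : I -> set (realization R X)) :
  (forall i, weak_open (F i)) -> weak_open (\bigcup_i F i).
Proof.
move=> oF n c cc.
rewrite (_ : chart_preimage c _ = \bigcup_i chart_preimage c (F i)).
  by apply: bigcup_open => i _; exact: oF.
apply/seteqP; split=> t.
  by case=> p [i _ Fp] e; exists i => //; exists p.
by case=> i _ [p Fp e]; exists p => //; exists i.
Qed.

HB.instance Definition _ (R : realType) (X : cubeComplex) :=
  isOpenTopological.Build (realization R X)
    (@weak_openT R X) (@weak_openI R X) (@weak_open_bigU R X).

(* * CAT(0) cube complexes *)

Definition path_connected (R : realType) (T : topologicalType) : Prop :=
  forall p q : T, exists f : R -> T,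
    [/\ {within `[0, 1], continuous f}, f 0 = p & f 1 = q].

Definition loops_null_homotopic (R : realType) (T : topologicalType) : Prop :=
  forall f : R -> T, {within `[0, 1], continuous f} -> f 0 = f 1 ->
    exists F : R * R -> T,
      [/\ {within `[0, 1] `*` `[0, 1], continuous F},
          forall s : R, s \in `[0, 1] -> F (s, 0) = f s,
          forall s : R, s \in `[0, 1] -> F (s, 1) = f 0 &
          forall t : R, t \in `[0, 1] -> F (0, t) = f 0 /\ F (1, t) = f 0].

Definition simply_connected (R : realType) (T : topologicalType) : Prop :=
  [/\ [set: T] !=set0, path_connected R T & loops_null_homotopic R T].

(* Gromov's link condition *)
Definition CAT0 (R : realType) (X : cubeComplex) : Prop :=
  simply_connected R (realization R X) /\ flag_links X.

(* * The L^1 metric *)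

(* A string from p to q of total length L whose consecutive points lie in a
   common cube and are joined there by an L^1 geodesic. *)
Inductive l1_string (R : realType) (X : cubeComplex) :
    realization R X -> realization R X -> R -> Prop :=
| string_nil p : l1_string p p 0
| string_cons n (c : corner n -> X) (t s : 'rV[R]_n) p q r L :
    cube c -> unit_cube t -> unit_cube s ->
    sval p = bary c t -> sval q = bary c s -> l1_string q r L ->
    l1_string p r (\sum_(i < n) `|t ord0 i - s ord0 i| + L).

Definition l1_dist (R : realType) (X : cubeComplex) (p q : realization R X) : R :=
  inf [set L | l1_string p q L].

(* * Actions by cubical automorphisms *)

Record cubicalAction (G : groupType) (X : cubeComplex) := CubicalAction {
  act :> G -> X -> X;
  act1 : forall v, act 1%g v = v;
  actM : forall g h v, act (g * h)%g v = act g (act h v);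
  act_cube : forall g n (c : corner n -> X), cube c -> cube (act g \o c)
}.

Lemma act_is_point (R : realType) (G : groupType) (X : cubeComplex)
    (a : cubicalAction G X) (g : G) (p : X -> R) :
  is_point p -> is_point (fun v => p (a g^-1%g v)).
Proof.
move=> [n [c [t [cc ht ->]]]]; exists n, (a g \o c), t; split=> //.
  exact: act_cube.
apply/funext => v; apply: eq_bigl => e; apply/eqP/eqP => /= [->|<-].
  by rewrite -actM mulgV act1.
by rewrite -actM mulVg act1.
Qed.

Definition act_point (R : realType) (G : groupType) (X : cubeComplex)
    (a : cubicalAction G X) (g : G) (p : realization R X) : realization R X :=
  exist _ _ (act_is_point a g (svalP p)).

Definition l1_ball (R : realType) (X : cubeComplex) (p : realization R X) (r : R) :
    set (realization R X) :=
  [set q | l1_dist p q < r].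

Definition proper_action (R : realType) (G : groupType) (X : cubeComplex)
    (a : cubicalAction G X) : Prop :=
  forall p : realization R X, exists2 r, 0 < r &
    finite_set [set g | act_point a g @` l1_ball p r `&` l1_ball p r !=set0].

(* * Hyperplanes *)

Definition edge (X : cubeComplex) (e : X * X) : Prop :=
  exists2 c : corner 1 -> X, cube c & e = (c (origin 1), c (antipode 1)).

(* Reversal, or passing to the opposite edge in a square. *)
Definition parallel_step (X : cubeComplex) (e f : X * X) : Prop :=
  f = (e.2, e.1) \/
  exists2 c : corner 2 -> X, cube c &
    e = (c (origin 2), c (axis ord0)) /\ f = (c (axis ord_max), c (antipode 2)).

(* A hyperplane is a parallelism class of edges; each edge is present in it
   with both orientations. *)
Definition hyperplane (X : cubeComplex) (H : set (X * X)) : Prop :=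
  exists2 e, edge e & H = [set f | clos_refl_sym_trans _ (@parallel_step X) e f].

Definition hyperplane_stabilizer (G : groupType) (X : cubeComplex)
    (a : cubicalAction G X) (H : set (X * X)) : set G :=
  [set g | [set (a g e.1, a g e.2) | e in H] = H].

(* * Quasi-isometric embeddings *)

Definition quasi_isometric_embedding (R : realType) (S T : Type)
    (dS : S -> S -> R) (dT : T -> T -> R) (f : S -> T) : Prop :=
  exists K C : R, [/\ 1 <= K, 0 <= C &
    forall x y, K^-1 * dS x y - C <= dT (f x) (f y) <= K * dS x y + C].

Definition orbit_map (R : realType) (G : groupType) (X : cubeComplex)
    (a : cubicalAction G X) (x : realization R X) (g : G) : realization R X :=
  act_point a g x.

(* Main.v *)
(** Edge loops in a simply connected cube complex are contracted by square moves:
    subdivide a null-homotopy so finely that each piece lies in an open star.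
    With flag links, edge paths therefore have normal forms modulo squares, and
    the distance in the 1-skeleton counts separating hyperplanes; it differs from
    the L1 metric on an orbit by a constant.  What has to be bounded linearly is
    thus the word length of g by the number of hyperplanes separating x0 and g x0.

    Call a hyperplane essential if it separates orbit points.  If up to translation
    all finite families of pairwise crossing essential hyperplanes lie in one
    finite set, then moving from x0 to g x0 inside the median hull of the orbit, one
    hyperplane at a time, stays within a finite set of orbits and gives the bound.
    To verify this, let N(h) be the neighbourhood in the Cayley graph of the edges
    crossed by h.  As Stab(h) is finitely generated, N(h) is connected (for a
    radius independent of h), so N(h) meets N(k) when h and k cross.  It remains
    to find a point common to the N(h) of a crossing family.  In dimension 2 a
    family has at most two members; in a free group the N(h) are subtrees and have
    the Helly property.
    The group of a closed hyperbolic surface is an HNN extension of a free group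
    along a cyclic group, and Helly applies first in the Bass-Serre tree and then
    in one vertex tree; two edge lines of a vertex tree share no two consecutive
    edges, which prevents hyperplanes from meeting only elsewhere.  For the torus
    and the Klein bottle, two independent essential hyperplanes give two linear
    functionals bounded by the number of separating hyperplanes. *)

From mathcomp Require Import all_boot all_order all_algebra monoid.
From mathcomp Require Import all_classical all_reals all_analysis.
From mathcomp Require Import zify ring lra.
From Stdlib Require Import Relations.
Require Import Defs.
Set Implicit Arguments.
Unset Strict Implicit.
Unset Printing Implicit Defensive.

(** All trees used here are extracted from presentations, with no normal form theorem for free
    groups or HNN extensions. [cocycle_coboundary] integrates every cochain on the Cayley graph that
    sums to zero round the relators. Applied mod 2 to the indicator of one edge, or of a family of
    parallel edges, it returns a side function that changes only there, which exhibits a bridge.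
    With integer values it also gives the homomorphisms to the integers and an infinite order
    element of the Klein bottle group. The flat surfaces are an obstacle to a uniform argument. In a
    plane the neighbourhoods of walls look like lines, and three pairwise crossing lines need not
    pass near one point, so [fin_crossing] can fail: let the plane lattice act on 3-space through
    three families of lines. Hence the surface cases aim at the weaker [word_linear]. In hyperbolic
    surface groups the same danger is confined to the strips between vertex spaces, where [line_det]
    excludes it by inspecting two-letter subwords of the relator. Crossing and parallelism of walls
    are tested on orbit points only, so walls that do not cut the orbit never enter. *)

(** * Square complexes with the three-cube condition *)

(* [sq a b c d]: the vertices of a square in cyclic order. *)
Record sqComplex := SqComplex {
  sqv :> choiceType;
  adj : sqv -> sqv -> Prop;
  sq : sqv -> sqv -> sqv -> sqv -> Prop;
  adjC : forall a b, adj a b -> adj b a;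
  sq_rot : forall a b c d, sq a b c d -> sq b c d a;
  sq_flip : forall a b c d, sq a b c d -> sq a d c b;
  sq_adj : forall a b c d, sq a b c d -> adj a b;
  sq_neq : forall a b c d, sq a b c d -> a <> c;
  sq_uniq : forall a b c d d', sq a b c d -> sq a b c d' -> d = d';
  sq_cube : forall x y y' w p q z, sq x y p w -> sq x y' q w -> sq x y z y' ->
    exists t, [/\ sq w p t q, sq y p t z & sq y' q t z]
}.

(** The eight alternatives are the dihedral symmetries of a square, so a square in the context
    proves each of its relabellings. *)
Ltac sqt := match goal with h : sq _ _ _ _ |- sq _ _ _ _ =>
  solve [ exact h | exact (sq_rot h) | exact (sq_rot (sq_rot h))
        | exact (sq_rot (sq_rot (sq_rot h))) | exact (sq_flip h)
        | exact (sq_rot (sq_flip h)) | exact (sq_rot (sq_rot (sq_flip h)))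
        | exact (sq_rot (sq_rot (sq_rot (sq_flip h)))) ] end.

Section Walks.
Variable X : sqComplex.
Implicit Types (u v w x y z : X) (p q r s : seq X).

(* Walks are listed backwards: the head is the endpoint. *)
Inductive walk u : X -> seq X -> Prop :=
| walk0 : walk u u [:: u]
| walkS x w p : walk u x p -> adj x w -> walk u w (w :: p).

Inductive hstep : seq X -> seq X -> Prop :=
| hstep_sq w x y x' p : sq w x y x' -> hstep [:: w, x, y & p] [:: w, x', y & p]
| hstep_back x w p : adj x w -> hstep [:: x, w, x & p] (x :: p)
| hstep_cons w p q : hstep p q -> hstep (w :: p) (w :: q).

Definition homotopic := clos_refl_sym_trans _ hstep.

(** Only the length-preserving moves. Reduced walks modulo these serve as normal forms of homotopy
    classes. *)
Inductive swap : seq X -> seq X -> Prop :=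
| swap_sq w x y x' p : sq w x y x' -> swap [:: w, x, y & p] [:: w, x', y & p]
| swap_cons w p q : swap p q -> swap (w :: p) (w :: q).

Definition swapeq := clos_refl_sym_trans _ swap.

Inductive backtracks : seq X -> Prop :=
| backtracks_here x w p : backtracks [:: x, w, x & p]
| backtracks_cons w p : backtracks p -> backtracks (w :: p).

Definition reduced p := ~ exists2 q, swapeq p q & backtracks q.

Lemma sq_neq2 a b c d : @sq X a b c d -> b <> d.
Proof. by move=> h; exact: (sq_neq (sq_rot h)). Qed.

Lemma swapeq_refl p : swapeq p p. Proof. exact: rst_refl. Qed.
Lemma swapeq_sym p q : swapeq p q -> swapeq q p. Proof. exact: rst_sym. Qed.
Lemma swapeq_trans q p r : swapeq p q -> swapeq q r -> swapeq p r.
Proof. exact: rst_trans. Qed.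

Lemma swapeq_cons w p q : swapeq p q -> swapeq (w :: p) (w :: q).
Proof.
elim=> [{}p {}q h|{}p|{}p {}q _ h|{}p {}q r _ h1 _ h2].
- by apply/rst_step/swap_cons.
- exact: swapeq_refl.
- exact: swapeq_sym.
- exact: swapeq_trans h1 h2.
Qed.

Lemma swapeq_sq w x y x' p : sq w x y x' ->
  swapeq [:: w, x, y & p] [:: w, x', y & p].
Proof. by move=> h; apply/rst_step/swap_sq. Qed.

Lemma swap_size p q : swap p q -> size p = size q.
Proof. by elim=> //= w {}p {}q _ ->. Qed.

Lemma swapeq_size p q : swapeq p q -> size p = size q.
Proof.
elim=> [{}p {}q /swap_size//|//|{}p {}q _ ->//|{}p {}q r _ -> _ ->//].
Qed.

Lemma swap_head p q x : swap p q -> head x p = head x q.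
Proof. by case. Qed.

Lemma swapeq_head p q x : swapeq p q -> head x p = head x q.
Proof.
elim=> [{}p {}q /swap_head//|//|{}p {}q _ ->//|{}p {}q r _ -> _ ->//].
Qed.

Lemma swapeq_consP w p q : swapeq (w :: p) q ->
  exists2 q', q = w :: q' & size q' = size p.
Proof.
case: q => [/swapeq_size//|x q] e.
have := swapeq_head w e; have := swapeq_size e => /= -[e1] e2.
by exists q => //; rewrite e2.
Qed.

Definition levi_rel w x p x' q :=
  (x = x' /\ swapeq (x :: p) (x' :: q)) \/
  exists y r, [/\ sq w x y x', swapeq (x :: p) [:: x, y & r] &
                  swapeq (x' :: q) [:: x', y & r]].

(* A swap class is determined by its last step; two possible last steps span a
   square.  Transitivity is where the three-cube condition enters. *)
Lemma levi n w x p x' q : size p <= n ->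
  swapeq [:: w, x & p] [:: w, x' & q] -> levi_rel w x p x' q.
Proof.
elim/ltn_ind: n w x p x' q => n IH w x p x' q sp h.
have trans a pa b pb c pc : size pa <= n -> size pb <= n -> size pc <= n ->
    levi_rel w a pa b pb -> levi_rel w b pb c pc -> levi_rel w a pa c pc.
  move=> sa sb sc [[-> h1]|[y [r [h1 h2 h3]]]].
    case=> [[<- h2]|[y [r [h2 h3 h4]]]].
      by left; split=> //; exact: swapeq_trans h1 h2.
    by right; exists y, r; split=> //; exact: swapeq_trans h1 h3.
  case=> [[e h4]|[y' [r' [h4 h5 h6]]]].
    subst c; right; exists y, r; split=> //.
    by apply: swapeq_trans h3; exact: swapeq_sym.
  (* Two forks, one through y and one through y'. One step further back, the induction hypothesis
     either identifies y and y' or gives a square at b. In the latter case the three squares at b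
     close up to a cube, and its vertex t opposite to b is the common step before a and c. *)
  have h7 : swapeq [:: b, y & r] [:: b, y' & r'].
    by apply: swapeq_trans h5; exact: swapeq_sym.
  have sr : size r < n.
    by have /= := swapeq_size h3; move=> [e]; rewrite e /= in sb.
  case: (IH _ sr _ _ _ _ _ (leqnn _) h7) => [[e h8]|[z [s [h8 h9 h10]]]].
    subst y'; have e : a = c by apply: (@sq_uniq X w b y); sqt.
    subst c; left; split=> //.
    apply: swapeq_trans h2 _; apply: swapeq_trans (swapeq_sym h6).
    exact: swapeq_cons.
  have [t [t1 t2 t3]] : exists t, [/\ sq w a t c, sq y a t z & sq y' c t z].
    by apply: (@sq_cube X b) h8; sqt.
  right; exists t, (z :: s); split=> //.
    apply: swapeq_trans h2 _; apply: swapeq_trans (swapeq_cons _ h9) _.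
    by apply: swapeq_sq; sqt.
  apply: swapeq_trans h6 _; apply: swapeq_trans (swapeq_cons _ h10) _.
  by apply: swapeq_sq; sqt.
have step P Q : swap P Q -> forall a pa, P = [:: w, a & pa] ->
    exists b qb, Q = [:: w, b & qb] /\ levi_rel w a pa b qb.
  case=> [w0 a y b p0 hs|w0 p0 q0 hs] c pc [].
    move=> ew ea ep; subst w0 a pc; exists b, (y :: p0); split=> //.
    by right; exists y, p0; split=> //; exact: swapeq_refl.
  move=> -> e; rewrite e in hs; have h2 : swapeq (c :: pc) q0 by exact: rst_step.
  have [q' eq sq'] := swapeq_consP h2.
  exists c, q'; rewrite eq; split=> //; left; split=> //.
  by rewrite -eq.
have main P Q : swapeq P Q -> (forall a pa, P = [:: w, a & pa] -> size pa <= n ->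
      exists b qb, Q = [:: w, b & qb] /\ levi_rel w a pa b qb) /\
   (forall a pa, Q = [:: w, a & pa] -> size pa <= n ->
      exists b qb, P = [:: w, b & qb] /\ levi_rel w a pa b qb).
  elim=> {P Q} [P Q hs|P|P Q _ [h1 h2]|P Q R hPQ [h1 h2] hQR [h3 h4]].
  - split=> a pa e _; first exact: step hs _ _ e.
    have hs' : swap Q P.
      elim: hs {e} => [w0 a0 y b p0 hs|w0 p0 q0 hs]; last exact: swap_cons.
      by apply: swap_sq; exact: sq_flip.
    exact: step hs' _ _ e.
  - by split=> a pa e _; exists a, pa; split=> //; left; split=> //; exact: swapeq_refl.
  - by split.
  - split=> a pa e sa.
      have [b [qb [e1 l1]]] := h1 _ _ e sa.
      have sb : size qb <= n.
        by have := swapeq_size hPQ; rewrite e e1 /= => -[<-].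
      have [c [qc [e2 l2]]] := h3 _ _ e1 sb.
      have sc : size qc <= n.
        by have := swapeq_size hQR; rewrite e1 e2 /= => -[<-].
      by exists c, qc; split=> //; exact: trans l1 l2.
    have [b [qb [e1 l1]]] := h4 _ _ e sa.
    have sb : size qb <= n.
      by have := swapeq_size hQR; rewrite e e1 /= => -[->].
    have [c [qc [e2 l2]]] := h2 _ _ e1 sb.
    have sc : size qc <= n.
      by have := swapeq_size hPQ; rewrite e1 e2 /= => -[->].
    by exists c, qc; split=> //; exact: trans l1 l2.
have [b [qb [[<- <-] l]]] := (main _ _ h).1 _ _ erefl sp.
exact: l.
Qed.

Lemma swapeq_cancel w x p q :
  swapeq [:: w, x & p] [:: w, x & q] -> swapeq (x :: p) (x :: q).
Proof.
case/(levi (leqnn _)) => [[]//|[y [r [h _ _]]]].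
by case: (sq_neq2 h).
Qed.

Lemma swapeq_fork w x p x' q : x <> x' -> swapeq [:: w, x & p] [:: w, x' & q] ->
  exists y r, [/\ sq w x y x', swapeq (x :: p) [:: x, y & r] &
                  swapeq (x' :: q) [:: x', y & r]].
Proof. by move=> n /(levi (leqnn _)) [[]|]. Qed.

Lemma reduced_swapeq p q : swapeq p q -> reduced p -> reduced q.
Proof.
by move=> e h [r er br]; apply: h; exists r => //; exact: swapeq_trans e er.
Qed.

Lemma reduced_cons w p : reduced (w :: p) -> reduced p.
Proof.
move=> h [q e b]; apply: h; exists (w :: q); first exact: swapeq_cons.
exact: backtracks_cons.
Qed.

Lemma backtracksP x p : backtracks (x :: p) ->
  (exists w r, p = [:: w, x & r]) \/ backtracks p.
Proof.
move eq: (x :: p) => q h; case: h eq => [y w r|w r h] [-> ->]; last by right.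
by left; exists w, r.
Qed.

(** The exchange property: a new edge fails to extend a reduced walk only by cancelling against it.
    If a backtracking representative arrives through x instead of w, the two last steps span a
    square; the claim for its fourth vertex y is the induction hypothesis, and its answer is carried
    back across the square. *)
Lemma reduced_snoc w z p : reduced (w :: p) -> ~ reduced [:: z, w & p] ->
  exists r, swapeq (w :: p) [:: w, z & r].
Proof.
have [n] := ubnP (size p); elim: n w z p => // n IH w z p sp rp /contrapT[q0 e].
have [q eq _] := swapeq_consP e; rewrite {}eq in e *.
case: q e => [/swapeq_size//|x a e].
have [ewx|nwx] := pselect (w = x).
  subst x; have := swapeq_cancel e => e'.
  move=> /backtracksP[[x [r [ewx ea]]]|b]; last by case: rp; exists (w :: a).
  by exists r; rewrite -ea.
have [y [r [h1 h2 h3]]] := swapeq_fork nwx e.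
have nw : reduced [:: w, y & r] by exact: reduced_swapeq h2 rp.
move=> /backtracksP[[x' [a' [ex ea]]]|b].
  subst x' a; have nzy : z <> y by exact: sq_neq h1.
  have [y' [r' [k1 k2 k3]]] := swapeq_fork nzy h3.
  have ey : y' = w by apply: (@sq_uniq X y x z); sqt.
  subst y'; case: nw; exists [:: w, y, w & r'].
    exact: swapeq_cons.
  exact: backtracks_here.
have [s es] : exists s, swapeq (y :: r) [:: y, x & s].
  apply: IH; last first.
  - by move=> k; apply: k; exists (x :: a) => //; exact: swapeq_sym.
  - exact: reduced_cons nw.
  - by have /= [] := swapeq_size h2 => es; move: sp; rewrite es.
exists (x :: s); apply: swapeq_trans h2 _; apply: swapeq_trans (swapeq_cons _ es) _.
by apply: swapeq_sq; sqt.
Qed.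

(* [nstep x w Q R]: R is the reduced form of the reduced walk Q, which ends at
   x, followed by the edge from x to w. *)
Definition nstep x w q r :=
  (exists2 s, swapeq q [:: x, w & s] & r = w :: s) \/
  ((forall s, ~ swapeq q [:: x, w & s]) /\ r = w :: q).

(** A relation, because a cancellation has to choose a representative that ends with the cancelled
    edge; by [nform_fun] the choice is immaterial up to swaps. *)
Fixpoint nform p r : Prop :=
  match p with
  | [::] => False
  | w :: p' => match p' with
               | [::] => r = [:: w]
               | x :: _ => exists2 q, nform p' q & nstep x w q r
               end
  end.

Lemma walk_consP u w p z : walk u z (w :: p) ->
  z = w /\ ((p = [::] /\ u = w) \/
            exists x q, [/\ p = x :: q, adj x w & walk u x p]).
Proof.
move eq: (w :: p) => q h; case: h eq => [|x z' r h a] [-> ->]; first by split; [|left].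
split=> //; right; move: h; case: r => [h|y r h]; first by inversion h.
by exists y, r; have ex : x = y by [inversion h]; subst y.
Qed.

Lemma walk_nnil u w p : walk u w p -> exists q, p = w :: q.
Proof. by case=> [|x w' q _ _]; [exists [::]|exists q]. Qed.

Lemma walk_cons2 u w x p z : walk u z [:: w, x & p] ->
  [/\ z = w, adj x w & walk u x (x :: p)].
Proof. by move=> /walk_consP[-> [[]//|[x1 [q [[-> ->] ? ?]]]]]. Qed.

Lemma hstep_walk p q : hstep p q -> forall u v, walk u v p <-> walk u v q.
Proof.
elim=> {p q} [w x y x' p h|x w p a|w p q h IH] u v.
- split=> /walk_cons2[-> a1 /walk_cons2[_ a2 h2]]; apply: walkS (walkS h2 _) _.
  + by apply/(@sq_adj X _ _ w x); sqt.
  + by apply/(@sq_adj X _ _ x y); sqt.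
  + by apply/(@sq_adj X _ _ w x'); sqt.
  + by apply/(@sq_adj X _ _ x' y); sqt.
- split=> [/walk_cons2[-> a1 /walk_cons2[_ a2 h2]]//|h].
  have [/= r [e _]] := walk_nnil h; subst v.
  exact: walkS (walkS h a) (adjC a).
- split=> /walk_consP[-> [[e ->]|[x1 [r [e a1 h1]]]]].
  + by subst p; inversion h.
  + by apply: walkS a1; exact/IH.
  + by subst q; inversion h.
  + by apply: walkS a1; exact/IH.
Qed.

Lemma swap_hstep p q : swap p q -> hstep p q.
Proof. by elim=> *; [exact: hstep_sq|exact: hstep_cons]. Qed.

Lemma swapeq_walk p q u v : swapeq p q -> walk u v p <-> walk u v q.
Proof.
elim=> [{}p {}q /swap_hstep/hstep_walk->//|//|{}p {}q _ ->//|{}p {}q r _ -> _ ->//].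
Qed.

Lemma nform_ex u v p : walk u v p -> exists q, nform p q.
Proof.
elim=> [|x w {}p h [q hq] a]; first by exists [:: u].
have [r e] := walk_nnil h; subst p.
have [[s hs]|nh] := pselect (exists s, swapeq q [:: x, w & s]).
  by exists (w :: s), q => //; left; exists s.
by exists (w :: q), q => //; right; split=> // s hs; apply: nh; exists s.
Qed.

Lemma nformP u v p q : walk u v p -> nform p q ->
  [/\ walk u v q, reduced q & size q <= size p].
Proof.
move=> h; elim: h q => [|x w {}p h IH a] q.
  move=> ->; split=> //; first exact: walk0.
  case=> r e b; have := swapeq_size e; case: b {e} => // y r' b.
  by case: b.
have [r e] := walk_nnil h; subst p => -[q' /IH[w1 r1 s1]].
have [q0 e0] := walk_nnil w1; subst q' => -[[s h1 ->]|[h1 ->]].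
  have r2 := reduced_swapeq h1 r1.
  have := (swapeq_walk u x h1).1 w1.
  move=> /walk_cons2[_ _ w2].
  split=> //; first exact: reduced_cons r2.
  by move: s1; rewrite (swapeq_size h1) /=; lia.
split; [exact: walkS w1 a| |by []].
by apply: contrapT => /(reduced_snoc r1)[s /h1].
Qed.

Lemma nstep_eqv x w q q' r r' : swapeq q q' -> nstep x w q r -> nstep x w q' r' ->
  swapeq r r'.
Proof.
move=> e [[s h ->]|[h ->]] [[s' h' ->]|[h' ->]].
- apply: (@swapeq_cancel x); apply: swapeq_trans (swapeq_sym h) _.
  exact: swapeq_trans e h'.
- by case: (h' s); apply: swapeq_trans h; exact: swapeq_sym.
- by case: (h s'); apply: swapeq_trans e h'.
- exact: swapeq_cons.
Qed.

Lemma nform_fun p q q' : nform p q -> nform p q' -> swapeq q q'.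
Proof.
elim: p q q' => //= w [|x p] IH q q'; first by move=> -> ->; exact: swapeq_refl.
by move=> [r h1 h2] [r' h1' h2']; apply: nstep_eqv h2 h2'; exact: IH.
Qed.

Lemma nform_reduced u v p : walk u v p -> reduced p -> nform p p.
Proof.
elim=> // x w {}p h IH a rp; have [r e] := walk_nnil h; subst p.
exists (x :: r); first by apply: IH; exact: reduced_cons rp.
right; split=> // s hs; apply: rp; exists [:: w, x, w & s].
  exact: swapeq_cons.
exact: backtracks_here.
Qed.

(** Confluence over a square, by cases on which of the two first edges at y cancel. If both do, the
    endings of q fork over this very square and both second edges cancel as well. If one does, a
    swap shows that the other route loses its length at the second edge. If neither does, nothing
    cancels and the results differ by one swap. *)
Lemma nstep_sq w x y x' q r1 r2 r1' r2' : reduced (y :: q) -> sq w x y x' ->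
  nstep y x (y :: q) r1 -> nstep x w r1 r2 ->
  nstep y x' (y :: q) r1' -> nstep x' w r1' r2' -> swapeq r2 r2'.
Proof.
move=> rq h; have nxx : x <> x' by apply: (@sq_neq X x y x' w); sqt.
have nwy : w <> y by exact: sq_neq h.
case=> [[s h1 ->]|[h1 ->]] k2 [[s' h1' ->]|[h1' ->]] k2'.
- have /(swapeq_fork nxx)[z [t [t1 t2 t3]]] : swapeq [:: y, x & s] [:: y, x' & s'].
    by apply: swapeq_trans h1'; exact: swapeq_sym.
  have ez : z = w by apply: (@sq_uniq X x y x'); sqt.
  subst z; case: k2 => [[a a1 ->]|[a1 _]]; last by case: (a1 t).
  case: k2' => [[b b1 ->]|[b1 _]]; last by case: (b1 t).
  apply: (@swapeq_trans (w :: t)).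
    by apply: (@swapeq_cancel x); apply: swapeq_trans t2; exact: swapeq_sym.
  by apply: (@swapeq_cancel x'); apply: swapeq_trans b1; exact: swapeq_sym.
- have e : swapeq [:: x', y & q] [:: x', w, x & s].
    apply: swapeq_trans (swapeq_cons _ h1) _; apply: swapeq_sq; sqt.
  case: k2' => [[b b1 ->]|[b1 _]]; last by case: (b1 (x :: s)).
  case: k2 => [[a a1 ->]|[a1 ->]].
    case: (h1' (w :: a)); apply: swapeq_trans h1 _.
    apply: swapeq_trans (swapeq_cons _ a1) _; apply: swapeq_sq; sqt.
  by apply: (@swapeq_cancel x'); apply: swapeq_trans b1; exact: swapeq_sym.
- have e : swapeq [:: x, y & q] [:: x, w, x' & s'].
    apply: swapeq_trans (swapeq_cons _ h1') _; apply: swapeq_sq; sqt.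
  case: k2 => [[b b1 ->]|[b1 _]]; last by case: (b1 (x' :: s')).
  case: k2' => [[a a1 ->]|[a1 ->]].
    case: (h1 (w :: a)); apply: swapeq_trans h1' _.
    apply: swapeq_trans (swapeq_cons _ a1) _; apply: swapeq_sq; sqt.
  by apply: (@swapeq_cancel x); apply: swapeq_trans e; exact: swapeq_sym.
- case: k2 => [[a /swapeq_fork]|[_ ->]].
    case=> [e|z [t [t1 t2 t3]]]; first by apply: nwy.
    have ez : z = x' by apply: (@sq_uniq X y x w); sqt.
    by subst z; case: (h1' t).
  case: k2' => [[a /swapeq_fork]|[_ ->]].
    case=> [e|z [t [t1 t2 t3]]]; first by apply: nwy.
    have ez : z = x by apply: (@sq_uniq X y x' w); sqt.
    by subst z; case: (h1 t).
  exact: swapeq_sq.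
Qed.

Lemma nform_hstep u v p p' q q' : walk u v p -> hstep p p' ->
  nform p q -> nform p' q' -> swapeq q q'.
Proof.
move=> wp h; elim: h u v wp q q' => {p p'} [w x y x' p h|x w p a|w p p' h IH] u v wp q q'.
- move=> [r1 [s k1 k2] k3] [r1' [s' k1' k2'] k3'].
  have [_ _ /walk_cons2[_ _ h2]] := walk_cons2 wp.
  have [w1 rd1 _] := nformP h2 k1; have [w1' rd1' _] := nformP h2 k1'.
  have [t et] := walk_nnil w1; subst s.
  have [r3 k4] : exists r3, nstep y x' (y :: t) r3.
    have [[m hm]|nm] := pselect (exists m, swapeq (y :: t) [:: y, x' & m]).
      by exists (x' :: m); left; exists m.
    by exists (x' :: y :: t); right; split=> // m hm; apply: nm; exists m.
  have [r4 k5] : exists r4, nstep x' w r3 r4.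
    have [[m hm]|nm] := pselect (exists m, swapeq r3 [:: x', w & m]).
      by exists (w :: m); left; exists m.
    by exists (w :: r3); right; split=> // m hm; apply: nm; exists m.
  apply: swapeq_trans (nstep_sq rd1 h k2 k3 k4 k5) _.
  apply: nstep_eqv k5 k3'; apply: nstep_eqv k4 k2'. exact: (@nform_fun (y::p) _ _ k1 k1').
- move=> [r1 [s k1 k2] k3] k4.
  have [_ _ /walk_cons2[_ _ h2]] := walk_cons2 wp.
  have [w1 rd1 _] := nformP h2 k1.
  apply: swapeq_trans (@nform_fun (x :: p) _ _ k1 k4).
  have [t et] := walk_nnil w1; subst s.
  case: k2 => [[m m1 e]|[m1 e]]; subst r1.
    case: k3 => [[l l1 e]|[l1 ->]]; last exact: swapeq_sym.
    case: rd1; exists [:: x, w, x & l].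
      by apply: swapeq_trans m1 _; exact: swapeq_cons.
    exact: backtracks_here.
  case: k3 => [[l l1 ->]|[l1 ->]]; last by case: (l1 t); exact: swapeq_refl.
  by apply: swapeq_sym; exact: swapeq_cancel l1.
- move: wp => /walk_consP[_ [[e1 e2]|[x [r [e a wp]]]]]; first by subst p; inversion h.
  have wp' := (hstep_walk h _ _).1 wp; subst p.
  have [r' e'] := walk_nnil wp'; subst p'.
  move=> [s h1 h2] [s' h1' h2']; apply: nstep_eqv h2 h2'; exact: (IH _ _ wp s s' h1 h1').
Qed.

Lemma nform_homotopic u v p p' q q' : walk u v p -> homotopic p p' ->
  nform p q -> nform p' q' -> swapeq q q'.
Proof.
move=> wp h; elim: h u v wp q q' => {p p'} [p p' h|p|p p' h IH|p p' p'' h IH h' IH'] u v wp q q'.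
- by move=> h1 h2; exact: nform_hstep wp h h1 h2.
- exact: nform_fun.
- move=> h1 h2; apply: swapeq_sym; apply: IH h2 h1.
  have hw a b c d : homotopic a b -> walk c d b -> walk c d a.
    move=> hh; have : walk c d a <-> walk c d b by elim: hh => [{}a {}b /hstep_walk->|//|? ? _ ->|? ? ? _ -> _ ->].
    by case.
  exact: hw wp.
- have wp' : walk u v p'.
    suff <- : walk u v p <-> walk u v p' by [].
    by elim: h {IH wp}=> [{}a {}b /hstep_walk->|//|? ? _ ->|? ? ? _ -> _ ->].
  move=> h1 h2; have [s hs] := nform_ex wp'.
  by apply: swapeq_trans (IH _ _ wp _ _ h1 hs) _; exact: IH' wp' _ _ hs h2.
Qed.

End Walks.

(** * Distances and medians in simply connected square complexes *)

Record cubed := Cubed {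
  cubed_sq :> sqComplex;
  cubed_conn : forall u v : cubed_sq, exists p, walk u v p;
  cubed_sc : forall (u v : cubed_sq) p q,
    walk u v p -> walk u v q -> homotopic p q
}.

Section Distance.
Variable X : cubed.
Implicit Types (u v w x y z a b c : X) (p q r s : seq X).

Lemma reduced_ex u v : exists p, walk u v p /\ reduced p.
Proof.
have [p hp] := cubed_conn u v; have [q hq] := nform_ex hp.
by have [? ? _] := nformP hp hq; exists q.
Qed.

(** The length of a chosen reduced walk. By [reduced_uniq] the choice does not matter, and by
    [dist_walk] this is the distance in the 1-skeleton. *)
Definition dist u v := (size (projT1 (cid (reduced_ex u v)))).-1.

Lemma reduced_uniq u v p q : walk u v p -> walk u v q -> reduced p -> reduced q ->
  swapeq p q.
Proof.
move=> wp wq rp rq.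
exact: nform_homotopic wp (cubed_sc wp wq) (nform_reduced wp rp) (nform_reduced wq rq).
Qed.

Lemma size_reduced u v p : walk u v p -> reduced p -> size p = (dist u v).+1.
Proof.
move=> wp rp; rewrite /dist; case: cid => q /= [wq rq].
rewrite (swapeq_size (reduced_uniq wp wq rp rq)).
by have [r ->] := walk_nnil wq.
Qed.

Lemma dist_walk u v p : walk u v p -> dist u v < size p.
Proof.
move=> wp; have [q hq] := nform_ex wp; have [wq rq sq] := nformP wp hq.
by rewrite -(size_reduced wq rq).
Qed.

Lemma geodesic_ex u v : exists p, [/\ walk u v p, reduced p & size p = (dist u v).+1].
Proof.
by have [p [wp rp]] := reduced_ex u v; exists p; split=> //; exact: size_reduced.
Qed.

Lemma distxx u : dist u u = 0.
Proof. by have := dist_walk (walk0 u); case: dist. Qed.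

Lemma dist_eq0 u v : dist u v = 0 -> u = v.
Proof.
have [p [wp _ sp]] := geodesic_ex u v => e; rewrite e in sp.
case: wp sp => // x w p0 h _ /= [sp].
by have [q eq] := walk_nnil h; move: sp; rewrite eq.
Qed.

Lemma walk_cat u v w p q : walk u v p -> walk v w q -> walk u w (q ++ behead p).
Proof.
move=> wp; elim=> [|x y q0 h IH a] /=; last exact: walkS IH a.
by have [r e] := walk_nnil wp; subst p.
Qed.

Lemma walk_rev u v p : walk u v p -> walk v u (rev p).
Proof.
elim=> [|x w p0 h IH a]; first exact: walk0.
have [r e] := walk_nnil h; subst p0.
rewrite rev_cons -cats1; have := walk_cat (walkS (walk0 w) (adjC a)) IH.
by rewrite /=.
Qed.

Lemma distC u v : dist u v = dist v u.
Proof.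
suff h a b : dist a b <= dist b a by apply/eqP; rewrite eqn_leq !h.
have [p [/walk_rev wp _ e]] := geodesic_ex b a.
by have := dist_walk wp; rewrite size_rev e.
Qed.

Lemma dist_triangle v u w : dist u w <= dist u v + dist v w.
Proof.
have [p [wp _ e]] := geodesic_ex u v; have [q [wq _ e']] := geodesic_ex v w.
by have := dist_walk (walk_cat wp wq); rewrite size_cat size_behead e e' /=; lia.
Qed.

(** Either the longer walk is reduced or, by [reduced_snoc], the edge cancels. Equality never
    occurs: the 1-skeleton is bipartite. *)
Lemma dist_adj u v w : adj v w ->
  dist u w = (dist u v).+1 \/ dist u v = (dist u w).+1.
Proof.
move=> a; have [p [wp rp e]] := geodesic_ex u v.
have [p0 ep] := walk_nnil wp; subst p; case: e => e.
have [rw|/(reduced_snoc rp)[r er]] := pselect (reduced [:: w, v & p0]).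
  by left; have := size_reduced (walkS wp a) rw; rewrite /= e => -[].
right; have wr := (swapeq_walk _ _ er).1 wp.
have [_ _ wr'] := walk_cons2 wr.
have rr := reduced_cons (reduced_swapeq er rp).
have := size_reduced wr' rr; have := swapeq_size er.
by rewrite /= e => -[->] [->].
Qed.

Lemma dist_adjl u v w : adj v w ->
  dist w u = (dist v u).+1 \/ dist v u = (dist w u).+1.
Proof. by rewrite ![dist _ u]distC; exact: dist_adj. Qed.

Lemma adj1 u v : adj u v -> dist u v = 1.
Proof. by move=> /(@dist_adj u); rewrite distxx; case=> // ->. Qed.

Lemma geodesic_last u v : u <> v -> exists2 w, adj w v & dist u v = (dist u w).+1.
Proof.
move=> n; have [p [wp rp e]] := geodesic_ex u v.
case: wp n rp e => // x w p0 h a _ rp /= [e]; exists x => //.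
by rewrite -e (size_reduced h) //; exact: reduced_cons rp.
Qed.

Lemma geodesic_first u v : u <> v -> exists2 w, adj u w & dist u v = (dist w v).+1.
Proof.
move=> n; have [w a e] := geodesic_last (nesym n).
by exists w; [exact: adjC|rewrite ![dist _ v]distC].
Qed.

(** The quadrangle condition of median graphs. The geodesics to w through x and through x' are both
    reduced, hence swap-equivalent, and their fork is the square. *)
Lemma quadrangle u w x x' n : x <> x' -> adj x w -> adj x' w ->
  dist u x = n -> dist u x' = n -> dist u w = n.+1 ->
  exists2 y, sq w x y x' & n = (dist u y).+1.
Proof.
move=> nx a a' dx dx' dw.
have geo z (az : adj z w) (dz : dist u z = n) : exists p,
    [/\ walk u z (z :: p), reduced [:: w, z & p] & walk u w [:: w, z & p]].
  have [p [wp rp e]] := geodesic_ex u z.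
  have [p0 ep] := walk_nnil wp; subst p; exists p0; split=> //; last exact: walkS wp az.
  apply: contrapT => /(reduced_snoc rp)[r er].
  have wr := (swapeq_walk _ _ er).1 wp; have [_ _ wr'] := walk_cons2 wr.
  by have := dist_walk wr'; have := swapeq_size er; move: e => /=; lia.
have [p [p1 p2 p3]] := geo x a dx; have [q [q1 q2 q3]] := geo x' a' dx'.
have [y [r [s1 s2 s3]]] := swapeq_fork nx (reduced_uniq p3 q3 p2 q2).
exists y => //.
have wr := (swapeq_walk _ _ s2).1 p1; have [_ _ wr'] := walk_cons2 wr.
have rr := reduced_cons (reduced_swapeq s2 (reduced_cons p2)).
have := size_reduced wr' rr; have := swapeq_size s2.
by have := size_reduced p1 (reduced_cons p2); rewrite /= dx; lia.
Qed.

Definition between u m v := dist u v = dist u m + dist m v.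

(** A vertex m off the geodesics from u to v has a neighbour closer to both. Step from m towards v:
    if this moves away from u, the next vertex m' has such a neighbour x by induction, and the
    quadrangle condition below m', m and x supplies the one for m. *)
Lemma shortcut u m v : dist u v < dist u m + dist m v ->
  exists x, [/\ adj m x, dist u m = (dist u x).+1 & dist m v = (dist x v).+1].
Proof.
move eqn: (dist m v) => n; elim: n m eqn => [|n IH] m e h.
  by move: h; rewrite (dist_eq0 e); lia.
have nmv : m <> v by move=> emv; move: e; rewrite emv distxx.
have [m' a e'] := geodesic_first nmv.
have [e1|e1] := dist_adj u a; last by exists m'; split=> //; lia.
have em' : dist m' v = n by lia.
have h' : dist u v < dist u m' + n by lia.
have [x [ax dx1 dx2]] := IH m' em' h'.
have nmx : m <> x by move=> emx; move: dx2 e'; rewrite emx; lia.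
have [y s dy] : exists2 y, sq m' m y x & dist u m = (dist u y).+1.
  by apply: quadrangle => //; [exact: adjC|lia].
have amy : adj m y by apply: (@sq_adj X _ _ x m'); sqt.
have axy : adj x y by apply: (@sq_adj X _ _ m m'); sqt.
exists y; split=> //.
by have := dist_adjl v amy; have := dist_adjl v axy; lia.
Qed.

(** Take m as far from u as possible among the vertices between u, v and between u, w; if it is not
    between v and w, [shortcut] finds a farther one. *)
Lemma median u v w : exists m, [/\ between u m v, between u m w & between v m w].
Proof.
pose P k := exists m, [/\ between u m v, between u m w & dist u m = k].
have P0 : P 0 by exists u; rewrite /between distxx; split.
have [k Pk maxk] : exists2 k, P k & forall j, P j -> j <= k.
  have ex : exists k, `[<P k>] by exists 0; exact/asboolP.
  have ub k : `[<P k>] -> k <= dist u v.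
    by move=> /asboolP[m [h _ <-]]; rewrite h leq_addr.
  by have [k /asboolP Pk h] := ex_maxnP ex ub; exists k => // j /asboolP/h.
case: Pk => m [h1 h2 e]; exists m; split=> //.
have := dist_triangle m v w; rewrite leq_eqVlt => /orP[/eqP//|/shortcut[x [a d1 d2]]].
have du : dist u x = k.+1.
  case: (dist_adj u a) => // [|du]; first by rewrite e.
  by have := dist_triangle x u v; rewrite h1 ![dist _ v]distC; lia.
suff : P k.+1 by move=> /maxk; rewrite ltnn.
exists x; split=> //; rewrite /between; rewrite /between in h1 h2; last by lia.
by rewrite (distC x v); rewrite (distC m v) in h1; lia.
Qed.

End Distance.

(** * Hyperplanes *)

Section Halfspaces.
Variable X : cubed.
Implicit Types (u v w x y z a b c : X) (e f : X * X) (H : set (X * X)).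

Lemma closer_opp v a b c d : @sq X a b c d ->
  dist v a < dist v b -> dist v d < dist v c.
Proof.
move=> s h.
have ab : adj a b by apply: (@sq_adj X _ _ c d); sqt.
have bc : adj c b by apply: (@sq_adj X _ _ a d); sqt.
have cd : adj c d by apply: (@sq_adj X _ _ a b); sqt.
have ad : adj a d by apply: (@sq_adj X _ _ c b); sqt.
have e1 := dist_adj v ab; have e2 := dist_adj v bc.
have e3 := dist_adj v cd; have e4 := dist_adj v ad.
rewrite ltnNge; apply/negP => h'.
have nac : a <> c by exact: sq_neq s.
have [y s' ey] : exists2 y, sq b a y c & dist v a = (dist v y).+1.
  by apply: quadrangle => //; lia.
have ey' : y = d by apply: (@sq_uniq X a b c); sqt.
by subst y; lia.
Qed.

Definition pstep e f := f = (e.2, e.1) \/ sq e.1 e.2 f.2 f.1.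
Definition parallel := clos_refl_sym_trans _ pstep.
Definition hyper e : set (X * X) := [set f | parallel e f].

Definition esep e u v : bool :=
  (dist u e.1 < dist u e.2) != (dist v e.1 < dist v e.2).

Lemma pstep_sep e f : adj e.1 e.2 -> pstep e f -> esep e =2 esep f.
Proof.
move=> a [->|s] u v /=; rewrite /esep /=.
  have h x : (dist x e.2 < dist x e.1) = ~~ (dist x e.1 < dist x e.2).
    by have := dist_adj x a; case: ltnP; case: ltnP; lia.
  by rewrite !h; case: (_ < _); case: (_ < _).
suff h x : (dist x e.1 < dist x e.2) = (dist x f.1 < dist x f.2) by rewrite !h.
by apply/idP/idP; apply: closer_opp; sqt.
Qed.

Lemma pstep_adj e f : pstep e f -> adj e.1 e.2 <-> adj f.1 f.2.
Proof.
move=> [->|s] /=; first by split=> /adjC.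
split=> _; first by apply/(@sq_adj X _ _ e.2 e.1); sqt.
by apply/(@sq_adj X _ _ f.2 f.1); sqt.
Qed.

Lemma parallel_adj e f : parallel e f -> adj e.1 e.2 <-> adj f.1 f.2.
Proof. by elim=> [? ? /pstep_adj->|//|? ? _ ->|? ? ? _ -> _ ->]. Qed.

Lemma parallel_sep e f : adj e.1 e.2 -> parallel e f -> esep e =2 esep f.
Proof.
move=> a h; elim: h a => [? ? h a|//|e1 f1 h IH a|e1 f1 g1 h1 IH1 h2 IH2 a] u v.
- by apply: pstep_sep.
- by rewrite IH //; apply/(parallel_adj h).
- by rewrite IH1 // IH2 //; apply/(parallel_adj h1).
Qed.

(** An edge joining the two halfspaces of (u, u') is parallel to it. With c the next vertex from b
    towards u', the quadrangle condition seen from u completes b, a, c to a square, whose edge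
    opposite to (a, b) is nearer to (u, u'). *)
Lemma closer_parallel a b u u' : adj a b -> adj u u' ->
  dist a u < dist a u' -> dist b u' < dist b u -> parallel (u, u') (a, b).
Proof.
move=> ab uu; move e: (dist a u) => n; elim: n a b ab e => [|n IH] a b ab e h1 h2.
  have ea := dist_eq0 e; subst a.
  have := dist_adjl u' ab; rewrite (adj1 uu) => -[e1|[e1]]; last first.
    by have -> := dist_eq0 (esym e1); exact: rst_refl.
  by have := dist_adjl u ab; rewrite distxx; lia.
have e1 := dist_adj a uu; have e2 := dist_adj b uu.
have e3 := dist_adjl u ab; have e4 := dist_adjl u' ab.
have nbu : b <> u' by move=> eb; subst b; rewrite distxx in e4; lia.
have [c ca dc] := geodesic_first nbu.
have f1 := dist_adj c uu; have f2 := dist_adjl u ca.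
have nac : a <> c by move=> eac; subst c; lia.
have [d s dd] : exists2 d, sq b a d c & dist u a = (dist u d).+1.
  apply: quadrangle => //; first exact: adjC.
  - by rewrite ![dist u _]distC; lia.
  - by rewrite ![dist u _]distC; lia.
rewrite !(distC u) in dd.
have cd : adj d c by apply: (@sq_adj X _ _ b a); sqt.
have da : adj d a by apply: (@sq_adj X _ _ b c); sqt.
have g1 := dist_adj d uu; have g2 := dist_adjl u' da; have g3 := dist_adjl u' cd.
apply: (@rst_trans _ _ _ (d, c)).
  by apply: IH => //; lia.
by apply: rst_step; right => /=; sqt.
Qed.

Lemma sep_parallel e f : adj e.1 e.2 -> adj f.1 f.2 -> esep e f.1 f.2 -> parallel e f.
Proof.
case: e f => [u u'] [a b] /= uu ab; rewrite /esep /= => h.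
have := dist_adj a uu; have := dist_adj b uu => h1 h2.
have [h3|h3] := ltnP (dist a u) (dist a u').
  by apply: closer_parallel => //; rewrite h3 /= in h; lia.
apply: (@rst_trans _ _ _ (b, a)); last by apply: rst_step; left.
apply: closer_parallel => //; first exact: adjC; last by lia.
by rewrite ltnNge h3 /= in h; move: h; case: ltnP.
Qed.

Lemma hyper_parallel e f : (hyper e = hyper f) <-> parallel e f.
Proof.
split=> [h|h].
  have : hyper f f by exact: rst_refl.
  by rewrite -h.
apply/seteqP; split=> g hg; first by apply: rst_trans hg; exact: rst_sym.
exact: rst_trans h hg.
Qed.

Definition is_hyper H := exists2 e, adj e.1 e.2 & H = hyper e.

(* Junk value: sets of edges that are not hyperplanes separate nothing. *)
Definition hsep H u v : bool :=
  `[< exists e, [/\ adj e.1 e.2, H = hyper e & esep e u v] >].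

Lemma hsepE e u v : adj e.1 e.2 -> hsep (hyper e) u v = esep e u v.
Proof.
move=> a; apply/asboolP/idP => [[f [_ /hyper_parallel h]]|s]; last by exists e.
by rewrite -(parallel_sep a h).
Qed.

Lemma hsep_hyper H u v : hsep H u v -> is_hyper H.
Proof. by move=> /asboolP[e [a -> _]]; exists e. Qed.

Lemma hsepP H : is_hyper H -> exists s : X -> bool, forall u v, hsep H u v = (s u != s v).
Proof.
move=> [e a ->]; exists (fun u => dist u e.1 < dist u e.2) => u v.
by rewrite hsepE.
Qed.

Lemma hsepA H u v w : hsep H u w = hsep H u v (+) hsep H v w.
Proof.
have [/hsepP[s hs]|n] := pselect (is_hyper H).
  by rewrite !hs; case: (s u); case: (s v); case: (s w).
have h x y : hsep H x y = false by apply/negP => /hsep_hyper.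
by rewrite !h.
Qed.

Lemma hsepxx H u : hsep H u u = false.
Proof. by have := hsepA H u u u; case: hsep. Qed.

Lemma hsepC H u v : hsep H u v = hsep H v u.
Proof. by have := hsepA H u v u; rewrite hsepxx; case: hsep; case: hsep. Qed.

Lemma hsep_edge e a b : adj e.1 e.2 -> adj a b ->
  hsep (hyper e) a b = `[< hyper e = hyper (a, b) >].
Proof.
move=> ae ab; rewrite hsepE //; apply/idP/asboolP => [h|/hyper_parallel h].
  by apply/hyper_parallel; exact: sep_parallel.
by rewrite (parallel_sep ae h) /esep /= !distxx (adj1 ab) distC (adj1 ab).
Qed.

Lemma hsep_edgeP H a b : adj a b -> hsep H a b -> H = hyper (a, b).
Proof.
by move=> ab /[dup] /hsep_hyper[e ae ->]; rewrite hsep_edge // => /asboolP.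
Qed.

Lemma hsep_adj a b : adj a b -> hsep (hyper (a, b)) a b.
Proof. by move=> ab; rewrite hsep_edge //; apply/asboolP. Qed.

(** A geodesic crosses no hyperplane twice: the hyperplane of its last edge has u and w on one side,
    so it is new. Hence distance counts separating hyperplanes. *)
Lemma hseps_ex u v : exists s : seq (set (X * X)),
  [/\ uniq s, forall H, (H \in s) = hsep H u v & size s = dist u v].
Proof.
move e: (dist u v) => n; elim: n v e => [|n IH] v e.
  rewrite (dist_eq0 e); exists [::]; split=> // H.
  by rewrite hsepxx.
have nuv : u <> v by move=> euv; move: e; rewrite euv distxx.
have [w wv dw] := geodesic_last nuv.
have [|s [us hs ss]] := IH w; first by lia.
exists (hyper (w, v) :: s); split=> /=; last by rewrite ss.
- rewrite us hs andbT hsepE //= /esep /= !distxx (adj1 wv).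
  by have -> : dist u w < dist u v by lia.
- move=> H; rewrite in_cons hs [RHS](hsepA H u w v).
  have [-> /=|nH] := eqVneq H (hyper (w, v)).
    rewrite hsep_adj // addbT hsepE //= /esep /= !distxx (adj1 wv).
    by have -> : dist u w < dist u v by lia.
  suff -> : hsep H w v = false by rewrite addbF.
  by apply/negP => /(hsep_edgeP wv) h; move: nH; rewrite h eqxx.
Qed.

Definition hseps u v := projT1 (cid (hseps_ex u v)).

Lemma mem_hseps u v H : (H \in hseps u v) = hsep H u v.
Proof. by rewrite /hseps; case: cid => s [? ? ?] /=. Qed.

Lemma uniq_hseps u v : uniq (hseps u v).
Proof. by rewrite /hseps; case: cid => s [? ? ?] /=. Qed.

Lemma size_hseps u v : size (hseps u v) = dist u v.
Proof. by rewrite /hseps; case: cid => s [? ? ?] /=. Qed.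

(** A count: what separates u from v separates u from m or m from v, and betweenness makes the two
    lists equally long, hence equal. *)
Lemma between_sep H u m v : between u m v -> hsep H u m -> hsep H u v.
Proof.
move=> b s; have sub : {subset hseps u v <= hseps u m ++ hseps m v}.
  move=> K; rewrite mem_cat !mem_hseps (hsepA K u m v).
  by case: hsep; case: hsep.
have e : size (hseps u m ++ hseps m v) <= size (hseps u v).
  by rewrite size_cat !size_hseps b.
have [_ h] := uniq_min_size (uniq_hseps u v) sub e.
by rewrite -mem_hseps h mem_cat mem_hseps s.
Qed.

Lemma between_same H u m v : between u m v -> hsep H u v = false -> hsep H u m = false.
Proof. by move=> b h; apply/negP => /(between_sep b); rewrite h. Qed.

End Halfspaces.

Section Halfspaces2.
Variable X : cubed.
Implicit Types (u v w x y z a b c : X) (H K : set (X * X)).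

(** The median of u, z, w lies beyond H, being between z and w, and it is nearer to u than z unless
    it is z. *)
Lemma gate H u z w : (forall z', hsep H u z' -> dist u z <= dist u z') ->
  hsep H u z -> hsep H u w -> between u z w.
Proof.
move=> near hz hw; have [m [m1 m2 m3]] := median u z w.
have hzw : hsep H z w = false by rewrite (hsepA H z u w) hsepC hz hw.
have hm : hsep H u m.
  by rewrite (hsepA H u z m) hz (between_same m3 hzw).
have e : dist m z = 0 by have := near _ hm; rewrite /between in m1; lia.
by rewrite (dist_eq0 e) in m2.
Qed.

(** Pairwise consistent sides that differ from those of u at finitely many hyperplanes come from a
    vertex. Walk from u towards the nearest vertex beyond a member of D: by [gate] and pairwise
    consistency the first edge crosses a member of D, and the remaining list is shorter. *)
Lemma realize u (D : seq (set (X * X))) :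
  (forall h k, exists v, hsep h u v = (h \in D) /\ hsep k u v = (k \in D)) ->
  exists v, forall h, hsep h u v = (h \in D).
Proof.
have [n] := ubnP (size D); elim: n u D => // n IH u D sD cons.
have [e|/set0P[h0 hD0]] := eqVneq [set` D]%classic set0.
  exists u => h; rewrite hsepxx; apply/esym/negP => hD.
  by have : (set0 : set (set (X * X))) h by rewrite -e.
pose P k := `[< exists h z, [/\ h \in D, hsep h u z & dist u z = k] >].
have exP : exists k, P k.
  have [z [hz _]] := cons h0 h0; exists (dist u z); apply/asboolP.
  by exists h0, z; split=> //; rewrite hz.
have [k /asboolP[h [z [hD hz dz]]] mink] := ex_minnP exP.
have near g z' : g \in D -> hsep g u z' -> dist u z <= dist u z'.
  by move=> gD gz; rewrite dz; apply: mink; apply/asboolP; exists g, z'.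
have nuz : u <> z by move=> e; move: hz; rewrite e hsepxx.
have [x ux dx] := geodesic_first nuz.
have bx : between u x z by rewrite /between dx (adj1 ux).
have hx g : hsep g u x = (g == hyper (u, x)).
  apply/idP/eqP => [/(hsep_edgeP ux)//|->]; exact: hsep_adj.
have lD : hyper (u, x) \in D.
  apply/contraT => lD; have [w []] := cons h (hyper (u, x)).
  rewrite hD (negbTE lD) => hw lw.
  have := gate (near h ^~ hD) hz hw => bz.
  have : hsep (hyper (u, x)) u z by apply: between_sep bx _; exact: hsep_adj.
  by move=> /(between_sep bz); rewrite lw.
pose D' := [seq g <- D | g != hyper (u, x)].
have memD' g : (g \in D') = (g \in D) (+) (g == hyper (u, x)).
  by rewrite mem_filter; case: eqP => [->|]; rewrite ?lD ?addbF.
have [|g g'|v hv] := IH x D'.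
- move: sD; rewrite -(count_predC (pred1 (hyper (u, x))) D) size_filter.
  have := lD; rewrite -has_pred1 has_count; case: count => // c1 _.
  by rewrite addSn ltnS => /(leq_trans _); apply; rewrite ltnS leq_addl.
- have [v [v1 v2]] := cons g g'; exists v; rewrite !memD'.
  by rewrite (hsepA g x u v) (hsepA g' x u v) !(hsepC _ x u) !hx v1 v2;
    split; rewrite addbC.
- by exists v => g; rewrite (hsepA g u x v) hx hv memD' addbCA addbb addbF.
Qed.

Definition hcross H K := forall u (s t : bool), exists v, hsep H u v = s /\ hsep K u v = t.

Lemma hcrossC H K : hcross H K -> hcross K H.
Proof. by move=> h u s t; have [v [? ?]] := h u t s; exists v. Qed.

Lemma hcross_neq H K : hcross H K -> X -> H <> K.
Proof. by move=> h u e; have [v [h1 h2]] := h u true false; move: h1 h2; rewrite e => ->. Qed.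

(** Descent on the sum of the distances to the n hyperplanes. If some distance exceeds 1, a step
    towards that hyperplane crosses none of the others and does not increase their distances. *)
Lemma crossing_corner n (H : 'I_n -> set (X * X)) u0 :
  (forall i, is_hyper (H i)) -> (forall i j, i != j -> hcross (H i) (H j)) ->
  exists u (a : 'I_n -> X), forall i, adj u (a i) /\ H i = hyper (u, a i).
Proof.
move=> hypH cr.
have far u i : exists z, hsep (H i) u z.
  have [[x y] /= xy e] := hypH i; have := hsepA (H i) x u y.
  rewrite {1}e hsep_adj //; case E : (hsep _ x u) => /=; last by exists y.
  by exists x; rewrite hsepC.
have [z0 hz0] := choice (far u0).
have [N] := ubnP (\sum_i dist u0 (z0 i)).
elim: N u0 z0 hz0 => // N IH u z hz sN.
have [[i [z' [hz' lt]]]|nn] := pselect (exists i z', hsep (H i) u z' /\ dist u z' < dist u (z i)).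
  apply: (IH u (fun j => if j == i then z' else z j)).
    by move=> j; case: eqP => // ->.
  rewrite ltnS in sN; apply: leq_trans _ sN; rewrite (bigD1 i) //= [X in _ < X](bigD1 i) //= eqxx.
  rewrite -addSn leq_add //; apply: leq_sum => j /negbTE ->; exact: leqnn.
have near i z' : hsep (H i) u z' -> dist u (z i) <= dist u z'.
  by move=> h; rewrite leqNgt; apply/negP => h'; apply: nn; exists i, z'.
have pos i : 0 < dist u (z i).
  rewrite lt0n; apply/eqP => /(@dist_eq0 X) e.
  by have := hz i; rewrite -e hsepxx.
have [[i hi]|all1] := pselect (exists i, 1 < dist u (z i)); last first.
  exists u, z => i.
  have d1 : dist u (z i) = 1.
    by have := pos i; case: ltngtP (leqnn 1) => // _ _; case: (ltngtP 1 (dist u (z i))) => // h _; case: all1; exists i.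
  have az : adj u (z i).
    have nuz : u <> z i by move=> e; move: d1; rewrite -e distxx.
    have [w uw] := geodesic_first nuz.
    by rewrite d1 => -[/esym/(@dist_eq0 X) <-].
  by split=> //; apply: hsep_edgeP.
have nuz : u <> z i by move=> e; move: hi; rewrite -e distxx.
have [x ux dx] := geodesic_first nuz.
have bx : between u x (z i) by rewrite /between dx (adj1 ux).
have nl j : hsep (H j) u x = false.
  apply/negP => hj; have [ej|nj] := eqVneq j i.
    by have := near i x; rewrite -ej => /(_ hj); rewrite ej (adj1 ux); lia.
  have [w [w1 w2]] := cr j i nj u false true.
  have := gate (near i) (hz i) w2 => bz.
  by have := between_sep bz (between_sep bx hj); rewrite w1.
have step j : exists z', hsep (H j) x z' /\ dist x z' + (j == i) <= dist u (z j).
  have same w : hsep (H j) x w = hsep (H j) u w.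
    by rewrite (hsepA (H j) x u w) hsepC nl.
  have [->|nj] := eqVneq j i.
    by exists (z i); rewrite (hsepA (H i) x u) hsepC nl hz dx /= addn1.
  (* With w beyond both hyperplanes, the median of x, [z j] and w is still beyond [H j]. It is no
     farther from x than [z j] is from u, because [z i] and [z j] are gates towards w and x lies on
     the way to [z i]. *)
  have [w [w1 w2]] := cr j i nj u true true.
  have b1 := gate (near j) (hz j) w1; have b2 := gate (near i) (hz i) w2.
  have [m [m1 m2 m3]] := median x (z j) w.
  exists m; rewrite addn0; split.
    rewrite same (hsepA (H j) u (z j) m) hz (between_same m3) //.
    by rewrite (hsepA (H j) (z j) u w) hsepC hz w1.
  have t1 := dist_triangle u x (z j); have t2 := dist_triangle (z i) x w.
  have e1 := adj1 ux; have e2 := distC x u; have e3 := distC m (z j).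
  rewrite /between in bx b1 b2 m1 m2 m3; lia.
have [z' hz'] := choice step.
apply: (IH x z'); first by move=> j; have [] := hz' j.
rewrite ltnS in sN; apply: leq_trans _ sN; rewrite (bigD1 i) //= [X in _ < X](bigD1 i) //=.
rewrite -addSn leq_add //.
  by have [_] := hz' i; rewrite eqxx addn1.
by apply: leq_sum => j /negbTE nj; have [_] := hz' j; rewrite nj addn0.
Qed.

Lemma corner_square u a b : adj u a -> adj u b ->
  hcross (hyper (u, a)) (hyper (u, b)) -> exists c, sq u a c b.
Proof.
move=> ua ub cr; have [w [wa wb]] := cr u true true.
have near x (ux : adj u x) z : hsep (hyper (u, x)) u z -> dist u x <= dist u z.
  rewrite (adj1 ux) lt0n => h; apply/eqP => /(@dist_eq0 X) e.
  by move: h; rewrite -e hsepxx.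
have ba := gate (near a ua) (hsep_adj ua) wa.
have bb := gate (near b ub) (hsep_adj ub) wb.
rewrite /between (adj1 ua) in ba; rewrite /between (adj1 ub) in bb.
have nab : a <> b by move=> e; apply: (hcross_neq cr u); rewrite e.
have [y s _] : exists2 y, sq u a y b & dist w a = (dist w y).+1.
  by apply: quadrangle => //; [exact: adjC|exact: adjC| |]; rewrite !(distC w); lia.
by exists y.
Qed.

End Halfspaces2.

(** * Groups acting on spaces with walls *)

(** What the group-theoretic part needs of hyperplanes: finitely many of them separate two points,
    separation is additive mod 2, finite consistent changes of sides are realized, and point
    stabilizers are finite. Cubes no longer appear. *)
Record wallAct (G : groupType) := WallAct {
  pt : choiceType;
  wl : choiceType;
  gp : G -> pt -> pt;
  gw : G -> wl -> wl;
  sep : wl -> pt -> pt -> bool;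
  seps : pt -> pt -> seq wl;
  gp1 : forall u, gp 1%g u = u;
  gpM : forall g h u, gp (g * h)%g u = gp g (gp h u);
  gw1 : forall h, gw 1%g h = h;
  gwM : forall g h w, gw (g * h)%g w = gw g (gw h w);
  mem_seps : forall u v h, (h \in seps u v) = sep h u v;
  uniq_seps : forall u v, uniq (seps u v);
  sepA : forall h u v w, sep h u w = sep h u v (+) sep h v w;
  sepG : forall g h u v, sep (gw g h) (gp g u) (gp g v) = sep h u v;
  sep_eq : forall u v, (forall h, sep h u v = false) -> u = v;
  sep_realize : forall u (D : seq wl),
    (forall h k, exists v, sep h u v = (h \in D) /\ sep k u v = (k \in D)) ->
    exists v, forall h, sep h u v = (h \in D);
  stab_fin : forall u, exists s : seq G, forall g, gp g u = u -> g \in s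
}.

Lemma finite_by_key (A : choiceType) (T : finType) (P : A -> Prop) (R : A -> T -> Prop) :
  (forall a, P a -> exists t, R a t) ->
  (forall a b t, P a -> P b -> R a t -> R b t -> a = b) ->
  exists s : seq A, forall a, P a -> a \in s.
Proof.
move=> ex inj.
pose f t : seq A := match pselect (exists a, P a /\ R a t) with
  | left h => [:: projT1 (cid h)] | right _ => [::] end.
exists (flatten [seq f t | t <- enum T]) => a Pa; have [t Rt] := ex a Pa.
apply/flattenP; exists (f t); first by apply: map_f; rewrite mem_enum.
rewrite /f; case: pselect => [h|[]]; last by exists a.
by case: cid => b [Pb Rb] /=; rewrite inE; apply/eqP; exact: inj Rt Rb.
Qed.

Section WallAct.
Variables (G : groupType) (A : wallAct G) (x0 : pt A).
Implicit Types (g z p q : G) (u v y : pt A) (h k l f : wl A) (F : seq (wl A)).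

Local Notation o g := (gp g x0).

Lemma sepxx h u : sep h u u = false.
Proof. by have := sepA h u u u; case: sep. Qed.

Lemma sepC h u v : sep h u v = sep h v u.
Proof. by have := sepA h u v u; rewrite sepxx; case: sep; case: sep. Qed.

Lemma gpK g : cancel (@gp _ A g) (@gp _ A g^-1%g).
Proof. by move=> u; rewrite -gpM mulVg gp1. Qed.

Lemma gpVK g : cancel (@gp _ A g^-1%g) (@gp _ A g).
Proof. by move=> u; rewrite -gpM mulgV gp1. Qed.

Lemma gwK g : cancel (@gw _ A g) (@gw _ A g^-1%g).
Proof. by move=> u; rewrite -gwM mulVg gw1. Qed.

Lemma gwVK g : cancel (@gw _ A g^-1%g) (@gw _ A g).
Proof. by move=> u; rewrite -gwM mulgV gw1. Qed.

Lemma sepGl g h u v : sep (gw g h) u v = sep h (gp g^-1%g u) (gp g^-1%g v).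
Proof. by rewrite -(sepG g h) !gpVK. Qed.

Definition wpar h k := forall g g', sep h (o g) (o g') = sep k (o g) (o g').

Definition wcross h k := forall g (s t : bool),
  exists g', sep h (o g) (o g') = s /\ sep k (o g) (o g') = t.

Definition essential h := exists g g', sep h (o g) (o g').

Definition crossing_fam F := forall h k, h \in F -> k \in F -> h <> k -> wcross h k.

Definition fin_crossing (W0 : seq (wl A)) := forall F,
  (forall h, h \in F -> essential h) -> crossing_fam F ->
  exists z, forall h, h \in F -> gw z^-1%g h \in W0.

(* The points of the median hull of the orbit. *)
Definition hull y := forall h k, exists g, sep h y (o g) = false /\ sep k y (o g) = false.

(** The obstruction to crossing h from y is a wall k lying in between, so an orbit point beyond h
    and not beyond k is required. Walls parallel to h are exempt, since they can only be crossed
    together with it. *)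
Definition flippable y h := essential h /\
  forall k, ~ wpar h k -> exists g, sep h y (o g) /\ sep k y (o g) = false.

Lemma wcross_pt y h k : wcross h k <->
  forall s t : bool, exists g, sep h y (o g) = s /\ sep k y (o g) = t.
Proof.
split=> [c s t|c g s t].
  have [g [h1 h2]] := c 1%g (s (+) sep h y (o 1%g)) (t (+) sep k y (o 1%g)).
  exists g; rewrite (sepA h y (o 1%g)) (sepA k y (o 1%g)) h1 h2.
  by split; rewrite addbC -addbA addbb addbF.
have [g' [h1 h2]] := c (s (+) sep h y (o g)) (t (+) sep k y (o g)).
exists g'; rewrite (sepA h _ y) (sepA k _ y) h1 h2 !(sepC _ (o g)).
by split; rewrite addbC -addbA addbb addbF.
Qed.

Lemma wcrossC h k : wcross h k -> wcross k h.
Proof. by move=> c g s t; have [g' [? ?]] := c g t s; exists g'. Qed.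

Lemma wcross_essential h k : wcross h k -> essential h.
Proof. by move=> c; have [g [h1 _]] := c 1%g true true; exists 1%g, g. Qed.

Lemma wpar_cross h k : wpar h k -> ~ wcross h k.
Proof. by move=> p c; have [g [h1 h2]] := c 1%g true false; rewrite p h2 in h1. Qed.

Lemma hull_orbit g : hull (o g).
Proof. by move=> h k; exists g; rewrite !sepxx. Qed.

Lemma hull_par y h k g : hull y -> wpar h k -> sep h y (o g) = sep k y (o g).
Proof.
move=> My p; have [g0 [h1 h2]] := My h k.
by rewrite (sepA h y (o g0)) (sepA k y (o g0)) h1 h2 p.
Qed.

Lemma hull_essential y h g : hull y -> sep h y (o g) -> essential h.
Proof.
move=> My s; have [g0 [h1 _]] := My h h; exists g0, g.
by move: s; rewrite (sepA h y (o g0)) h1.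
Qed.

Definition flip_of y h y' := forall l, sep l y y' = `[< wpar h l >].

(** All walls parallel to h separate y from one orbit point beyond h, so they are finitely many.
    Consistency of the new sides is checked on orbit points, which also keeps the new point in the
    hull. *)
Lemma flip_ex y h : hull y -> flippable y h ->
  exists y', hull y' /\ flip_of y h y'.
Proof.
move=> My fl; have [[g1 [g2 e]] fy] := fl.
have [g hg] : exists g, sep h y (o g).
  case E : (sep h y (o g1)); first by exists g1.
  by exists g2; rewrite (sepA h y (o g1)) E e.
pose D := [seq l <- seps y (o g) | `[< wpar h l >]].
have memD l : (l \in D) = `[< wpar h l >].
  rewrite mem_filter mem_seps; case: asboolP => //= p.
  by rewrite -(hull_par g My p).
have tw c : wpar h c -> sep c y (o g) by move=> p; rewrite -(hull_par g My p).
have quad a b : exists g', sep a y (o g') = `[< wpar h a >] /\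
    sep b y (o g') = `[< wpar h b >].
  case: asboolP => pa; case: asboolP => pb.
  - by exists g; rewrite !tw.
  - have [g' [e1 e2]] := fy _ pb; exists g'.
    by rewrite -(hull_par g' My pa) e1.
  - have [g' [e1 e2]] := fy _ pa; exists g'.
    by rewrite -(hull_par g' My pb) e1.
  - exact: My.
have [|y' hy'] := @sep_realize _ A y D.
  move=> a b; have [g' [e1 e2]] := quad a b.
  by exists (o g'); rewrite e1 e2 !memD.
exists y'; split; last by move=> l; rewrite hy' memD.
move=> a b; have [g' [e1 e2]] := quad a b; exists g'.
by rewrite (sepA a y' y) (sepA b y' y) !(sepC _ y' y) !hy' !memD e1 e2 !addbb.
Qed.

Lemma flip_stay y y' h f : hull y -> flip_of y h y' -> flippable y f ->
  f = h \/ wcross h f -> flippable y' f.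
Proof.
move=> My fy [ef ff] d; split=> // k nk.
have tr l g : sep l y' (o g) = `[< wpar h l >] (+) sep l y (o g).
  by rewrite (sepA l y' y) (sepC l y') fy.
case: d => [e|c].
  subst f; have [g [e1 e2]] := My h k; exists g.
  by rewrite !tr e1 e2 !addbF (asboolF nk); split=> //; apply/asboolP.
have nhf : `[< wpar h f >] = false by apply/asboolPn => /wpar_cross.
have [p|n] := pselect (wpar h k).
  have [g [e1 e2]] := (wcross_pt y h f).1 c true true; exists g.
  by rewrite !tr nhf e2 -(hull_par g My p) e1; split=> //; rewrite (asboolT p).
by have [g [e1 e2]] := ff k nk; exists g; rewrite !tr nhf e1 e2 (asboolF n).
Qed.

(** Choose a wall nearest to y. When h is not flippable, some k not parallel to h has all orbit
    points beyond h beyond it too; P passes to k by assumption, and [mu], the number of such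
    intermediate walls, drops. *)
Lemma flippable_ex (P : wl A -> Prop) y h0 g0 : hull y -> P h0 -> sep h0 y (o g0) ->
  (forall h k, P h -> (forall g, sep h y (o g) -> sep k y (o g)) -> P k) ->
  exists h, [/\ P h, sep h y (o g0) & flippable y h].
Proof.
move=> My P0 s0 up.
pose mu h := size [seq l <- seps y (o g0) | `[< forall g, sep h y (o g) -> sep l y (o g) >]].
have [n] := ubnP (mu h0); elim: n h0 P0 s0 => // n IH h Ph sh mh.
have [fl|nf] := pselect (flippable y h); first by exists h.
have [k [nk hk]] : exists k, ~ wpar h k /\ forall g, sep h y (o g) -> sep k y (o g).
  apply: contrapT => no; apply: nf; split; first exact: hull_essential sh.
  move=> k nk; apply: contrapT => nq; apply: no; exists k; split=> // g hg.
  by apply: contraT => kg; case: nq; exists g; split=> //; exact: negbTE.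
apply: (IH k); [exact: up hk|exact: hk|].
rewrite ltnS in mh; apply: leq_trans mh; rewrite /mu.
have [g [hg kg]] : exists g, sep k y (o g) /\ sep h y (o g) = false.
  apply: contrapT => no; apply: nk => g g'.
  have e j : sep h y (o j) = sep k y (o j).
    apply/idP/idP; first exact: hk.
    by move=> kj; apply: contraT => hj; case: no; exists j; split=> //; exact: negbTE.
  by rewrite (sepA h _ y) (sepA k _ y) !(sepC _ _ y) !e.
set s1 := [seq l <- _ | _]; set s2 := [seq l <- _ | _].
apply: (@uniq_leq_size _ (h :: s1)).
  rewrite /= filter_uniq ?uniq_seps // andbT mem_filter.
  by apply/negP => /andP[/asboolP/(_ _ hg)]; rewrite kg.
move=> l; rewrite in_cons mem_filter => /orP[/eqP->|/andP[/asboolP kl lm]].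
  by rewrite mem_filter mem_seps sh andbT; apply/asboolP.
by rewrite mem_filter lm andbT; apply/asboolP => j /hk/kl.
Qed.

Lemma sepGo g h a b : sep (gw g h) (o a) (o b) = sep h (o (g^-1 * a)%g) (o (g^-1 * b)%g).
Proof. by rewrite sepGl -!gpM. Qed.

Lemma wcrossG g h k : wcross h k -> wcross (gw g h) (gw g k).
Proof.
move=> c a s t; have [b [e1 e2]] := c (g^-1 * a)%g s t.
by exists (g * b)%g; rewrite !sepGo !mulKg.
Qed.

Lemma hullG g y : hull y -> hull (gp g y).
Proof.
move=> My h k; have [a [e1 e2]] := My (gw g^-1%g h) (gw g^-1%g k).
have tr l : sep l (gp g y) (o (g * a)%g) = sep (gw g^-1%g l) y (o a).
  by rewrite gpM -{1}[l](gwVK g) sepG.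
by exists (g * a)%g; rewrite !tr.
Qed.

Lemma essentialG g h : essential h -> essential (gw g h).
Proof. by move=> [a [b e]]; exists (g * a)%g, (g * b)%g; rewrite sepGo !mulKg. Qed.

Lemma flippableG g y h : flippable y h -> flippable (gp g y) (gw g h).
Proof.
move=> [e f]; split; first exact: essentialG.
move=> k nk; have [|a [e1 e2]] := f (gw g^-1%g k).
  move=> p; apply: nk; rewrite -[k](gwVK g) => a b.
  by rewrite sepGo [RHS]sepGo; exact: p.
exists (g * a)%g; rewrite gpM sepG e1; split=> //.
by rewrite -[k](gwVK g) sepG e2.
Qed.

Definition max_crossing y F := [/\ forall f, f \in F -> flippable y f,
  crossing_fam F & forall k, ~ forall f, f \in F -> wcross k f].

(** A point pinned down by a maximal crossing family inside the translate by z of [W0]. By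
    [max_crossing_uniq] only finitely many points are near a given z. *)
Definition near (W0 : seq (wl A)) z y := hull y /\
  exists F, (forall f, f \in F -> gw z^-1%g f \in W0) /\ max_crossing y F.

Lemma nearG W0 g z y : near W0 z y -> near W0 (g * z)%g (gp g y).
Proof.
move=> [My [F [FW [fl cr mx]]]]; split; first exact: hullG.
exists (map (gw g) F); split.
  by move=> _ /mapP[f /FW h ->]; rewrite invgM gwM gwK.
split=> [_ /mapP[f /fl h ->]|_ _ /mapP[f fF ->] /mapP[f' fF' ->] ne|k hk].
- exact: flippableG.
- by apply: wcrossG; apply: cr => // e; apply: ne; rewrite e.
- apply: (mx (gw g^-1%g k)) => f fF; rewrite -[f](gwK g).
  by apply: wcrossG; apply: hk; exact: map_f.
Qed.

(** A wall k separating y1 from y2 crosses every f in F: flippability of f at y1 and at y2, and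
    membership of both in the hull, provide orbit points in the four quarter-spaces. This
    contradicts maximality. *)
Lemma max_crossing_uniq y1 y2 F : hull y1 -> hull y2 ->
  max_crossing y1 F -> max_crossing y2 F ->
  (forall f, f \in F -> sep f y1 y2 = false) -> y1 = y2.
Proof.
move=> M1 M2 [fl1 _ mx] [fl2 _ _] same; apply: (@sep_eq _ A) => k.
apply/negP => sk; apply: (mx k) => f fF.
have npar : ~ wpar f k.
  move=> p; have [g [e1 e2]] := M1 f k.
  have := hull_par g M2 p.
  by rewrite (sepA f y2 y1) (sepA k y2 y1) !(sepC _ y2 y1) sk same // e1 e2.
apply: wcrossC; apply/(wcross_pt y1) => s t.
have q s' : exists g, sep f y1 (o g) = s' /\ sep k y1 (o g) = false.
  case: s'; first by have [_ /(_ _ npar)] := fl1 _ fF.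
  exact: M1.
have q' s' : exists g, sep f y1 (o g) = s' /\ sep k y1 (o g) = true.
  have tr g : sep f y1 (o g) = sep f y2 (o g) by rewrite (sepA f y1 y2) same.
  have tr' g : sep k y1 (o g) = ~~ sep k y2 (o g) by rewrite (sepA k y1 y2) sk.
  case: s'.
    have [_ /(_ _ npar)[g [e1 e2]]] := fl2 _ fF.
    by exists g; rewrite tr tr' e1 e2.
  by have [g [e1 e2]] := M2 f k; exists g; rewrite tr tr' e1 e2.
by case: t.
Qed.

Lemma near_fin W0 : exists s : seq (pt A), forall y, near W0 1%g y -> y \in s.
Proof.
pose w i := tnth (in_tuple W0) i.
pose R y (t : {ffun 'I_(size W0) -> bool * bool}) := exists F,
  [/\ forall f, f \in F -> f \in W0, max_crossing y F &
      forall i, t i = (w i \in F, sep (w i) x0 y)].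
apply: (@finite_by_key _ _ _ R) => [y [My [F [FW mx]]]|y1 y2 t].
  exists [ffun i => (w i \in F, sep (w i) x0 y)]; exists F; split=> // [f /FW|i].
    by rewrite invg1 gw1.
  by rewrite ffunE.
move=> [M1 _] [M2 _] [F1 [W1 mx1 e1]] [F2 [W2 mx2 e2]].
have wP f : f \in W0 -> exists i, f = w i.
  by move=> fW; exact/tnthP.
have eF f : (f \in F1) = (f \in F2).
  apply/idP/idP => fF.
    by have [i e] := wP f (W1 _ fF); have := e1 i; rewrite e2 -e fF => -[].
  by have [i e] := wP f (W2 _ fF); have := e1 i; rewrite e2 -e fF => -[].
apply: (max_crossing_uniq M1 M2 mx1).
  have [fl cr mx] := mx2; split=> [f|f g|k hk]; rewrite ?eF; [exact: fl|exact: cr|].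
  by apply: (mx k) => f; rewrite -eF; exact: hk.
move=> f fF; have [i e] := wP f (W1 _ fF); have := e1 i; rewrite e2 -e => -[_ es].
by rewrite (sepA f y1 x0) (sepC f y1) es addbb.
Qed.

(** Greedy extension, stopped by the bound that [fin_crossing] puts on the size of a crossing
    family. Maximality is against all walls whereas members must be flippable: a wall crossing all
    of F is first moved towards y by [flippable_ex], which preserves these crossings. *)
Lemma max_crossing_ex W0 y h : fin_crossing W0 -> hull y -> flippable y h ->
  exists F, h \in F /\ max_crossing y F.
Proof.
move=> fin My flh.
pose good F := [/\ uniq F, h \in F, forall f, f \in F -> flippable y f & crossing_fam F].
have bound F : good F -> size F <= size W0.
  move=> [uF _ fl cr]; have [|z hz] := fin F _ cr; first by move=> f /fl[].
  rewrite -(size_map (gw z^-1%g)); apply: uniq_leq_size.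
    by rewrite map_inj_uniq //; exact: (can_inj (gwK _)).
  by move=> _ /mapP[f fF ->]; exact: hz.
have g0 : good [:: h].
  split=> // [|f|f k]; rewrite ?mem_head // !inE; first by move=> /eqP->.
  by move=> /eqP-> /eqP->.
have ext F : good F -> ~ max_crossing y F -> exists k, good (k :: F).
  move=> [uF hF fl cr] nm.
  have [k hk] : exists k, forall f, f \in F -> wcross k f.
    by apply: contrapT => no; apply: nm; split=> // k hk; apply: no; exists k.
  have [g0' [sk _]] := (wcross_pt y k h).1 (hk _ hF) true true.
  pose P k := forall f, f \in F -> wcross k f.
  have up a b : P a -> (forall g, sep a y (o g) -> sep b y (o g)) -> P b.
    move=> Pa ab f fF; apply/(wcross_pt y) => s t.
    have nfb : ~ wpar f b.
      move=> p; have [g [e1 e2]] := (wcross_pt y a f).1 (Pa _ fF) true false.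
      by have := ab _ e1; rewrite -(hull_par g My p) e2.
    case: s.
      have [g [e1 e2]] := (wcross_pt y a f).1 (Pa _ fF) true t.
      by exists g; split=> //; exact: ab.
    case: t; last exact: My.
    by have [_ /(_ _ nfb)[g [e1 e2]]] := fl _ fF; exists g.
  have [k' [Pk' _ flk']] := flippable_ex My (hk : P k) sk up.
  exists k'; split=> /=.
  - rewrite uF andbT; apply/negP => kF; apply: (wpar_cross (h := k') (k := k')) (Pk' _ kF).
    by [].
  - by rewrite in_cons hF orbT.
  - by move=> f; rewrite in_cons => /orP[/eqP->|/fl].
  - move=> a b; rewrite !in_cons => /orP[/eqP->|aF] /orP[/eqP->|bF] ne //.
    + exact: Pk'.
    + by apply: wcrossC; exact: Pk'.
    + exact: cr.
have [n] := ubnP (size W0 - size [:: h]).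
elim: n [:: h] g0 => // n IH F gF sF.
have [mx|/(ext F gF)[k gk]] := pselect (max_crossing y F).
  by exists F; case: gF.
apply: (IH (k :: F) gk); have := bound _ gk => /=; lia.
Qed.

(** One family serves both ends of the flip: it contains h, so its members are h and walls crossing
    h, and these stay flippable by [flip_stay]. *)
Lemma near_ex W0 y y' h : fin_crossing W0 -> hull y -> hull y' -> flippable y h ->
  flip_of y h y' -> exists z, near W0 z y /\ near W0 z y'.
Proof.
move=> fin My My' flh fy; have [F [hF mx]] := max_crossing_ex fin My flh.
have [fl cr mxk] := mx.
have [|z hz] := fin F _ cr; first by move=> f /fl[].
exists z; split; split=> //; exists F; split=> //; split=> // f fF.
apply: (flip_stay My fy) => //; first exact: fl.
have [->|ne] := pselect (f = h); first by left.
by right; apply: cr => // e; apply: ne.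
Qed.

Lemma trans_fin u v : exists s : seq G, forall g, gp g u = v -> g \in s.
Proof.
have [[g0 e0]|no] := pselect (exists g, gp g u = v); last first.
  by exists [::] => g e; case: no; exists g.
have [s hs] := stab_fin u; exists [seq (g0 * g)%g | g <- s] => g e.
apply/mapP; exists (g0^-1 * g)%g; last by rewrite mulVKg.
by apply: hs; rewrite gpM e -e0 gpK.
Qed.

Lemma trans_fin_seq (s1 s2 : seq (pt A)) : exists s : seq G,
  forall g u, u \in s1 -> gp g u \in s2 -> g \in s.
Proof.
pose f u v := projT1 (cid (trans_fin u v)).
exists (flatten [seq f u v | u <- s1, v <- s2]) => g u us gs.
apply/flattenP; exists (f u (gp g u)); first by apply/allpairsP; exists (u, gp g u).
by rewrite /f; case: cid => s /= hs; exact: hs.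
Qed.

(** Each flip removes a wall between the current point and [o q] and costs one letter. Translated
    back, consecutive points lie in the finite set [Y]; finite stabilizers leave finitely many
    elements carrying a point of [Y] into [Y], and these form [D]. *)
Lemma linear_bound W0 : fin_crossing W0 -> exists D : seq G, forall q,
  exists l : seq G, [/\ all (mem D) l, (\prod_(g <- l) g = q)%g &
    size l <= (size (seps x0 (o q))).+1].
Proof.
move=> fin; have [Y0 hY0] := near_fin W0.
pose Y := x0 :: Y0; have [D hD] := trans_fin_seq Y Y; exists D => q.
have nearY z y : y = o z \/ near W0 z y -> gp z^-1%g y \in Y.
  case=> [->|/(nearG z^-1%g)]; first by rewrite gpK mem_head.
  by rewrite mulVg => /hY0 h; rewrite in_cons h orbT.
(* The extra letter pays for the last move, from z to q, when y has become [o q]; with no wall left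
   this is forced. *)
suff main n y z : hull y -> y = o z \/ near W0 z y -> size (seps y (o q)) <= n ->
   exists l : seq G, [/\ all (mem D) l, (\prod_(g <- l) g = z^-1 * q)%g & size l <= n.+1].
  have [l [l1 l2 l3]] := main _ _ 1%g (hull_orbit 1%g) (or_introl erefl) (leqnn _).
  by exists l; rewrite l2 invg1 mul1g; rewrite gp1 in l3.
elim: n y z => [|n IH] y z My /nearY yz sn; have [ey|ny] := pselect (y = o q);
  try (exists [:: (z^-1 * q)%g]; split=> //=; [|by rewrite big_seq1];
       rewrite andbT; apply: (hD _ x0); [exact: mem_head|by rewrite gpM -ey]).
  case: ny; apply: (@sep_eq _ A) => h; rewrite -mem_seps.
  by move: sn; case: seps.
have [h0 s0] : exists h, sep h y (o q).
  apply: contrapT => no; apply: ny; apply: (@sep_eq _ A) => h.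
  by apply/negP => s; apply: no; exists h.
have [h [_ sh flh]] := flippable_ex (P := fun _ => True) My I s0 (fun _ _ _ _ => I).
have [y' [My' fy]] := flip_ex My flh.
have [z' [n1 n2]] := near_ex fin My My' flh fy.
have [l [l1 l2 l3]] : exists l : seq G, [/\ all (mem D) l, (\prod_(g <- l) g = z'^-1 * q)%g & size l <= n.+1].
  apply: (IH y') => //; first by right.
  rewrite -ltnS; apply: leq_trans sn.
  apply: (@uniq_leq_size _ (h :: seps y' (o q))).
    rewrite /= uniq_seps andbT mem_seps (sepA h y' y) (sepC h y') fy sh.
    by rewrite asboolT.
  move=> l; rewrite in_cons !mem_seps (sepA l y' y) (sepC l y') fy.
  case/orP => [/eqP->//|]; case: asboolP => //= p _.
  by rewrite -(hull_par q My p).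
exists ((z^-1 * z')%g :: l); rewrite /= l1 big_cons l2 -mulgA mulVKg andbT; split=> //.
apply: (hD _ (gp z'^-1%g y)); first by apply: nearY; right.
by rewrite gpM gpVK.
Qed.

End WallAct.

(** * Neighbourhoods of walls in the Cayley graph *)

Section Thickness.
Local Open Scope group_scope.

Section Balls.
Variables (G : groupType) (L : seq G).
Hypothesis symL : forall s, s \in L -> s^-1 \in L.

Fixpoint wball n : seq G :=
  if n is m.+1 then wball m ++ [seq g * s | g <- wball m, s <- L] else [:: 1].

Lemma ball1 n : 1 \in wball n.
Proof. by elim: n => [|n IH] /=; rewrite ?inE // mem_cat IH. Qed.

Lemma ballS n g : g \in wball n -> g \in wball n.+1.
Proof. by move=> h; rewrite /= mem_cat h. Qed.

Lemma ball_leq n m g : n <= m -> g \in wball n -> g \in wball m.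
Proof. by move=> /subnKC <-; elim: (m - n) => [|k IH]; rewrite ?addn0 ?addnS // => /IH/ballS. Qed.

Lemma ball_step n g s : g \in wball n -> s \in L -> g * s \in wball n.+1.
Proof. by move=> gn sL; rewrite /= mem_cat; apply/orP; right; exact: allpairs_f. Qed.

Lemma ballSP n g : g \in wball n.+1 ->
  g \in wball n \/ exists h s, [/\ h \in wball n, s \in L & g = h * s].
Proof.
by rewrite /= mem_cat => /orP[|/allpairsP[[h s] /= [? ? ->]]]; [left|right; exists h, s].
Qed.

Lemma ballM n m g h : g \in wball n -> h \in wball m -> g * h \in wball (n + m).
Proof.
move=> gn; elim: m h => [|m IH] h; first by rewrite addn0 inE => /eqP->; rewrite mulg1.
rewrite addnS => /ballSP[/IH/ballS//|[k [s [/IH km sL ->]]]].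
by rewrite mulgA; exact: ball_step.
Qed.

Lemma ball_letter s : s \in L -> s \in wball 1.
Proof. by move=> sL; rewrite -[s]mul1g; apply: ball_step => //; exact: ball1. Qed.

Lemma ballV n g : g \in wball n -> g^-1 \in wball n.
Proof.
elim: n g => [|n IH] g; first by rewrite !inE => /eqP->; rewrite invg1.
move=> /ballSP[/IH/ballS//|[k [s [/IH kn sL ->]]]].
by rewrite invgM -add1n; apply: ballM => //; exact/ball_letter/symL.
Qed.

Definition joined_in (N : set G) : relation G := clos_refl_trans _
  (fun a b => [/\ N a, N b & exists2 s, s \in L & b = a * s]).

Definition gconnected (N : set G) := forall a b, N a -> N b -> joined_in N a b.

Lemma withinC N a b : joined_in N a b -> joined_in N b a.
Proof.
elim=> [x y [Nx Ny [s sL e]]|x|x y z _ h1 _ h2].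
- apply: rt_step; split=> //; exists s^-1; first exact: symL.
  by rewrite e mulgK.
- exact: rt_refl.
- exact: rt_trans h2 h1.
Qed.

Lemma within_ind_const (N : set G) (Q : G -> Prop) a b :
  (forall x s, N x -> N (x * s) -> s \in L -> Q x -> Q (x * s)) ->
  joined_in N a b -> Q a -> Q b.
Proof.
move=> h; elim=> [x y [Nx Ny [s sL e]]|//|x y z _ h1 _ h2 /h1/h2//].
by subst y; exact: h.
Qed.

Lemma within_path (N : set G) n a g :
  (forall v, v \in wball n -> N (a * v)) -> g \in wball n -> joined_in N a (a * g).
Proof.
elim: n g => [|n IH] g Nv; first by rewrite inE => /eqP->; rewrite mulg1; exact: rt_refl.
have IH' h : h \in wball n -> joined_in N a (a * h).
  by apply: IH => v vn; apply: Nv; exact: ballS.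
move=> gn; have /ballSP[/IH'//|[h [s [hn sL e]]]] := gn.
apply: rt_trans (IH' _ hn) _; apply: rt_step; split.
- by apply: Nv; exact: ballS.
- exact: Nv.
- by exists s => //; rewrite e mulgA.
Qed.

Hypothesis genL : forall g, exists n, g \in wball n.

Lemma exit_edge (Q : G -> Prop) a b : Q a -> ~ Q b ->
  exists g s, [/\ s \in L, Q g & ~ Q (g * s)].
Proof.
move=> Qa nQb; apply: contrapT => no.
have [n] := genL (a^-1 * b); move eg : (a^-1 * b) => g gn.
have eb : b = a * g by rewrite -eg mulVKg.
apply: nQb; rewrite eb; elim: n g gn {eg eb} => [|n IH] g.
  by rewrite inE => /eqP->; rewrite mulg1.
move=> /ballSP[/IH//|[h [s [/IH Qh sL ->]]]].
by apply: contrapT => nq; apply: no; exists (a * h), s; split=> //; rewrite -mulgA.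
Qed.

End Balls.

Section Thickening.
Variables (G : groupType) (A : wallAct G) (x0 : pt A) (L : seq G).
Hypothesis symL : forall s, s \in L -> s^-1 \in L.
Hypothesis genL : forall g, exists n, g \in wball L n.
Implicit Types (g z : G) (h k : wl A).
Local Notation o g := (gp g x0).

Definition bd h g := exists2 s, s \in L & sep h (o g) (o (g * s)).

(** The neighbourhood N(h) of the overview, with radius R. *)
Definition thick R h : set G := [set g | exists2 u, u \in wball L R & bd h (g * u)].

Lemma bd_gw g h a : bd h a -> bd (gw g h) (g * a).
Proof. by move=> [s sL e]; exists s => //; rewrite sepGo -!mulgA !mulKg. Qed.

Lemma thick_gw R g h a : thick R h a -> thick R (gw g h) (g * a).
Proof. by move=> [u un b]; exists u => //; rewrite -mulgA; exact: bd_gw. Qed.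

Lemma bd_thick R h a : bd h a -> thick R h a.
Proof. by move=> b; exists 1; [exact: ball1|rewrite mulg1]. Qed.

Lemma essential_bd h : essential x0 h -> exists a, bd h a.
Proof.
move=> [a [b e]].
have [||g [s [sL Qg nQ]]] := @exit_edge _ L genL (fun g => sep h (o a) (o g) = false) a b.
- exact: sepxx.
- by rewrite e.
exists g, s => //; rewrite (sepA h _ (o a)) sepC Qg /=.
by case: sep nQ => //; case.
Qed.

Definition walls_at R : seq (wl A) :=
  flatten [seq seps (o u) (o (u * s)) | u <- wball L R, s <- L].

Lemma thick1 R h : thick R h 1 -> h \in walls_at R.
Proof.
move=> [u un [s sL e]]; apply/flattenP; exists (seps (o u) (o (u * s))).
  by apply/allpairsP; exists (u, s).
by rewrite mem_seps; rewrite !mul1g in e.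
Qed.

Lemma thick_walls R h z : thick R h z -> gw z^-1 h \in walls_at R.
Proof. by move=> t; apply: thick1; rewrite -[1](mulVg z); exact: thick_gw. Qed.

(** Translating a common point z to 1 puts the whole family among the finitely many walls whose
    neighbourhood contains 1. *)
Lemma fin_of_common R :
  (forall F, (forall h, h \in F -> essential x0 h) -> crossing_fam x0 F ->
     exists z, forall h, h \in F -> thick R h z) ->
  fin_crossing x0 (walls_at R).
Proof.
by move=> H F eF cF; have [z hz] := H F eF cF; exists z => h /hz; exact: thick_walls.
Qed.

(** Generation as a monoid, so that T has to contain inverses as needed. *)
Definition fg_stab h := exists T : seq G, (forall t, t \in T -> gw t h = h) /\
  forall g, gw g h = h -> exists l, all (mem T) l /\ \prod_(t <- l) t = g.

Lemma within_gw R g h a b : joined_in L (thick R h) a b ->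
  joined_in L (thick R (gw g h)) (g * a) (g * b).
Proof.
elim=> [x y [Nx Ny [s sL e]]|x|x y z _ h1 _ h2].
- apply: rt_step; split; [exact: thick_gw|exact: thick_gw|].
  by exists s => //; rewrite e mulgA.
- exact: rt_refl.
- exact: rt_trans h1 h2.
Qed.

Lemma bd_within R h a g : bd h a -> g \in wball L R -> joined_in L (thick R h) a (a * g).
Proof.
move=> b; apply: within_path => v vn; exists v^-1; first exact: ballV.
by rewrite mulgK.
Qed.

(** The stabilizer has finitely many orbits on the places where h is crossed: g^-1 carries h into a
    finite list, and two places with the same image differ by a stabilizing element. *)
Lemma bd_cofinite h : exists U : seq G,
  (forall g, bd h g -> exists a u, [/\ gw a h = h, u \in U & g = a * u]) /\
  forall u, u \in U -> bd h u.
Proof.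
pose f k : seq G := match pselect (exists u, bd h u /\ gw u^-1 h = k) with
  | left e => [:: projT1 (cid e)] | right _ => [::] end.
exists (flatten [seq f k | k <- walls_at 0]); split=> [g bg|u].
  have gk : gw g^-1 h \in walls_at 0 by apply: thick_walls; exact: bd_thick.
  have [u [fu eu]] : exists u, u \in f (gw g^-1 h) /\ gw u^-1 h = gw g^-1 h.
    rewrite /f; case: pselect => [e|[]]; last by exists g.
    by case: cid => u [bu eu] /=; exists u; rewrite mem_head.
  exists (g * u^-1), u; rewrite mulgVK gwM eu gwVK; split=> //.
  by apply/flattenP; exists (f (gw g^-1 h)) => //; exact: map_f.
move=> /flattenP[s /mapP[k _ ->]]; rewrite /f; case: pselect => // e.
by case: cid => v [bv ev] /=; rewrite inE => /eqP->.
Qed.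

Lemma ball_all (s : seq G) : exists n, forall g, g \in s -> g \in wball L n.
Proof.
elim: s => [|a s [n hn]]; first by exists 0.
have [m hm] := genL a; exists (n + m) => g.
rewrite inE => /orP[/eqP->|/hn]; first by apply: ball_leq hm; exact: leq_addl.
by apply: ball_leq; exact: leq_addr.
Qed.

(** A stabilizer generator t moves u0 to u0 times its conjugate u0^-1 t u0. A ball holding these
    conjugates, and the differences from u0 to the orbit representatives, therefore joins everything
    inside the neighbourhood. *)
Lemma thick_connected h : essential x0 h -> fg_stab h ->
  exists R0, forall R, R0 <= R -> gconnected L (thick R h).
Proof.
move=> /essential_bd[u0 b0] [T [Th Tg]]; have [U [cU bU]] := bd_cofinite h.
have [R0 hR0] := ball_all ([seq u0^-1 * t * u0 | t <- T] ++ [seq u0^-1 * u | u <- U]).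
exists R0 => R lR.
have inR g : g \in [seq u0^-1 * t * u0 | t <- T] ++ [seq u0^-1 * u | u <- U] ->
    g \in wball L R by move=> /hR0; exact: ball_leq.
have stab a : gw a h = h -> joined_in L (thick R h) u0 (a * u0).
  move=> /Tg[l [al <-]]; elim: l al => [_|t l IH /= /andP[tT al]].
    by rewrite big_nil mul1g; exact: rt_refl.
  rewrite big_cons; apply: rt_trans (_ : joined_in L (thick R h) (t * u0) _); last first.
    by have := within_gw t (IH al); rewrite Th // mulgA.
  have -> : t * u0 = u0 * (u0^-1 * t * u0) by rewrite !mulgA mulgV mul1g.
  by apply: bd_within => //; apply: inR; rewrite mem_cat; apply/orP; left; exact: (map_f (fun t => u0^-1 * t * u0)).
have toU0 a : thick R h a -> joined_in L (thick R h) u0 a.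
  move=> [u un bu]; have [c [v [ec vU e]]] := cU _ bu.
  apply: rt_trans (stab c ec) _.
  apply: rt_trans (_ : joined_in L (thick R h) (c * v) a); last first.
    by rewrite -e -{2}[a](mulgK u); apply: bd_within => //; exact: ballV.
  have -> : c * v = c * u0 * (u0^-1 * v) by rewrite -mulgA mulVKg.
  apply: bd_within; first by rewrite -ec; exact: bd_gw.
  by apply: inR; rewrite mem_cat; apply/orP; right; exact: (map_f (fun u => u0^-1 * u)).
by move=> a b ta tb; apply: rt_trans (withinC symL (toU0 a ta)) (toU0 b tb).
Qed.

Lemma thick_connected_all : (forall h, essential x0 h -> fg_stab h) ->
  exists R, forall h, essential x0 h -> gconnected L (thick R h).
Proof.
move=> fg.
have [R0 hR0] : exists R0, forall h, h \in walls_at 0 -> essential x0 h ->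
    forall R, R0 <= R -> gconnected L (thick R h).
  elim: (walls_at 0) => [|k s [R1 hR1]]; first by exists 0.
  have [ek|nk] := pselect (essential x0 k); last first.
    exists R1 => h; rewrite inE => /orP[/eqP->//|]; exact: hR1.
  have [R2 hR2] := thick_connected ek (fg _ ek).
  exists (R1 + R2) => h; rewrite inE => /orP[/eqP-> _ R l|hs eh R l].
    by apply: hR2; apply: leq_trans l; exact: leq_addl.
  by apply: (hR1 h) => //; apply: leq_trans l; exact: leq_addr.
exists R0 => h eh; have [g bg] := essential_bd eh.
have := hR0 _ (thick_walls (bd_thick 0 bg)) (essentialG _ eh) R0 (leqnn _).
move=> c a b ta tb; have := c _ _ (thick_gw g^-1 ta) (thick_gw g^-1 tb).
by move=> /(within_gw g); rewrite !mulVKg gwVK.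
Qed.

(** If the neighbourhoods are disjoint, each lies on one side of the other wall. Consider the
    quarter-space beyond h as seen from N(k) and beyond k as seen from N(h). Leaving it would cross
    h in N(h), or k in N(k), on the wrong side of the other wall; so it cannot be left, yet it is
    neither empty nor everything. *)
Lemma cross_meet R h k : gconnected L (thick R h) -> gconnected L (thick R k) ->
  wcross x0 h k -> exists z, thick R h z /\ thick R k z.
Proof.
move=> ch ck c; apply: contrapT => no.
have side l m : gconnected L (thick R m) -> (forall z, thick R m z -> ~ thick R l z) ->
    forall a b, thick R m a -> thick R m b -> sep l (o a) (o b) = false.
  move=> cm dis a b ta tb.
  apply: (within_ind_const (Q := fun b => sep l (o a) (o b) = false) _ (cm _ _ ta tb)).
    move=> x s tx txs sL e; rewrite (sepA l _ (o x)) e /=.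
    by apply/negP => sx; apply: (dis x tx); apply: bd_thick; exists s.
  exact: sepxx.
have sk := side h k ck (fun z tk th => no (ex_intro _ z (conj th tk))).
have sh := side k h ch (fun z th tk => no (ex_intro _ z (conj th tk))).
have [a ba] := essential_bd (wcross_essential c).
have [b bb] := essential_bd (wcross_essential (wcrossC c)).
have ta := bd_thick R ba; have tb := bd_thick R bb.
have [g0 [q1 q2]] := (wcross_pt x0 (o b) h k).1 c true (~~ sep k (o b) (o a)).
have q3 : sep k (o a) (o g0) by rewrite (sepA k _ (o b)) q2 (sepC k (o a)); case: sep.
have [||g [s [sL [e1 e2]]]] := @exit_edge _ L genL
    (fun g => sep h (o b) (o g) /\ sep k (o a) (o g)) g0 b.
- by split.
- by rewrite sepxx => -[].
move=> nq; case e3 : (sep h (o g) (o (g * s))).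
  have : thick R h g by apply: bd_thick; exists s.
  by move=> /(sh _ _ ta); rewrite e2.
case e4 : (sep k (o g) (o (g * s))).
  have : thick R k g by apply: bd_thick; exists s.
  by move=> /(sk _ _ tb); rewrite e1.
by apply: nq; rewrite (sepA h _ (o g)) (sepA k _ (o g)) e1 e2 e3 e4.
Qed.

Lemma fin_crossing_dim2 : (forall h, essential x0 h -> fg_stab h) ->
  (forall h k l, wcross x0 h k -> wcross x0 h l -> wcross x0 k l -> False) ->
  exists W0, fin_crossing x0 W0.
Proof.
move=> fg no3; have [R cR] := thick_connected_all fg.
exists (walls_at R); apply: fin_of_common => F eF cF.
case: F eF cF => [|h F] eF cF; first by exists 1.
have [[k [kF nk]]|all_eq] := pselect (exists k, k \in h :: F /\ k <> h).
  have hF : h \in h :: F by exact: mem_head.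
  have chk : wcross x0 h k by apply: cF => // e; apply: nk.
  have [z [z1 z2]] := cross_meet (cR _ (eF _ hF)) (cR _ (eF _ kF)) chk.
  exists z => l lF; have [->//|nlh] := pselect (l = h).
  have [->//|nlk] := pselect (l = k).
  have c1 : wcross x0 h l by apply: cF => // e; apply: nlh.
  have c2 : wcross x0 k l by apply: cF => // e; apply: nlk.
  by case: (no3 h k l).
have [z bz] := essential_bd (eF _ (mem_head h F)); exists z => l lF.
have [->|nlh] := pselect (l = h); first exact: bd_thick.
by case: all_eq; exists l.
Qed.

End Thickening.

End Thickness.

(** * Trees *)

Section TreesAndCocycles.
Local Open Scope classical_set_scope.

Section Trees.
Variables (V : Type) (tadj : V -> V -> Prop).

Definition tree_edge_cut a b (s : V -> bool) := s a <> s b /\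
  forall c d, tadj c d -> s c <> s d -> (c = a /\ d = b) \/ (c = b /\ d = a).

(* Every edge is a bridge; connectedness is not required. *)
Definition forest := forall a b, tadj a b -> exists s, tree_edge_cut a b s.

Definition tpath (K : set V) := clos_refl_trans _
  (fun a b => [/\ K a, K b & tadj a b]).

Definition tconnected (K : set V) := forall a b, K a -> K b -> tpath K a b.

Hypothesis fo : forest.

Lemma tpath_cross K a b (s : V -> bool) : tpath K a b -> s a <> s b ->
  exists c d, [/\ K c, K d, tadj c d & s c <> s d].
Proof.
elim=> [x y [Kx Ky xy] n|x //|x y z _ h1 _ h2 n]; first by exists x, y.
have [e|/h1//] := pselect (s x = s y).
by apply: h2; rewrite -e.
Qed.

Lemma cut_connected K a b (s : V -> bool) c d : tree_edge_cut a b s -> tconnected K ->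
  K c -> K d -> s c <> s d -> K a /\ K b.
Proof.
move=> [_ cut] cK Kc Kd n; have [x [y [Kx Ky xy sxy]]] := tpath_cross (cK _ _ Kc Kd) n.
by have [[<- <-]|[<- <-]] := cut _ _ xy sxy.
Qed.

Lemma first_hit (K K1 : set V) p q : tpath K p q -> ~ K1 p -> K1 q ->
  exists c r, [/\ tadj c r, ~ K1 c, K1 r & tpath (~` K1) p c].
Proof.
move=> /clos_rt_rt1n_iff; elim=> [//|x y z [Kx Ky xy] h IH nx Kz].
have [Ky1|ny] := pselect (K1 y); first by exists x, y; split=> //; exact: rt_refl.
have [c [r [cr nc Kr pc]]] := IH ny Kz; exists c, r; split=> //.
by apply: rt_trans pc; exact: rt_step.
Qed.

(** r is where a path from p first enters K1, through the edge from c to r. The cut of this edge has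
    p on one side and all of K1 on the other, so a connected set containing p and meeting K1 uses
    the edge. *)
Lemma helly_gate (K0 K1 : set V) p : tconnected K0 -> tconnected K1 -> K0 p ->
  K0 `&` K1 !=set0 -> exists2 r, K1 r &
  forall K, tconnected K -> K p -> K `&` K1 !=set0 -> K r.
Proof.
move=> c0 c1 K0p [q [K0q K1q]].
have [K1p|nK1p] := pselect (K1 p); first by exists p.
have [c [r [cr nc K1r pc]]] := first_hit (c0 _ _ K0p K0q) nK1p K1q.
exists r => // K cK Kp [v [Kv K1v]]; have [s cut] := fo cr.
have srv : s r = s v.
  by apply: contrapT => n; have [] := cut_connected cut c1 K1r K1v n.
have spc : s p = s c.
  apply: contrapT => n; have [x [y [nx ny xy sxy]]] := tpath_cross pc n.
  by case: cut => _ /(_ _ _ xy sxy)[[_ e]|[e _]]; [apply: ny|apply: nx]; rewrite e.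
have [] // := cut_connected cut cK Kp Kv.
by rewrite spc -srv; case: cut.
Qed.

Lemma helly (I : eqType) (K : I -> set V) (t : seq I) i0 :
  (forall i, i \in i0 :: t -> tconnected (K i)) ->
  (forall i j, i \in i0 :: t -> j \in i0 :: t -> K i `&` K j !=set0) ->
  exists v, forall i, i \in i0 :: t -> K i v.
Proof.
elim: t => [|i1 t IH] cK mK.
  by have [v [Kv _]] := mK i0 i0 (mem_head _ _) (mem_head _ _);
     exists v => i; rewrite inE => /eqP->.
have sub i : i \in i0 :: t -> i \in [:: i0, i1 & t].
  by rewrite !inE => /orP[->//|->]; rewrite !orbT.
have in1 : i1 \in [:: i0, i1 & t] by rewrite !inE eqxx orbT.
have in0 : i0 \in [:: i0, i1 & t] by rewrite !inE eqxx.
have [|i j hi hj|p hp] := IH; first by move=> i /sub; exact: cK.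
  by apply: mK; exact: sub.
have [r K1r hr] := helly_gate (cK _ in0) (cK _ in1) (hp _ (mem_head _ _)) (mK _ _ in0 in1).
exists r => i; have [->//|/eqP ne] := pselect (i = i1).
move=> hi; apply: hr; [exact: cK| |exact: mK].
by apply: hp; move: hi; rewrite !inE (negbTE ne).
Qed.

Lemma forest_irr a : ~ tadj a a.
Proof. by move=> /fo[s [+ _]]. Qed.

(** In a closed path the bridge first crossed is crossed again later. This closes up a shorter path,
    unless the second crossing follows at once, which is a backtrack. *)
Lemma reduced_inj (f : nat -> V) : (forall i, tadj (f i) (f i.+1)) ->
  (forall i, f i <> f i.+2) -> forall i j, i < j -> f i <> f j.
Proof.
move=> ad red i j; move e: (j - i) => n; elim/ltn_ind: n i j e => n IH i j e lij eij.
have lt1 : i.+1 < j.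
  rewrite ltn_neqAle lij andbT; apply/eqP => e1.
  by apply: (@forest_irr (f i)); rewrite {2}eij -e1.
have [s [n1 cut]] := fo (ad i).
have [k [k1 k2 k3]] : exists k, [/\ i < k, k < j & s (f k) <> s (f k.+1)].
  apply: contrapT => no; apply: n1; rewrite [in LHS]eij.
  have {e IH eij cut} : forall m, i < m -> m <= j -> s (f m) = s (f i.+1).
    elim=> // m IHm; rewrite ltnS leq_eqVlt => /orP[/eqP<-//|im] mj.
    rewrite -IHm //; last exact: ltnW.
    by apply: contrapT => n1; apply: no; exists m; split=> //; exact: nesym.
  by move=> h; exact: h lij (leqnn j).
have [[e1 _]|[e1 e2]] := cut _ _ (ad k) k3.
  by apply: (IH (k - i) _ i k) => //; lia.
have [lt|ge] := ltnP k.+1 j.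
  by apply: (IH (k.+1 - i) _ i k.+1) => //; lia.
have ek : j = k.+1 by lia.
have [lt|ge'] := ltnP i.+1 k.
  by apply: (IH (k - i.+1) _ i.+1 k) => //; lia.
have ek' : k = i.+1 by lia.
by apply: (red i); rewrite eij ek ek'.
Qed.

Import Order.TTheory GRing.Theory Num.Theory.
Local Open Scope ring_scope.

Definition reduced_line (l : int -> V) := forall i : int,
  tadj (l i) (l (i + 1)) /\ l i <> l (i + 2).

Lemma line_inj l : reduced_line l -> forall i j, i < j -> l i <> l j.
Proof.
move=> rl i j ij; pose f n := l (i + n%:Z).
have [n ej] : exists n : nat, j = i + n%:Z by exists `|j - i|%N; lia.
have -> : l i = f 0%N by rewrite /f addr0.
have -> : l j = f n by rewrite /f -ej.
apply: reduced_inj; [move=> m|move=> m|by lia].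
  have [+ _] := rl (i + m%:Z); rewrite /f.
  by have -> : i + m%:Z + 1 = i + m.+1%:Z by lia.
have [_ +] := rl (i + m%:Z); rewrite /f.
by have -> : i + m%:Z + 2 = i + m.+2%:Z by lia.
Qed.

Lemma line_cut l : reduced_line l -> forall i, exists s,
  [/\ tree_edge_cut (l i) (l (i + 1)) s, forall m : int, m <= i -> s (l m) = s (l i) &
      forall m : int, i < m -> s (l m) = s (l (i + 1))].
Proof.
move=> rl i; have [s cut] := fo (rl i).1; exists s.
have inj a b : l a = l b -> a = b.
  by move=> e; have [/(line_inj rl)//|/(line_inj rl)/nesym//|//] := ltgtP a b.
have st (m : int) : m != i -> s (l (m + 1)) = s (l m).
  move=> ne; apply: contrapT => n.
  case: cut => _ /(_ _ _ (rl m).1 (nesym n))[[/inj e _]|[/inj e1 /inj e2]]; lia.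
split=> // m mi.
  have [n em] : exists n : nat, m = i - n%:Z by exists `|i - m|%N; lia.
  rewrite {}em {mi m}; elim: n => [|n IH]; first by rewrite subr0.
  by rewrite -IH (_ : i - n%:Z = i - n.+1%:Z + 1) ?st //; lia.
have [n em] : exists n : nat, m = i + 1 + n%:Z by exists (absz (m - i - 1)%R); lia.
rewrite {}em {mi m}; elim: n => [|n IH]; first by rewrite addr0.
by rewrite -IH (_ : i + 1 + n.+1%:Z = i + 1 + n%:Z + 1) ?st //; lia.
Qed.

Lemma line_segment l K i j m : reduced_line l -> tconnected K -> K (l i) -> K (l j) ->
  i <= m <= j -> K (l m).
Proof.
move=> rl cK Ki Kj /andP[im]; rewrite le_eqVlt => /orP[/eqP->|mj]; first exact: Kj.
have [s [cut h1 h2]] := line_cut rl m.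
have n : s (l i) <> s (l j) by rewrite (h1 i) // (h2 j) //; case: cut.
by have [] := cut_connected cut cK Ki Kj n.
Qed.

End Trees.

(** * Cocycles on presented groups *)

Section Cocycles.
Import GRing.Theory.
Variables (G : groupType) (A : Type) (f : A -> G) (rel : set (word A)).
Variables (K : zmodType) (c : G -> A -> K).
Local Open Scope ring_scope.

(** The integral of a 1-cochain along the path from g spelled by the word; an inverse letter runs
    backwards along the edge starting at g * (f a)^-1. *)
Fixpoint wsum (g : G) (w : word A) : K :=
  match w with
  | [::] => 0
  | (a, b) :: w' => if b then - c (g * (f a)^-1)%g a + wsum (g * (f a)^-1)%g w'
                    else c g a + wsum (g * f a)%g w'
  end.

Lemma weval_nil : weval f [::] = 1%g. Proof. by rewrite /weval big_nil. Qed.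

Lemma weval_cons a b w :
  weval f ((a, b) :: w) = ((if b then (f a)^-1 else f a) * weval f w)%g.
Proof. by rewrite /weval big_cons. Qed.

Lemma weval_cat u v : weval f (u ++ v) = (weval f u * weval f v)%g.
Proof. by rewrite /weval big_cat. Qed.

Lemma wsum_cat g u v : wsum g (u ++ v) = wsum g u + wsum (g * weval f u)%g v.
Proof.
elim: u g => [|[a b] u IH] g /=; first by rewrite weval_nil mulg1 add0r.
by rewrite weval_cons; case: b; rewrite IH addrA mulgA.
Qed.

Hypothesis pres : presents f rel.

Lemma relator_eval r : rel r -> weval f r = 1%g.
Proof.
move=> rr; rewrite -weval_nil; apply/pres.2; apply: rst_step.
by have := step_relator [::] [::] rr; rewrite cats0.
Qed.

Hypothesis closed : forall r, rel r -> forall g, wsum g r = 0.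

Lemma wsum_step u v : word_step rel u v -> forall g, wsum g u = wsum g v.
Proof.
case=> [{}u {}v x b|{}u r {}v rr] g.
  rewrite !wsum_cat; congr (_ + _); rewrite !weval_cons weval_nil mulg1.
  by case: b => /=; rewrite addr0 ?mulVg ?mulgV ?mulgK mulg1 ?addNr ?addrN add0r.
by rewrite !wsum_cat (closed rr) add0r (relator_eval rr) mulg1.
Qed.

(** Vanishing of the first cohomology of the Cayley complex: integrate from 1 along any word for g.
    Free cancellations and relators do not change the integral, so the choice of the word is
    immaterial. *)
Lemma cocycle_coboundary : exists s : G -> K, forall g a, s (g * f a)%g = s g + c g a.
Proof.
have [ws hws] := choice pres.1.
exists (fun g => wsum 1%g (ws g)) => g a.
have : wsum 1%g (ws (g * f a)%g) = wsum 1%g (ws g ++ [:: (a, false)]).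
  have /pres.2 h : weval f (ws (g * f a)%g) = weval f (ws g ++ [:: (a, false)]).
    by rewrite weval_cat weval_cons weval_nil mulg1 !hws.
  elim: h => [? ? /wsum_step->//|//|? ? _ ->//|? ? ? _ -> _ ->//].
by move=> ->; rewrite wsum_cat /= mul1g hws addr0.
Qed.

End Cocycles.

Section Morphisms.
Import GRing.Theory.
Variables (G : groupType) (A : Type) (f : A -> G) (rel : set (word A)).
Local Open Scope ring_scope.

Lemma wsum_const (K : zmodType) (c : A -> K) g w :
  wsum f (fun _ => c) g w = \sum_(l <- w) (if l.2 then - c l.1 else c l.1).
Proof.
elim: w g => [|[a b] w IH] g; first by rewrite big_nil.
by rewrite big_cons /= !IH; case: b.
Qed.

Lemma presents_hom (K : zmodType) (c : A -> K) : presents f rel ->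
  (forall r, rel r -> \sum_(l <- r) (if l.2 then - c l.1 else c l.1) = 0) ->
  exists e : G -> K, (forall g h, e (g * h)%g = e g + e h) /\ forall a, e (f a) = c a.
Proof.
move=> pres c0.
have [r rr g|s hs] := @cocycle_coboundary G A f rel K (fun _ => c) pres.
  by rewrite wsum_const c0.
have hw w g : s (g * weval f w)%g = s g + \sum_(l <- w) (if l.2 then - c l.1 else c l.1).
  elim: w g => [|[a b] w IH] g; first by rewrite weval_nil mulg1 big_nil addr0.
  rewrite weval_cons mulgA IH big_cons addrA; congr (_ + _); case: b; last exact: hs.
  by apply: (addIr (c a)); rewrite addrNK -hs mulgVK.
exists (fun g => s g - s 1%g); split=> [g h|a].
  have [w <-] := pres.1 h; rewrite hw -[weval f w in RHS]mul1g hw.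
  by rewrite addrAC; congr (_ + _); rewrite addrAC subrr add0r.
by rewrite -[f a]mul1g hs addrAC subrr add0r.
Qed.

Lemma weval_map (B : Type) (h : B -> A) w :
  weval f [seq (h l.1, l.2) | l <- w] = weval (f \o h) w.
Proof. by rewrite /weval big_map. Qed.

Lemma wsum_map (K : zmodType) (c : G -> A -> K) (B : Type) (h : B -> A) g w :
  wsum f c g [seq (h l.1, l.2) | l <- w] = wsum (f \o h) (fun g b => c g (h b)) g w.
Proof. by elim: w g => [|[b s] w IH] g //=; rewrite !IH. Qed.

Lemma eq_wsum (K : zmodType) (c c' : G -> A -> K) g w :
  (forall h a, c h a = c' h a) -> wsum f c g w = wsum f c' g w.
Proof. by move=> h; elim: w g => [|[b s] w IH] g //=; rewrite !IH !h. Qed.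

Lemma presents_ind (P : G -> Prop) : presents f rel -> P 1%g ->
  (forall g a, P g -> P (g * f a)%g /\ P (g * (f a)^-1)%g) -> forall g, P g.
Proof.
move=> pres P1 PM g; have [w <-] := pres.1 g.
rewrite -[weval f w]mul1g; elim: w (1%g : G) P1 => [|[a b] w IH] h Ph.
  by rewrite weval_nil mulg1.
by rewrite weval_cons mulgA; apply: IH; have [] := PM h a Ph; case: b.
Qed.

End Morphisms.

End TreesAndCocycles.

(** * Free groups *)

Section Free.
Import GRing.Theory.
Local Open Scope classical_set_scope.
Local Open Scope group_scope.

Lemma ball_weval (G : groupType) (I : Type) (f : I -> G) (L : seq G) (w : word I) :
  (forall s, s \in L -> s^-1 \in L) ->
  (forall i, exists n, f i \in wball L n) -> exists n, weval f w \in wball L n.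
Proof.
move=> symL hf; elim: w => [|[a b] w [n IH]].
  by exists 0; rewrite weval_nil; exact: ball1.
have [m hm] := hf a; exists (m + n); rewrite weval_cons; apply: ballM => //.
by case: b => //; exact: ballV.
Qed.

Definition letters (G : groupType) (I : Type) (f : I -> G) (w : word I) : seq G :=
  flatten [seq [:: f l.1; (f l.1)^-1] | l <- w].

Lemma letters_weval (G : groupType) (I : Type) (f : I -> G) (L : seq G) (w : word I) :
  {subset letters f w <= L} -> weval f w \in wball L (size w).
Proof.
elim: w => [|[a b] w IH] sub; first by rewrite weval_nil; exact: ball1.
rewrite weval_cons -[size _]/(1 + size w)%N; apply: ballM; last first.
  by apply: IH => x hx; apply: sub; rewrite /letters /= !inE hx !orbT.
by apply: ball_letter; apply: sub; rewrite /letters /= !inE; case: b; rewrite eqxx ?orbT.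
Qed.

Lemma lettersV (G : groupType) (I : Type) (f : I -> G) (w : word I) s :
  s \in letters f w -> s^-1 \in letters f w.
Proof.
elim: w => [|l w IH] //; rewrite /letters /= !inE => /or3P[/eqP->|/eqP->|/IH h].
- by rewrite eqxx orbT.
- by rewrite invgK eqxx.
- by move: h; rewrite /letters => ->; rewrite !orbT.
Qed.

Lemma fin_crossing_free (G : groupType) (A : wallAct G) (x0 : pt A) :
  finitely_presented G -> free_group G ->
  (forall h : wl A, essential x0 h -> fg_stab h) -> exists W0, fin_crossing x0 W0.
Proof.
move=> [n [f0 [rels [gen0 _]]]] [I [f pres]] fg.
have [ws hws] := choice (fun i => pres.1 (f0 i)).
(* The basis may be given by an infinite type; only the letters spelling the finitely many
   generators are kept for the Cayley graph, while the tree uses the whole basis. *)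
pose L := flatten [seq letters f (ws i) | i <- enum 'I_n].
have symL s : s \in L -> s^-1 \in L.
  move=> /flattenP[_ /mapP[i hi ->] si]; apply/flattenP.
  by exists (letters f (ws i)); [exact: map_f|exact: lettersV].
have genL g : exists m, g \in wball L m.
  have [w <-] := gen0 g; apply: ball_weval => // i.
  exists (size (ws i)); rewrite -hws; apply: letters_weval => s hs.
  by apply/flattenP; exists (letters f (ws i)) => //; apply: map_f; rewrite mem_enum.
have [R cR] := thick_connected_all symL genL fg.
pose tadj g k := exists a, k = g * f a \/ g = k * f a.
have Ltadj g s : s \in L -> tadj g (g * s).
  move=> /flattenP[_ /mapP[i _ ->]]; elim: (ws i) => // l w IH.
  rewrite /letters /= !inE => /or3P[/eqP->|/eqP->|/IH//]; exists l.1; first by left.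
  by right; rewrite mulgVK.
have fo : forest tadj.
  move=> a b; wlog : a b / exists i, b = a * f i.
    move=> H [i [e|e]]; first by apply: H; [exists i|exists i; left].
    have [||s [n1 cut]] := H b a; [by exists i|by exists i; left|].
    by exists s; split=> [|c d h1 h2]; [exact: nesym|have [|] := cut c d h1 h2; [right|left]].
  move=> [i eb] _; subst b.
  (* Without relators every cochain is closed, so the indicator of a single edge integrates to the
     side function of that edge. *)
  have [s hs] := @cocycle_coboundary G I f set0 bool
    (fun g j => `[< g = a /\ f j = f i >]) pres (fun r e => False_ind _ e).
  exists s; split; first by rewrite hs; case: asboolP => [_|[]] //; case: (s a).
  move=> c d [j [e|e]]; subst.
    by rewrite hs; case: asboolP => [[-> ->]|_]; [left|rewrite GRing.addr0].
  by rewrite hs; case: asboolP => [[-> ->]|_]; [right|rewrite GRing.addr0].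
have tcon h : essential x0 h -> tconnected tadj (thick x0 L R h).
  move=> eh a b ta tb; elim: (cR h eh a b ta tb) => [x y [tx ty [s sL e]]|x|x y z _ h1 _ h2].
  - by apply: rt_step; split=> //; rewrite e; exact: Ltadj.
  - exact: rt_refl.
  - exact: rt_trans h1 h2.
exists (walls_at x0 L R); apply: fin_of_common => -[|h0 F] eF cF; first by exists 1.
have [||z hz] := helly fo (K := thick x0 L R) (i0 := h0) (t := F); last by exists z.
  by move=> i /eF; exact: tcon.
move=> h k hF kF; have [->|ne] := pselect (h = k).
  by have [a /(bd_thick R)] := essential_bd genL (eF _ kF); exists a; split.
have [z [z1 z2]] := cross_meet genL (cR _ (eF _ hF)) (cR _ (eF _ kF)) (cF _ _ hF kF ne).
by exists z.
Qed.

End Free.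

(** * Free abelian groups of rank one and two acting on walls *)

Section FlatPlanes.
Import Order.TTheory GRing.Theory Num.Theory.
Local Open Scope ring_scope.

Lemma finite_int_bound (P : int -> Prop) (s : seq int) : (forall n, P n -> n \in s) ->
  exists2 K : int, 0 <= K & forall n, P n -> - K < n < K.
Proof.
move=> h; suff [K K0 hK] : exists2 K : int, 0 <= K & forall n, n \in s -> - K < n < K.
  by exists K => // n /h/hK.
elim: s {h} => [|a s [K K0 hK]]; first by exists 0.
exists (K + `|a| + 1) => [|n]; first by lia.
by rewrite inE => /orP[/eqP->|/hK]; lia.
Qed.

Section Line.
Variables (G : groupType) (A : wallAct G) (x0 : pt A) (psi : int -> G).
Hypothesis psiD : forall m n, psi (m + n) = (psi m * psi n)%g.
Hypothesis psi_inj : forall n, psi n = 1%g -> n = 0.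
Implicit Types (h e : wl A) (m n i j k : int).

Local Notation o n := (gp (psi n) x0).

Lemma hom0 : psi 0 = 1%g.
Proof. by apply: (@mulgI _ (psi 0)); rewrite -psiD addr0 mulg1. Qed.

Lemma homN n : psi (- n) = (psi n)^-1%g.
Proof. by apply: (@mulgI _ (psi n)); rewrite -psiD subrr hom0 mulgV. Qed.

Lemma sep_shift h k m n : sep (gw (psi k) h) (o m) (o n) = sep h (o (m - k)) (o (n - k)).
Proof. by rewrite sepGo -homN -!psiD ![- k + _]addrC. Qed.

Lemma sep_shiftN h k m n : sep (gw (psi (- k)) h) (o m) (o n) = sep h (o (m + k)) (o (n + k)).
Proof. by rewrite sep_shift !opprK. Qed.

Definition line_essential h := exists2 K : int, 0 <= K &
  forall m n, m <= - K -> K <= n -> sep h (o m) (o n).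

Lemma sep_step h i (n : nat) : sep h (o i) (o (i + n%:Z)) ->
  exists j, [/\ i <= j, j < i + n%:Z & sep h (o j) (o (j + 1))].
Proof.
elim: n => [|n IH]; first by rewrite addr0 sepxx.
rewrite (sepA h _ (o (i + n%:Z))); case E: (sep h (o i) (o (i + n%:Z))) => /= s.
  by have [j [j1 j2 j3]] := IH E; exists j; split=> //; lia.
exists (i + n%:Z); split; [lia|lia|].
by rewrite (_ : i + n%:Z + 1 = i + n.+1%:Z) //; lia.
Qed.

Definition periodic h := exists2 p : int, p != 0 & gw (psi p) h = h.

(** A periodic wall separates [o (-b)] from [o 0] exactly when it separates [o 0] from [o b], for b
    a multiple of the period, so it cannot separate the two ends. *)
Lemma line_essential_aperiodic h : line_essential h -> ~ periodic h.
Proof.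
move=> [K K0 hK] [p0 np0 e0].
have [p p_gt0 ep] : exists2 p : int, 0 < p & gw (psi p) h = h.
  case: (ltrP 0 p0) => [lt|le]; first by exists p0.
  by exists (- p0); [lia|rewrite homN -{1}e0 gwK].
have sh m n : sep h (o (m + p)) (o (n + p)) = sep h (o m) (o n).
  by rewrite -sep_shiftN homN -{1}ep gwK.
have shn (k : nat) m n : sep h (o (m + p * k%:Z)) (o (n + p * k%:Z)) = sep h (o m) (o n).
  elim: k m n => [|k IH] m n; first by rewrite mulr0 !addr0.
  by rewrite intS mulrDr mulr1 !addrA IH sh.
pose k := `|K|%N; pose b := p * k%:Z.
have bK : K <= b by rewrite /b /k; nia.
have : sep h (o (- b)) (o b) by apply: hK; lia.
have := shn k (- b) 0; rewrite -/b addNr add0r (sepA h (o (- b)) (o 0) (o b)) => ->.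
by rewrite addbb.
Qed.

Local Notation E := (seps x0 (o 1)).

Lemma crossE h n : sep h (o n) (o (n + 1)) = (gw (psi (- n)) h \in E).
Proof. by have := sep_shiftN h n 0 1; rewrite mem_seps hom0 gp1 add0r (addrC n) => ->. Qed.

Lemma aperiodic_bound h (s : seq (wl A)) : ~ periodic h ->
  exists2 K : int, 0 <= K & forall n, gw (psi (- n)) h \in s -> - K < n < K.
Proof.
move=> np.
have [|m n i _ _ ->|t ht] := @finite_by_key int 'I_(size s)
    (fun n => gw (psi (- n)) h \in s) (fun n (i : 'I_(size s)) => tnth (in_tuple s) i = gw (psi (- n)) h).
- move=> n hn; have /tnthP[i e] : gw (psi (- n)) h \in in_tuple s by [].
  by exists i.
- move=> e; apply: contrapT => ne; apply: np; exists (m - n).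
    by rewrite subr_eq0; apply/eqP.
  by rewrite psiD gwM -e -gwM -psiD subrr hom0 gw1.
- exact: finite_int_bound ht.
Qed.


Lemma aperiodic_tails h : ~ periodic h -> exists2 K : int, 0 <= K &
  (forall m n, K <= m -> K <= n -> sep h (o m) (o n) = false) /\
  (forall m n, m <= - K -> n <= - K -> sep h (o m) (o n) = false).
Proof.
move=> /(@aperiodic_bound _ E)[K K0 hK]; exists K => //.
have no i (n : nat) : (K <= i \/ i + n%:Z <= - K) -> sep h (o i) (o (i + n%:Z)) = false.
  move=> out; apply/negP => /sep_step[j [j1 j2]]; rewrite crossE => /hK; lia.
have both m n : (K <= m /\ K <= n) \/ (m <= - K /\ n <= - K) -> sep h (o m) (o n) = false.
  move=> H; case: (lerP m n) => [le|lt].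
    have -> : n = m + `|n - m|%N%:Z by lia.
    by apply: no; lia.
  rewrite sepC; have -> : m = n + `|m - n|%N%:Z by lia.
  by apply: no; lia.
by split=> m n h1 h2; apply: both; [left|right].
Qed.

(* If no wall is essential for an infinite cyclic group, the orbit of a
   finite-index subgroup converges to a point fixed by that subgroup. *)
Lemma line_essential_ex : exists h, line_essential h.
Proof.
apply: contrapT => noess.
have tails h : ~ periodic h -> exists2 K : int, 0 <= K &
    forall m n, (m <= - K \/ K <= m) -> (n <= - K \/ K <= n) -> sep h (o m) (o n) = false.
  move=> nph; have [K K0 [hp hn]] := aperiodic_tails nph; exists K => //.
  have mid : sep h (o (- K)) (o K) = false.
    apply/negP => s; apply: noess; exists h; exists K => // m n hm hn'.
    by rewrite (sepA h _ (o (- K))) hn // (sepA h (o (- K)) (o K)) s hp.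
  move=> m n [hm|hm] [hn'|hn']; [exact: hn| | |exact: hp].
    by rewrite (sepA h _ (o (- K))) hn // (sepA h (o (- K)) (o K)) mid hp.
  by rewrite sepC (sepA h _ (o (- K))) hn // (sepA h (o (- K)) (o K)) mid hp.
have [M M0 hM] : exists2 M : int, 0 < M & forall e, e \in E -> periodic e ->
    gw (psi M) e = e.
  elim: E => [|e s [M M0 hM]]; first by exists 1.
  have [[p np ep]|nper] := pselect (periodic e); last first.
    by exists M => // e'; rewrite inE => /orP[/eqP->//|]; exact: hM.
  have mul (q : int) (k : int) e' : gw (psi q) e' = e' -> gw (psi (q * k)) e' = e'.
    move=> h; have nat_mul (c : nat) : gw (psi (q * c%:Z)) e' = e'.
      by elim: c => [|c IH]; [rewrite mulr0 hom0 gw1|rewrite intS mulrDr mulr1 psiD gwM IH].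
    have [ek|ek] : k = `|k|%N%:Z \/ k = - `|k|%N%:Z by lia.
      by rewrite ek.
    by rewrite ek mulrN homN -{1}(nat_mul `|k|%N) gwK.
  exists (`|p| * M) => [|e']; first by rewrite pmulr_lgt0 // normr_gt0.
  rewrite inE => /orP[/eqP-> _|h1 h2]; last by rewrite mulrC; apply: mul; exact: hM.
  by have [->|->] : `|p| = p \/ `|p| = p * (-1) by [lia]; rewrite ?mul1r -?mulrA; apply: mul.
(* A wall of period M gives the same parity on two successive intervals of length M, hence does not
   separate points at distance 2M. This removes the periodic walls from the limit. *)
have [M2 [eM2 M20]] : exists M2 : int, M2 = M + M /\ 0 < M2 by exists (M + M); lia.
have sepM (n : nat) e i k : e \in E -> periodic e ->
    sep (gw (psi k) e) (o i) (o (i + M2 * n%:Z)) = false.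
  move=> eE pe; have eM := hM e eE pe.
  have sh m m' : sep (gw (psi k) e) (o (m + M)) (o (m' + M)) = sep (gw (psi k) e) (o m) (o m').
    by rewrite -sep_shiftN -gwM -psiD addrC psiD gwM -{1}eM homN gwK.
  elim: n => [|n IH]; first by rewrite mulr0 addr0 sepxx.
  rewrite (sepA _ _ (o (i + M2 * n%:Z))) IH /=.
  set b := i + _; have -> : i + M2 * n.+1%:Z = b + M + M by rewrite /b eM2; lia.
  by rewrite (sepA _ _ (o (b + M))) sh addbb.
have reach h m n : sep h (o m) (o n) -> exists k e, [/\ e \in E, h = gw (psi k) e &
    (m <= k < n) || (n <= k < m)].
  move=> s.
  have [j [j1 j2]] : exists j, ((m <= j < n) || (n <= j < m)) /\ sep h (o j) (o (j + 1)).
    case: (lerP m n) => [le|lt].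
      have en : n = m + `|n - m|%N%:Z by lia.
      rewrite en in s; have [j [j1 j2 j3]] := sep_step s; exists j; split=> //.
      by rewrite en; lia.
    have en : m = n + `|m - n|%N%:Z by lia.
    rewrite sepC en in s; have [j [j1 j2 j3]] := sep_step s; exists j; split=> //.
    by rewrite en; lia.
  move: j2; rewrite crossE => jE; exists j, (gw (psi (- j)) h); split=> //.
  by rewrite -gwM -psiD subrr hom0 gw1.
have evconst h : exists K : int, 0 <= K /\ forall a b : nat, K <= a%:Z -> K <= b%:Z ->
    sep h (o (M2 * a%:Z)) (o (M2 * b%:Z)) = false.
  have [[e [k [eE pe eh]]]|nper] := pselect (exists e k, [/\ e \in E, periodic e & h = gw (psi k) e]).
    exists 0; split=> // a b _ _.
    have z c : sep h (o 0) (o (M2 * c%:Z)) = false.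
      by rewrite eh -[M2 * _]add0r; exact: sepM.
    by rewrite (sepA h _ (o 0)) sepC !z.
  have [[m [n s]]|no] := pselect (exists m n, sep h (o m) (o n)); last first.
    by exists 0; split=> // a b _ _; apply/negP => s; apply: no; exists (M2 * a%:Z), (M2 * b%:Z).
  have nph : ~ periodic h.
    have [k [e [eE eh _]]] := reach _ _ _ s => -[p np ep]; apply: nper; exists e, k; split=> //.
    exists p => //; apply: (can_inj (gwK (psi k))).
    by rewrite -eh -gwM -psiD addrC psiD gwM -eh ep.
  have [K K0 hK] := tails h nph; exists K; split=> // a b ha hb.
  by apply: hK; right; nia.
have [B B0 hB] : exists2 B : int, 0 <= B & forall e, e \in E -> ~ periodic e ->
    forall m n, (m <= - B \/ B <= m) -> (n <= - B \/ B <= n) -> sep e (o m) (o n) = false.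
  elim: E => [|e s [B B0 hB]]; first by exists 0.
  have [pe|npe] := pselect (periodic e).
    by exists B => // e'; rewrite inE => /orP[/eqP->//|]; exact: hB.
  have [K K0 hK] := tails e npe; exists (B + K) => [|e']; first by lia.
  rewrite inE => /orP[/eqP-> _ m n h1 h2|h1 h2 m n h3 h4]; first by apply: hK; lia.
  by apply: (hB e' h1 h2); lia.
(* Walls that separate x0 from the limit of the points [o (M2 * a)]. *)
pose lim h := exists K : int, 0 <= K /\ forall a : nat, K <= a%:Z -> sep h x0 (o (M2 * a%:Z)).
have limN h : exists K : int, 0 <= K /\ forall a : nat, K <= a%:Z ->
    sep h x0 (o (M2 * a%:Z)) = `[< lim h >].
  have [K [K0 hK]] := evconst h.
  have ab a b : K <= a%:Z -> K <= b%:Z -> sep h x0 (o (M2 * a%:Z)) = sep h x0 (o (M2 * b%:Z)).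
    by move=> ha hb; rewrite (sepA h _ (o (M2 * b%:Z))) (sepC h (o _)) hK // addbF.
  exists K; split=> // a ha; apply/idP/asboolP => [s|[K' [K0' hK']]].
    by exists K; split=> // b hb; rewrite -(ab a).
  by rewrite (ab a (absz K + absz K')%N); [apply: hK'|done|]; lia.
(* Only aperiodic walls shifted by less than B can separate x0 from the limit, so the limit differs
   from x0 at finitely many walls and [sep_realize] applies. *)
pose cand := [seq gw (psi (c%:Z - B)) e | c <- iota 0 (absz B + absz B).+1, e <- E].
pose D := [seq h <- cand | `[< lim h >]].
have memD h : (h \in D) = `[< lim h >].
  rewrite mem_filter; case: asboolP => //= -[K [K0 hK]].
  have s0 : sep h (o 0) (o (M2 * `|K|%N%:Z)) by rewrite hom0 gp1; apply: hK; lia.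
  have [k [e [eE eh _]]] := reach _ _ _ s0.
  have npe : ~ periodic e.
    by move=> pe; have := sepM `|K|%N e 0 k eE pe; rewrite -eh add0r s0.
  have kB : - B < k < B.
    apply/negP => out; pose n := (absz K + absz k + absz B)%N.
    have : sep h (o 0) (o (M2 * n%:Z)) by rewrite hom0 gp1; apply: hK; rewrite /n; lia.
    by rewrite eh sep_shift (hB e eE npe) //; rewrite /n; nia.
  apply/allpairsP; exists (absz (k + B)%R, e); split=> //.
    by rewrite /fst mem_iota; lia.
  by rewrite eh; congr (gw (psi _) _) => /=; lia.
have [|y hy] := @sep_realize _ A x0 D.
  move=> h k; have [K [K0 hK]] := limN h; have [K' [K0' hK']] := limN k.
  exists (o (M2 * (absz K + absz K')%N%:Z)); rewrite !memD hK ?hK' //; lia.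
have fixy : gp (psi M2) y = y.
  apply: (@sep_eq _ A) => h.
  have [K1 [K10 hK1]] := limN h; have [K2 [K20 hK2]] := limN (gw (psi (- M2)) h).
  have [K3 [K30 hK3]] := evconst h.
  pose n := (absz K1 + absz K2 + absz K3)%N.
  have s1 : sep h y (o (M2 * n%:Z)) = false.
    by rewrite (sepA h y x0) sepC hy memD hK1 ?addbb // /n; lia.
  have s2 : sep h (gp (psi M2) y) (o (M2 * n.+1%:Z)) = false.
    rewrite intS mulrDr mulr1 psiD gpM -[h](gwVK (psi M2)) sepG -homN.
    by rewrite (sepA _ y x0) sepC hy memD hK2 ?addbb // /n; lia.
  have s3 : sep h (o (M2 * n%:Z)) (o (M2 * n.+1%:Z)) = false by apply: hK3; rewrite /n; lia.
  by rewrite (sepA h _ (o (M2 * n.+1%:Z))) s2 (sepA h _ (o (M2 * n%:Z))) sepC s3 sepC s1.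
(* All powers of [psi M2] fix the limit y and are distinct, against finiteness of the stabilizer. *)
have [s hs] := stab_fin y.
have fixn (n : nat) : gp (psi (M2 * n%:Z)) y = y.
  by elim: n => [|n IH]; [rewrite mulr0 hom0 gp1|rewrite intS mulrDr mulr1 psiD gpM IH].
have : (size [seq psi (M2 * c%:Z) | c <- iota 0 (size s).+1] <= size s)%N.
  apply: uniq_leq_size; last by move=> _ /mapP[n _ ->]; exact: hs.
  rewrite map_inj_in_uniq ?iota_uniq // => a b _ _ e.
  have : psi (M2 * a%:Z - M2 * b%:Z) = 1%g by rewrite psiD homN e mulgV.
  by move=> /psi_inj; nia.
by rewrite size_map size_iota ltnn.
Qed.

End Line.

Section SepDistance.
Variables (G : groupType) (A : wallAct G).
Implicit Types (u v w : pt A).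

Definition sdist u v := size (seps u v).

Lemma sdist_triangle v u w : (sdist u w <= sdist u v + sdist v w)%N.
Proof.
rewrite /sdist -size_cat; apply: uniq_leq_size; first exact: uniq_seps.
by move=> h; rewrite mem_cat !mem_seps (sepA h u v w); case: sep.
Qed.

Lemma sdistC u v : sdist u v = sdist v u.
Proof.
have h a b : (sdist a b <= sdist b a)%N.
  by apply: uniq_leq_size; [exact: uniq_seps|move=> h; rewrite !mem_seps sepC].
by apply/eqP; rewrite eqn_leq !h.
Qed.

Lemma sdistG g u v : sdist (gp g u) (gp g v) = sdist u v.
Proof.
have h a b c : (sdist (gp c a) (gp c b) <= sdist a b)%N.
  rewrite /sdist -(size_map (gw c) (seps a b)); apply: uniq_leq_size; first exact: uniq_seps.
  move=> h; rewrite mem_seps -{1}[h](gwVK c) sepG -mem_seps => hm.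
  by rewrite -[h](gwVK c); exact: map_f.
apply/eqP; rewrite eqn_leq h /=.
by have := h (gp g u) (gp g v) g^-1%g; rewrite !gpK.
Qed.

Lemma sdist_prod x (l : seq G) n : (forall g, g \in l -> (sdist x (gp g x) <= n)%N) ->
  (sdist x (gp (\prod_(g <- l) g)%g x) <= n * size l)%N.
Proof.
elim: l => [|g l IH] hl.
  rewrite big_nil gp1 /sdist; suff -> : seps x x = [::] by rewrite muln0.
  by case E : (seps x x) => [//|h s]; have := mem_head h s; rewrite -E mem_seps sepxx.
rewrite big_cons gpM mulnS; apply: leq_trans (sdist_triangle (gp g x) _ _) _.
rewrite leq_add ?hl ?mem_head // sdistG; apply: IH => k kl.
by apply: hl; rewrite inE kl orbT.
Qed.

End SepDistance.

Section Plane.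
Variables (G : groupType) (A : wallAct G) (x0 : pt A) (Phi : int -> int -> G).
Hypothesis PhiD : forall i j k l, Phi (i + k) (j + l) = (Phi i j * Phi k l)%g.
Hypothesis Phi_inj : forall i j, Phi i j = 1%g -> i = 0 /\ j = 0.
Implicit Types (h e : wl A) (m n i j k u v : int).

Local Notation o i j := (gp (Phi i j) x0).
Local Notation row := (Phi^~ 0).

Lemma rowD m n : row (m + n) = (row m * row n)%g.
Proof. by rewrite -PhiD addr0. Qed.

Lemma row_inj n : row n = 1%g -> n = 0.
Proof. by case/Phi_inj. Qed.

Lemma Phi0 : Phi 0 0 = 1%g. Proof. exact: (hom0 rowD). Qed.

Lemma PhiN i j : Phi (- i) (- j) = (Phi i j)^-1%g.
Proof. by apply: (@mulgI _ (Phi i j)); rewrite -PhiD !subrr Phi0 mulgV. Qed.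

Lemma gwPhiD i j k l h : gw (Phi i j) (gw (Phi k l) h) = gw (Phi (i + k) (j + l)) h.
Proof. by rewrite PhiD gwM. Qed.

Lemma sepPhi h i j k l k' l' :
  sep (gw (Phi i j) h) (o k l) (o k' l') = sep h (o (k - i) (l - j)) (o (k' - i) (l' - j)).
Proof.
rewrite sepGo -PhiN -!PhiD ![- i + _]addrC.
by rewrite ![- j + _]addrC.
Qed.

Lemma aperiodic_row h i j : ~ periodic row h -> ~ periodic row (gw (Phi i j) h).
Proof.
move=> np [p p0 e]; apply: np; exists p => //.
apply: (can_inj (gwK (Phi i j))).
by rewrite gwPhiD addrC [j + _]addrC -gwPhiD e.
Qed.

(** h crosses only finitely many edges from one row to the next, since its translates along the row
    direction are distinct; so the tails of row 0 and row j agree. *)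
Lemma row_tails h (j : nat) : ~ periodic row h -> exists2 K : int, 0 <= K &
  (forall m n, K <= m -> K <= n -> sep h (o m 0) (o n j%:Z) = false) /\
  (forall m n, m <= - K -> n <= - K -> sep h (o m 0) (o n j%:Z) = false).
Proof.
move=> np; elim: j => [|j [K K0 [hp hn]]].
  by have [K K0 [hp hn]] := aperiodic_tails x0 rowD np; exists K.
have [B B0 hB] := aperiodic_bound rowD (seps x0 (o 0 1)) (@aperiodic_row h 0 (- j%:Z) np).
have col n : (n <= - B \/ B <= n) -> sep h (o n j%:Z) (o n j.+1%:Z) = false.
  move=> out; apply/negP => s.
  suff /hB : gw (row (- n)) (gw (Phi 0 (- j%:Z)) h) \in seps x0 (o 0 1) by lia.
  rewrite gwPhiD add0r addr0 mem_seps -[x0 in sep _ x0](gp1 x0) -Phi0 sepPhi.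
  by rewrite !opprK !add0r [1 + _]addrC (_ : j%:Z + 1 = j.+1%:Z) //; lia.
exists (K + B) => [|]; first by lia.
split=> m n hm hn'.
  by rewrite (sepA h _ (o n j%:Z)) hp ?col //; lia.
by rewrite (sepA h _ (o n j%:Z)) hn ?col //; lia.
Qed.

Lemma transversal h : line_essential x0 row h -> exists u v,
  [/\ 0 < v, gw (Phi u v) h = h & forall y, sep h y (gp (Phi u v) y) = false].
Proof.
move=> es; have np := line_essential_aperiodic rowD es; have [K0 K00 hK0] := es.
have ex (j : nat) : exists i, gw (Phi (- i) (- j%:Z)) h \in seps x0 (o 1 0).
  have [K Kge [hp hn]] := row_tails j np; pose N := K0 + K.
  have s : sep h (o (- N) j%:Z) (o (- N + (absz (N + N)%R)%:Z) j%:Z).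
    rewrite (_ : - N + _ = N); last by rewrite /N; lia.
    rewrite (sepA h _ (o (- N) 0)) sepC hn /=; [|by rewrite /N; lia..].
    rewrite (sepA h _ (o N 0)) hp ?hK0 //; by rewrite /N; lia.
  have s' : sep (gw (Phi 0 (- j%:Z)) h) (o (- N) 0) (o (- N + (absz (N + N)%R)%:Z) 0).
    by rewrite sepPhi !subr0 !opprK !add0r.
  have [i [_ _]] := @sep_step G A x0 row _ _ _ s'; rewrite (crossE x0 rowD) gwPhiD add0r addr0 => c.
  by exists i.
have [f hf] := choice ex.
have [i [j [ij js e]]] : exists i j : nat, [/\ (i < j)%N, True &
    gw (Phi (- f i) (- i%:Z)) h = gw (Phi (- f j) (- j%:Z)) h].
  pose t := [seq gw (Phi (- f c) (- c%:Z)) h | c <- iota 0 (size (seps x0 (o 1 0))).+1].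
  have : ~~ uniq t.
    apply/negP => ut; have : (size t <= size (seps x0 (o 1 0)))%N.
      by apply: uniq_leq_size => // _ /mapP[j _ ->].
    by rewrite size_map size_iota ltnn.
  move=> /(uniqPn h)[i [j [ij js]]]; rewrite size_map size_iota in js.
  rewrite !(nth_map 0%N) ?size_iota ?(ltn_trans ij js) // !nth_iota ?(ltn_trans ij js) //.
  by rewrite !add0n => e; exists i, j.
pose u := f j - f i; pose v := j%:Z - i%:Z.
have st : gw (Phi u v) h = h.
  by have := congr1 (gw (Phi (f j) j%:Z)) e; rewrite !gwPhiD !subrr Phi0 gw1.
exists u, v; split=> //; first by rewrite /v; lia.
have cst y y' : sep h y (gp (Phi u v) y) = sep h y' (gp (Phi u v) y').
  have := sepG (Phi u v) h y y'; rewrite st.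
  rewrite (sepA h y y' (gp (Phi u v) y)) (sepA h y' (gp (Phi u v) y') (gp (Phi u v) y)).
  by rewrite (sepC h (gp (Phi u v) y')) => ->; rewrite addbC -addbA addbb addbF.
have [v' ev] : exists v' : nat, v = v'%:Z by exists (absz v); rewrite /v; lia.
have [K Kge [hp hn]] := row_tails v' np => y.
rewrite (cst y (o (K + `|u|) 0)) -gpM -PhiD addr0 ev; apply: hp; lia.
Qed.

(** The translates of h along row 0 are distinct, and about |m| - 2K of them separate x0 from the
    point with horizontal offset m; moving along (u, v) does not change sides of h. So h gives a
    linear functional bounded by the wall count. *)
Lemma transversal_bound h u v : line_essential x0 row h -> 0 < v -> gw (Phi u v) h = h ->
  (forall y, sep h y (gp (Phi u v) y) = false) ->
  exists2 K : int, 0 <= K & forall m j,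
    `|m| <= (sdist x0 (o (u * j + m) (v * j)))%:Z + K.
Proof.
move=> es v0 st pr; have np := line_essential_aperiodic rowD es; have [K K0 hK] := es.
exists (K + K) => [|]; first by lia.
have prN y : sep h y (gp (Phi (- u) (- v)) y) = false.
  by rewrite PhiN sepC -{2}[y](gpVK (Phi u v)) pr.
have prn (n : nat) y : sep h y (gp (Phi (u * n%:Z) (v * n%:Z)) y) = false /\
    sep h y (gp (Phi (- (u * n%:Z)) (- (v * n%:Z))) y) = false.
  elim: n y => [|n IH] y; first by rewrite !mulr0 oppr0 Phi0 gp1 !sepxx.
  rewrite intS !mulrDr !mulr1 !opprD !PhiD !gpM.
  have [IH1 IH2] := IH y; split.
    by rewrite (sepA h y (gp (Phi (u * n%:Z) (v * n%:Z)) y)) IH1 pr.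
  by rewrite (sepA h y (gp (Phi (- (u * n%:Z)) (- (v * n%:Z))) y)) IH2 prN.
have prz j y : sep h y (gp (Phi (u * j) (v * j)) y) = false.
  have [->|->] : j = (absz j)%:Z \/ j = - (absz j)%:Z by lia.
    exact: (prn _ _).1.
  by rewrite !mulrN; exact: (prn _ _).2.
have pos m j : 0 <= m -> m <= (sdist x0 (o (u * j + m) (v * j)))%:Z + (K + K).
  move=> m0; pose c := absz (m - K - K + 1)%R.
  have [small|big] := lerP m (K + K); first by lia.
  suff : (c <= sdist x0 (o (u * j + m) (v * j)))%N by rewrite /c; lia.
  have <- : size [seq gw (Phi (K + b%:Z) 0) h | b <- iota 0 c] = c.
    by rewrite size_map size_iota.
  apply: uniq_leq_size.
    rewrite map_inj_in_uniq ?iota_uniq // => a b _ _ e.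
    apply: contrapT => ne; apply: np; exists (a%:Z - b%:Z); first by lia.
    have := congr1 (gw (Phi (- (K + b%:Z)) 0)) e; rewrite !gwPhiD addNr addr0 Phi0 gw1.
    by move=> e'; rewrite -[RHS]e'; congr (gw (Phi _ _) h); lia.
  move=> h0 /mapP[i]; rewrite mem_iota add0n => /andP[_ ic] ->.
  rewrite mem_seps -[x0 in sep _ x0](gp1 x0) -Phi0 sepPhi !subr0 add0r.
  rewrite (sepA h _ (o (m - (K + i%:Z)) 0)) hK /=; [|by rewrite /c in ic; lia..].
  rewrite -(_ : gp (Phi (u * j) (v * j)) (o (m - (K + i%:Z)) 0) =
     o (u * j + m - (K + i%:Z)) (v * j)) ?prz // -gpM -PhiD addr0.
  by rewrite addrA.
move=> m j; have [m0|m0] := lerP 0 m; first by have := pos m j m0; lia.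
have := pos (- m) (- j); rewrite !mulrN -opprD => /(_ _).
have -> : sdist x0 (o (- (u * j + m)) (- (v * j))) = sdist x0 (o (u * j + m) (v * j)).
  by rewrite PhiN -(sdistG (Phi (u * j + m) (v * j))) gpVK sdistC.
by move=> h'; have := h' _; lia.
Qed.

End Plane.

Lemma plane_arith (i j u v u2 v2 K K2 d : int) : 0 < v -> 0 < v2 -> 0 <= K ->
  0 <= K2 -> 0 <= d -> `|i * v - u * j| <= d * v + K ->
  `|j * v2 - u2 * (i * v - u * j)| <= d * (v * v2) + K2 ->
  `|i| + `|j| <= ((1 + `|u|) * (v2 * v + K2 + `|u2| * (v + K)) + v + K) * (d + 1).
Proof.
move=> v0 v20 K0 K20 d0; set m := i * v - u * j => b1 b2.
have b3 : `|j| <= d * (v * v2) + K2 + `|u2| * (d * v + K).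
  have h1 : `|j| <= `|j * v2| by rewrite normrM ler_peMr ?normr_ge0 //; lia.
  have h2 : `|u2 * m| <= `|u2| * (d * v + K) by rewrite normrM ler_wpM2l.
  by lia.
have b4 : `|i| <= d * v + K + `|u| * `|j|.
  have h1 : `|i| <= `|i * v| by rewrite normrM ler_peMr ?normr_ge0 //; lia.
  by have := normrM u j; rewrite /m in b1; lia.
have u0 : 0 <= `|u| by []. have u20 : 0 <= `|u2| by [].
move: (`|u|) (`|u2|) (`|i|) (`|j|) u0 u20 b3 b4 => a b p q a0 b0 b3 b4.
pose B := d * (v * v2) + K2 + b * (d * v + K).
have hB : B <= (v2 * v + K2 + b * (v + K)) * (d + 1).
  have : 0 <= d * K2 + v2 * v + b * (d * K) + b * v by rewrite !addr_ge0 ?mulr_ge0 //; lia.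
  by rewrite /B; lia.
have ha : (1 + a) * q <= (1 + a) * ((v2 * v + K2 + b * (v + K)) * (d + 1)).
  by apply: ler_wpM2l; [lia|exact: le_trans b3 hB].
have : d * v + K <= (v + K) * (d + 1).
  have : 0 <= d * K by rewrite mulr_ge0.
  by lia.
by lia.
Qed.

Lemma plane_linear (G : groupType) (A : wallAct G) (x0 : pt A) (Phi : int -> int -> G) :
  (forall i j k l, Phi (i + k) (j + l) = (Phi i j * Phi k l)%g) ->
  (forall i j, Phi i j = 1%g -> i = 0 /\ j = 0) ->
  exists C : nat, forall i j,
    (absz i + absz j <= C * (sdist x0 (gp (Phi i j) x0)).+1)%N.
Proof.
move=> PhiD Phi_inj.
have [h1 e1] := line_essential_ex x0 (rowD PhiD) (row_inj Phi_inj).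
have [u [v [v0 st pr]]] := transversal PhiD e1.
have [K K0 hK] := transversal_bound PhiD e1 v0 st pr.
(* New coordinates whose rows run along the stabilizing direction (u, v) of h1. A wall essential for
   these rows gives a functional independent of the first. *)
pose Phi2 s t := Phi (u * s + t) (v * s).
have Phi2D i j k l : Phi2 (i + k) (j + l) = (Phi2 i j * Phi2 k l)%g.
  by rewrite /Phi2 -PhiD; congr (Phi _ _); lia.
have Phi2_inj i j : Phi2 i j = 1%g -> i = 0 /\ j = 0.
  move=> /Phi_inj[e2 /eqP]; rewrite mulf_eq0 gt_eqF //= => /eqP i0.
  by move: e2; rewrite i0 mulr0 add0r.
have [h2 e2] := line_essential_ex x0 (rowD Phi2D) (row_inj Phi2_inj).
have [u2 [v2 [v20 st2 pr2]]] := transversal Phi2D e2.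
have [K2 K20 hK2] := transversal_bound Phi2D e2 v20 st2 pr2.
(* The functionals are evaluated at lattice points of the form u * j + m, v * j, which need not be
   (i, j) itself. Passing to the multiples of (i, j) by v and by v * v2 reaches such points, at the
   cost of that factor in the wall count. *)
have mult (n : nat) (i j : int) : (sdist x0 (gp (Phi (i * n%:Z)%R (j * n%:Z)%R) x0) <=
    sdist x0 (gp (Phi i j) x0) * n)%N.
  have -> : Phi (i * n%:Z) (j * n%:Z) = (\prod_(g <- nseq n (Phi i j)) g)%g.
    elim: n => [|n IH]; first by rewrite !mulr0 (Phi0 PhiD) big_nil.
    by rewrite intS !mulrDr !mulr1 PhiD IH /= big_cons.
  rewrite -{2}(size_nseq n (Phi i j)); apply: sdist_prod => g.
  by rewrite mem_nseq => /andP[_ /eqP->].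
have [nv ev] : exists nv : nat, v = nv%:Z by exists (absz v); lia.
have [nv2 ev2] : exists nv2 : nat, v2 = nv2%:Z by exists (absz v2); lia.
exists (absz ((1 + `|u|) * (v2 * v + K2 + `|u2| * (v + K)) + v + K)).
move=> i j; set d := sdist _ _.
have b1 : `|i * v - u * j| <= d%:Z * v + K.
  apply: le_trans (hK _ j) _; rewrite lerD2r ev -PoszM lez_nat.
  apply: leq_trans (mult nv i j); rewrite -ev mulrC.
  by rewrite (_ : j * u + _ = i * v) 1?[v * j]mulrC //; ring.
have b2 : `|j * v2 - u2 * (i * v - u * j)| <= d%:Z * (v * v2) + K2.
  set k := i * v - u * j; have := hK2 (j * v2 - u2 * k) k; rewrite /Phi2.
  have -> : u2 * k + (j * v2 - u2 * k) = j * v2 by rewrite addrC subrK.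
  have -> : u * (j * v2) + v2 * k = i * (v * v2) by rewrite /k; ring.
  have -> : v * (j * v2) = j * (v * v2) by ring.
  move=> h; apply: le_trans h _; rewrite lerD2r ev ev2 -!PoszM lez_nat.
  exact: mult.
have := plane_arith v0 v20 K0 K20 (le0z_nat d) b1 b2.
set X := _ + v + K; move=> h.
have X0 : 0 <= X.
  by rewrite /X !addr_ge0 ?mulr_ge0 ?addr_ge0 ?mulr_ge0 ?addr_ge0 // ?ltW.
have eX : (absz X)%:Z = X by rewrite gez0_abs.
rewrite -lez_nat PoszD PoszM eX -addn1 PoszD.
exact: h.
Qed.

End FlatPlanes.

(** * Integer powers *)

Section HnnExtensions.
Import Order.TTheory GRing.Theory Num.Theory.
Local Open Scope ring_scope.

Definition zpow (G : groupType) (c : G) (k : int) : G :=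
  match k with Posz p => (c ^+ p)%g | Negz p => (c ^- p.+1)%g end.

Lemma zpow1S (G : groupType) (c : G) k : zpow c (k + 1) = (zpow c k * c)%g.
Proof.
case: k => [p|[|p]].
- by rewrite -PoszD addn1 /= expgSr.
- by rewrite /= expg1 mulVg.
- have -> : Negz p.+1 + 1 = Negz p by lia.
  by rewrite /= [(c ^+ p.+2)%g]expgS invgM mulgVK.
Qed.

Lemma zpowD (G : groupType) (c : G) k l : zpow c (k + l) = (zpow c k * zpow c l)%g.
Proof.
have h j (p : nat) : zpow c (j + p%:Z) = (zpow c j * c ^+ p)%g.
  elim: p => [|p IH]; first by rewrite addr0 expg0 mulg1.
  by rewrite (_ : j + p.+1%:Z = j + p%:Z + 1) ?zpow1S ?IH ?expgSr ?mulgA //; lia.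
case: l => [p|p]; first exact: h.
have e : zpow c k = (zpow c (k + Negz p) * c ^+ p.+1)%g.
  by rewrite -h; congr (zpow c _); lia.
by rewrite e /= mulgK.
Qed.

Lemma zpow0 (G : groupType) (c : G) : zpow c 0 = 1%g. Proof. by []. Qed.

Lemma zpow1 (G : groupType) (c : G) : zpow c 1 = c. Proof. by rewrite /= expg1. Qed.

Lemma zpowN (G : groupType) (c : G) k : zpow c (- k) = (zpow c k)^-1%g.
Proof. by apply: (@mulgI _ (zpow c k)); rewrite -zpowD subrr mulgV. Qed.

Lemma int_const (T : Type) (F : int -> T) : (forall k, F (k + 1) = F k) -> forall k, F k = F 0.
Proof.
move=> h; elim/int_rect => [//|n <-|n <-]; first by rewrite -(h n%:Z); congr F; lia.
by rewrite -[LHS]h; congr F; lia.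
Qed.

Lemma hom_unit (G : groupType) (e : G -> int) :
  (forall g h, e (g * h)%g = e g + e h) -> e 1%g = 0.
Proof. by move=> eM; have := eM 1%g 1%g; rewrite mulg1; lia. Qed.

Lemma hom_inv (G : groupType) (e : G -> int) :
  (forall g h, e (g * h)%g = e g + e h) -> forall g, e g^-1%g = - e g.
Proof. by move=> eM g; have := eM g g^-1%g; rewrite mulgV (hom_unit eM); lia. Qed.

Lemma hom_zpow (G : groupType) (e : G -> int) :
  (forall g h, e (g * h)%g = e g + e h) -> forall g k, e (zpow g k) = e g * k.
Proof.
move=> eM g k; have := @int_const _ (fun j => e (zpow g j) - e g * j) _ k.
rewrite zpow0 mulr0 (hom_unit eM) => h; apply/eqP; rewrite -subr_eq0 h // => j.
by rewrite zpow1S eM; lia.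
Qed.

(** * HNN extensions of free groups along cyclic subgroups *)

(* In the extension with stable letter T and relation T b T^-1 = (r b)^(+-1), the
   closed path at q spelled by the relator crosses the T-edges at q and at
   [q * edge_elt], the b-edge at [q * bet] and the path [edge_word] at q; [cocycle]
   says that cochains vanishing on these paths are coboundaries. *)
Section Hnn.
Variables (G : groupType) (I : finType) (y : I -> G) (T b : G) (r : word I).
Variable eps : bool.

Definition letter (a : option I) : G := if a is Some i then y i else b.
Definition letter_val (l : option I * bool) : G := if l.2 then (letter l.1)^-1%g else letter l.1.
Definition lift_word : word (option I) := [seq (Some l.1, l.2) | l <- r].
Definition edge_word : word (option I) := lift_word ++ [:: (None, false)].
Definition rho : G := weval letter lift_word.
Definition edge_elt : G := weval letter edge_word.
Definition bet : G := if eps then (edge_elt * T)%g else T.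
(** The cell based at q has its b-edges at q * bet and at q * rho = q * bet * tau. Right
    multiplication by [tau] thus passes across a cell from one b-edge to the other, one level of [e]
    down. *)
Definition tau : G := (bet^-1 * rho)%g.
Local Notation n := (size edge_word).
Definition edge_letter (j : int) := nth (None, false) edge_word (absz (j %% n)%Z).
Definition letter_inv (l : option I * bool) := (l.1, ~~ l.2).

Variable e : G -> int.
Hypothesis eM : forall g h, e (g * h)%g = e g + e h.
Hypothesis eT : e T = 1.
Hypothesis elt : forall a, e (letter a) = 0.
Hypothesis rel : (T * b = (if eps then edge_elt^-1 else edge_elt) * T)%g.
Hypothesis cocycle : forall (cT : G -> bool) (c : G -> option I -> bool),
  (forall q, cT q (+) cT (q * edge_elt)%g (+) c (q * bet)%g None
     (+) wsum letter c q edge_word = false) ->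
  exists s : G -> bool, (forall g, s (g * T)%g = s g (+) cT g) /\
    forall g a, s (g * letter a)%g = s g (+) c g a.
Hypothesis W_det : forall i j, edge_letter i = edge_letter j ->
  edge_letter (i + 1) = edge_letter (j + 1) -> (n %| i - j)%Z.
Hypothesis W_noinv : forall i j, edge_letter i = letter_inv (edge_letter (j + 1)) ->
  edge_letter (i + 1) <> letter_inv (edge_letter j).
Hypothesis W_red : forall i, edge_letter (i + 1) <> letter_inv (edge_letter i).
Hypothesis W_bb : forall i, (edge_letter i).1 = None -> (edge_letter (i + 1)).1 <> None.

Lemma exp_word u : e (weval letter u) = 0.
Proof.
elim: u => [|[a s] u IH]; first by rewrite weval_nil (hom_unit eM).
by rewrite weval_cons eM IH addr0; case: s; rewrite ?(hom_inv eM) elt ?oppr0.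
Qed.

Lemma exp_bet : e bet = 1.
Proof. by rewrite /bet; case: eps; rewrite ?eM ?eT // /edge_elt exp_word. Qed.

Lemma exp_tau : e tau = - 1.
Proof. by rewrite /tau eM (hom_inv eM) exp_bet /rho exp_word addr0. Qed.

(* Two points of G are in the same coset of the vertex group. *)
Definition fstep g h := exists a, h = (g * letter a)%g.
Definition fconn := clos_refl_sym_trans _ fstep.

Lemma fconn_refl g : fconn g g. Proof. exact: rst_refl. Qed.
Lemma fconn_sym g h : fconn g h -> fconn h g. Proof. exact: rst_sym. Qed.
Lemma fconn_trans h g k : fconn g h -> fconn h k -> fconn g k. Proof. exact: rst_trans. Qed.

Lemma fconn_letter g a : fconn g (g * letter a)%g.
Proof. by apply: rst_step; exists a. Qed.

Lemma fconn_e g h : fconn g h -> e g = e h.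
Proof.
by elim=> [x z [a ->]|//|x z _ ->|x z t _ -> _ ->] //; rewrite eM elt addr0.
Qed.

Lemma wsum0 (c : G -> option I -> bool) u g :
  (forall h a, a \in [seq l.1 | l <- u] -> e h = e g -> c h a = false) -> wsum letter c g u = false.
Proof.
elim: u g => [//|[a s] u IH] g /= h0.
have ha : a \in a :: [seq l.1 | l <- u] by rewrite mem_head.
have hu a' : a' \in [seq l.1 | l <- u] -> a' \in a :: [seq l.1 | l <- u].
  by move=> h; rewrite inE h orbT.
have es : e (g * (letter a)^-1)%g = e g by rewrite eM (hom_inv eM) elt oppr0 addr0.
have es' : e (g * letter a)%g = e g by rewrite eM elt addr0.
case: s h0 => h0; rewrite h0 // IH // => h a' /hu h1 h2; apply: h0 => //.
  by rewrite h2.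
by rewrite h2.
Qed.

Lemma wsum_eq (c c' : G -> option I -> bool) g :
  (forall h i, c h (Some i) = c' h (Some i)) ->
  wsum letter c g lift_word = wsum letter c' g lift_word.
Proof.
rewrite /lift_word => h; elim: r g => [//|[i s] u IH] g /=.
by case: s; rewrite h IH.
Qed.

Lemma wsumW c q : wsum letter c q edge_word = wsum letter c q lift_word (+) c (q * rho)%g None.
Proof. by rewrite /edge_word wsum_cat /= addr0. Qed.

(* The cut dual to an edge of a vertex tree is carried into the adjacent
   vertex spaces by translating along powers of [tau]. *)
Lemma letter_cut x0 a0 : exists s : G -> bool, forall g a, fconn x0 g ->
  s (g * letter a)%g = s g (+) `[< g = x0 /\ a = a0 >].
Proof.
case: a0 => [i0|].
  pose c0 g (a : option I) := `[< g = x0 /\ a = Some i0 >].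
  pose nE q := wsum letter c0 q lift_word.
  have nE0 q : e q != e x0 -> nE q = false.
    move=> ne; apply: wsum0 => h a _ eh; apply/asboolP => -[hx _].
    by move: ne; rewrite -eh hx eqxx.
  (* Only edges at the level of x0 carry the indicator. The cells based at that level force values
     on b-edges one level up, and [tau] propagates them upwards; the exponent brings g down to level
     e x0 + 1, where [bet^-1] recovers the base of the cell. Below, everything is 0. *)
  pose c g (a : option I) := if a is Some i then c0 g a else
    if e x0 < e g then nE (g * tau ^+ absz (e g - 1 - e x0)%R * bet^-1)%g else false.
  have [|s [_ hs]] := @cocycle (fun _ => false) c.
    move=> q; rewrite !addFb wsumW (wsum_eq (c' := c0)) // -/(nE q) /c !eM exp_bet.
    rewrite (_ : e rho = 0) ?addr0; last exact: exp_word.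
    have [lt1|gt1|eq1] := ltgtP (e q) (e x0).
    - have -> : (e x0 < e q + 1) = false by lia.
      by rewrite nE0 // lt_eqF.
    - rewrite ifT; last by lia.
      rewrite (nE0 q) ?addFb; last by lia.
      have -> : absz (e q + 1 - 1 - e x0)%R = (absz (e q - 1 - e x0)%R).+1 by lia.
      by rewrite expgS mulgA -[(q * bet * tau)%g]mulgA /tau mulVKg addbb.
    - rewrite ifT; last by lia.
      rewrite eq1 (_ : e x0 + 1 - 1 - e x0 = 0) ?expg0 ?mulg1 ?mulgK ?addbF ?addbb //.
      by lia.
  exists s => g a /fconn_e eg; rewrite hs; congr (_ (+) _); case: a => [i //|] /=.
  by rewrite eg ltxx; apply/esym/asboolP => -[].
(* For a b-edge the cochain must be invariant under [tau]; the orbit of x0 meets the level of x0 in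
   x0 alone, as [tau] lowers [e]. *)
pose c g (a : option I) := if a is Some i then false else `[< exists k, g = (x0 * zpow tau k)%g >].
have [|s [_ hs]] := @cocycle (fun _ => false) c.
  move=> q; rewrite !addFb wsumW.
  have -> : wsum letter c q lift_word = false.
    by apply: wsum0 => h a; rewrite /lift_word -map_comp => /mapP[l _ ->].
  rewrite addFb.
  suff -> : c (q * bet)%g None = c (q * rho)%g None by rewrite addbb.
  have e2 : (q * rho = q * bet * tau)%g by rewrite /tau -mulgA mulVKg.
  apply/asboolP/asboolP => -[k hk].
    by exists (k + 1); rewrite e2 hk zpow1S [RHS]mulgA.
  by exists (k - 1); rewrite zpowD mulgA -hk zpowN zpow1 e2 mulgK.
exists s => g a fg; rewrite hs; congr (_ (+) _); case: a => [i|] /=.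
  by apply/esym/asboolP => -[].
apply/asboolP/asboolP => [[k hk]|[-> _]]; last by exists 0; rewrite mulg1.
split=> //; have := fconn_e fg; rewrite hk eM (hom_zpow eM) exp_tau => h.
by have -> : k = 0 by [lia]; rewrite mulg1.
Qed.

(** The side function of a Bass-Serre edge: the coset g0 <edge_elt> of T-edges. A cell has its
    T-edges at q and q * edge_elt, so both belong to the coset or neither does. *)
Lemma edge_cut g0 : exists s : G -> bool,
  (forall g, s (g * T)%g = s g (+) `[< exists k, g = (g0 * zpow edge_elt k)%g >]) /\
  forall g a, s (g * letter a)%g = s g.
Proof.
have [|s [h1 h2]] := @cocycle (fun g => `[< exists k, g = (g0 * zpow edge_elt k)%g >]) (fun _ _ => false).
  move=> q; rewrite wsum0 // !addbF.
  suff -> : `[< exists k, q = (g0 * zpow edge_elt k)%g >] =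
      `[< exists k, (q * edge_elt)%g = (g0 * zpow edge_elt k)%g >] by rewrite addbb.
  apply/asboolP/asboolP => -[k hk].
    by exists (k + 1); rewrite hk zpow1S mulgA.
  by exists (k - 1); rewrite zpowD mulgA -hk zpowN zpow1 mulgK.
by exists s; split=> // g a; rewrite h2 addbF.
Qed.

Definition fadj g h := fstep g h \/ fstep h g.

Lemma fadj_sym g h : fadj g h -> fadj h g. Proof. by case; [right|left]. Qed.

Lemma fadj_fconn g h : fadj g h -> fconn g h.
Proof. by case=> [h1|h1]; [exact: rst_step|apply: rst_sym; exact: rst_step]. Qed.

Lemma fadj_letter g l : fadj g (g * letter_val l)%g.
Proof.
case: l => [a [|]]; rewrite /letter_val /=; last by left; exists a.
by right; exists a; rewrite mulgVK.
Qed.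

(** [letter_cut] only controls the coset of its base point, so the side function is replaced by
    [false] on the other cosets. *)
Lemma vertex_forest : forest fadj.
Proof.
have main g a : exists s, tree_edge_cut fadj g (g * letter a)%g s.
  have [s hs] := letter_cut g a.
  pose s' h := if `[< fconn g h >] then s h else false; exists s'; split.
    rewrite /s' !asboolT; [|exact: fconn_letter|exact: fconn_refl].
    by rewrite hs ?asboolT //; [case: (s g)|exact: fconn_refl].
  have st c a' : s' c <> s' (c * letter a')%g -> c = g /\ a' = a.
    rewrite /s'; case: asboolP => [fc|nf].
      rewrite asboolT; last by apply: fconn_trans fc _; exact: fconn_letter.
      by rewrite hs //; case: asboolP => //; rewrite addbF.
    by rewrite asboolF // => fc; apply: nf; apply: fconn_trans fc _; apply: fconn_sym; exact: fconn_letter.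
  move=> c d [[a' ed]|[a' ec]] n.
    by subst d; have [-> ->] := st _ _ n; left.
  by subst c; have [-> ->] := st _ _ (nesym n); right.
move=> g h [[a ->]|[a ->]]; first exact: main.
have [s [n cut]] := main h a; exists s; split; first exact: nesym.
by move=> c d cd ncd; have [|] := cut c d cd ncd; [right|left].
Qed.

Lemma letter_nontrivial g a a' : (g * letter a * letter a')%g <> g.
Proof.
move=> h; have [s hs] := letter_cut g a.
have s1 : s (g * letter a)%g = ~~ s g by rewrite hs ?asboolT ?addbT //; exact: fconn_refl.
have := hs (g * letter a)%g a' (fconn_letter _ _); rewrite h s1 asboolF.
  by case: (s g).
by move=> [h2 _]; move: s1; rewrite h2; case: (s g).
Qed.

Lemma letter_inj : injective letter.
Proof.
move=> a a' h; have [s hs] := letter_cut 1%g a.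
have h1 := hs 1%g a (fconn_refl _); have h2 := hs 1%g a' (fconn_refl _).
move: h1; rewrite h h2 [in RHS]asboolT // => /addbI h3.
by have /asboolP[] : `[<1%g = 1%g :> G /\ a' = a>] by rewrite h3.
Qed.

Lemma letter_val_inj : injective letter_val.
Proof.
move=> [a [|]] [a' [|]]; rewrite /letter_val /=.
- by move=> /invg_inj/letter_inj->.
- move=> h; case: (@letter_nontrivial 1%g a a'); rewrite -h mul1g mulgV //.
- move=> h; case: (@letter_nontrivial 1%g a a'); rewrite h mul1g mulVg //.
- by move=> /letter_inj->.
Qed.

Lemma letter_val_inv l : letter_val (letter_inv l) = (letter_val l)^-1%g.
Proof. by case: l => a [|]; rewrite /letter_val /letter_inv //= invgK. Qed.

Lemma size_edge_word : (0 < n)%N. Proof. by rewrite size_cat addn1. Qed.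

(** One boundary line of the strip over an edge, spelled by the periodic word [edge_word]. The other
    one, [bline], is spelled by powers of b; the rungs of the strip sit at multiples of [scale]. *)
Definition wline g0 (j : int) : G :=
  (g0 * zpow edge_elt (j %/ n)%Z * weval letter (take (absz (j %% n)%Z) edge_word))%g.

Lemma wline_step g0 j : wline g0 (j + 1) = (wline g0 j * letter_val (edge_letter j))%g.
Proof.
have n0 := size_edge_word; rewrite /wline /edge_letter.
have n0' : (n%:Z != 0) by lia.
set q := (j %/ n)%Z; pose i := absz (j %% n)%Z.
have ei : (j %% n)%Z = i%:Z by rewrite /i; have := modz_ge0 j n0'; lia.
have lti : (i < n)%N by have := @ltz_pmod j n; lia.
have ej : j = q * n%:Z + i%:Z by rewrite -ei; exact: divz_eq.
have evE : letter_val (nth (None, false) edge_word i) = weval letter [:: nth (None, false) edge_word i].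
  by case: (nth _ _ _) => a s; rewrite weval_cons weval_nil mulg1 /letter_val.
have tk : (weval letter (take i edge_word) * letter_val (nth (None, false) edge_word i))%g = weval letter (take i.+1 edge_word).
  by rewrite evE -weval_cat cats1 -take_nth.
rewrite ei /= -[RHS]mulgA tk; have [lt1|ge1] := ltnP i.+1 n.
  have -> : ((j + 1) %/ n)%Z = q.
    by rewrite ej -addrA divzMDl // divz_small ?addr0 //; lia.
  have -> : ((j + 1) %% n)%Z = i.+1%:Z.
    by rewrite ej -addrA modzMDl modz_small; lia.
  by [].
have ei1 : i.+1 = n by lia.
have -> : ((j + 1) %/ n)%Z = q + 1.
  by rewrite ej (_ : q * n%:Z + i%:Z + 1 = (q + 1) * n%:Z) ?mulzK //; lia.
have -> : ((j + 1) %% n)%Z = 0.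
  by rewrite ej (_ : q * n%:Z + i%:Z + 1 = (q + 1) * n%:Z) ?modzMl //; lia.
by rewrite ei1 take_size zpow1S take0 weval_nil mulg1 mulgA.
Qed.

Lemma wline_scale g0 k : wline g0 (n%:Z * k) = (g0 * zpow edge_elt k)%g.
Proof.
have n0 := size_edge_word.
by rewrite /wline mulrC mulzK ?modzMl ?take0 ?weval_nil ?mulg1 //; lia.
Qed.

Definition bline g0 (j : int) : G := (g0 * zpow edge_elt j * T)%g.

Lemma bline_step g0 j : bline g0 (j + 1) = (bline g0 j * letter_val (None, eps))%g.
Proof.
rewrite /bline zpow1S -!mulgA; congr (_ * (_ * _))%g.
rewrite /letter_val /=; move: rel; case: eps => h.
  by apply: (@mulIg _ b); rewrite mulgVK -mulgA h mulVKg.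
by rewrite h.
Qed.

Definition line (t : bool) g0 := if t then bline g0 else wline g0.
Definition scale (t : bool) : int := if t then 1 else n%:Z.
Definition line_letter (t : bool) (j : int) := if t then (None, eps) else edge_letter j.

Lemma line_step t g0 j : line t g0 (j + 1) = (line t g0 j * letter_val (line_letter t j))%g.
Proof. by case: t; [exact: bline_step|exact: wline_step]. Qed.

Definition base (t : bool) g0 k : G := if t then (g0 * zpow edge_elt k * T)%g else (g0 * zpow edge_elt k)%g.

Lemma line_scale t g0 k : line t g0 (scale t * k) = base t g0 k.
Proof. by case: t; rewrite /line /scale /base ?mul1r // wline_scale. Qed.

Lemma line_reduced t g0 : reduced_line fadj (line t g0).
Proof.
move=> j; split; first by rewrite line_step; exact: fadj_letter.
rewrite (_ : j + 2 = j + 1 + 1); last by lia.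
rewrite !line_step -mulgA -{1}[line t g0 j]mulg1 => /mulgI/esym h.
have h1 : letter_val (line_letter t (j + 1)) = letter_val (letter_inv (line_letter t j)).
  by apply: (@mulgI _ (letter_val (line_letter t j))); rewrite h letter_val_inv mulgV.
move: h1 => /letter_val_inj; case: t {h} => /=; last exact: W_red.
by rewrite /letter_inv; case: eps.
Qed.

Lemma line_conn t g0 i j : fconn (line t g0 i) (line t g0 j).
Proof.
have h (p : nat) k : fconn (line t g0 k) (line t g0 (k + p%:Z)).
  elim: p => [|p IH]; first by rewrite addr0; exact: fconn_refl.
  rewrite (_ : k + p.+1%:Z = k + p%:Z + 1) ?line_step; [apply: fconn_trans IH _|by lia].
  by apply: fadj_fconn; exact: fadj_letter.
have [le|le] := lerP i j.
  by have := h (absz (j - i)) i; rewrite (_ : i + _ = j) //; lia.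
by apply: fconn_sym; have := h (absz (i - j)) j; rewrite (_ : j + _ = i) //; lia.
Qed.

(* The only place where the conditions [W_det], [W_noinv], [W_red] and [W_bb] on
   two-letter subwords are used. *)
Lemma line_det t t' g0 g1 i j (d : int) : d = 1 \/ d = -1 ->
  line t g0 i = line t' g1 j -> line t g0 (i + 1) = line t' g1 (j + d) ->
  line t g0 (i + 2) = line t' g1 (j + 2 * d) -> exists k, g1 = (g0 * zpow edge_elt k)%g.
Proof.
move=> hd h0 h1 h2.
have bb i' j' : bline g0 i' = bline g1 j' -> exists k, g1 = (g0 * zpow edge_elt k)%g.
  move=> /mulIg h; exists (i' - j').
  by rewrite zpowD mulgA h zpowN mulgK.
have e12 : i + 2 = i + 1 + 1 by lia.
rewrite e12 !line_step in h2; rewrite line_step in h1.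
case: hd => hd; rewrite {}hd in h1 h2.
  rewrite (_ : j + 2 * 1 = j + 1 + 1) in h2; last by lia.
  rewrite !line_step in h1 h2.
  have l1 : line_letter t i = line_letter t' j by apply: letter_val_inj; move: h1; rewrite h0 => /mulgI.
  have l2 : line_letter t (i + 1) = line_letter t' (j + 1).
    by apply: letter_val_inj; move: h2; rewrite h0 l1 => /mulgI.
  case: t t' h0 l1 l2 {h1 h2} => -[] h0 l1 l2.
  - exact: bb h0.
  - by case: (@W_bb j); [rewrite -[edge_letter j]l1|rewrite -[edge_letter (j + 1)]l2].
  - by case: (@W_bb i); [rewrite [edge_letter i]l1|rewrite [edge_letter (i + 1)]l2].
  - have dv := W_det l1 l2; have n0 := size_edge_word.
    have md : (i %% n = j %% n)%Z by apply/eqP; rewrite eqz_mod_dvd.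
    move: h0; rewrite /line /wline md => /mulIg h; exists ((i %/ n)%Z - (j %/ n)%Z).
    by rewrite zpowD mulgA h zpowN mulgK.
set k := j + 2 * -1 in h2.
have ek1 : j + -1 = k + 1 by rewrite /k; lia.
have ek2 : j = k + 1 + 1 by rewrite /k; lia.
rewrite ek1 in h1; rewrite ek2 in h0; rewrite !line_step in h0 h1.
have l1 : line_letter t i = letter_inv (line_letter t' (k + 1)).
  apply: letter_val_inj; rewrite letter_val_inv; apply: (@mulgI _ (line t g0 i)).
  by rewrite h1 h0 mulgK.
have l2 : line_letter t (i + 1) = letter_inv (line_letter t' k).
  apply: letter_val_inj; rewrite letter_val_inv; apply: (@mulgI _ (line t g0 i * letter_val (line_letter t i))%g).
  by rewrite h2 h1 mulgK.
have h0' : line t g0 i = line t' g1 j by rewrite ek2 !line_step.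
case: t t' h0 h1 h2 l1 l2 h0' => -[] h0 h1 h2 l1 l2 h0'.
- exact: bb h0'.
- case: (@W_bb k).
    by move: (congr1 (@fst _ _) l2) => /= <-.
  by move: (congr1 (@fst _ _) l1) => /= <-.
- case: (@W_bb i).
    by move: (congr1 (@fst _ _) l1) => /= ->.
  by move: (congr1 (@fst _ _) l2) => /= ->.
- by case: (W_noinv l1).
Qed.

Lemma line_mul t g g0 j : line t (g * g0)%g j = (g * line t g0 j)%g.
Proof. by case: t; rewrite /line /bline /wline -!mulgA. Qed.

Lemma base_mul t g g0 k : base t (g * g0)%g k = (g * base t g0 k)%g.
Proof. by case: t; rewrite /base -!mulgA. Qed.

Lemma base_shift t g0 q k : base t (g0 * zpow edge_elt q)%g k = base t g0 (q + k).
Proof. by case: t; rewrite /base zpowD !mulgA. Qed.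

Lemma scale_gt0 t : 0 < scale t.
Proof. by case: t => //=; have := size_edge_word; rewrite /scale; lia. Qed.

Lemma line_shift t g0 q j : line t (g0 * zpow edge_elt q)%g j = line t g0 (scale t * q + j).
Proof.
have main (p : nat) i : line t (g0 * zpow edge_elt q)%g i = line t g0 (scale t * q + i) ->
    line t (g0 * zpow edge_elt q)%g (i + p%:Z) = line t g0 (scale t * q + (i + p%:Z)) /\
    line t (g0 * zpow edge_elt q)%g (i - p%:Z) = line t g0 (scale t * q + (i - p%:Z)).
  move=> h0; elim: p => [|p [IH1 IH2]].
    by have -> : i - 0%:Z = i by lia.
  split.
    rewrite (_ : i + p.+1%:Z = i + p%:Z + 1); last by lia.
    rewrite addrA !line_step IH1; congr (_ * letter_val _)%g.
    case: (t) => //=; rewrite /edge_letter /scale; congr (nth _ _ (absz _)).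
    by rewrite mulrC modzMDl.
  have e2 : i - p%:Z = i - p.+1%:Z + 1 by lia.
  have e3 : scale t * q + (i - p%:Z) = scale t * q + (i - p.+1%:Z) + 1 by lia.
  move: IH2; rewrite e3 e2 !line_step.
  have -> : line_letter t (scale t * q + (i - p.+1%:Z)) = line_letter t (i - p.+1%:Z).
    case: (t) => //=; rewrite /edge_letter /scale; congr (nth _ _ (absz _)).
    by rewrite mulrC modzMDl.
  exact: mulIg.
have h0 : line t (g0 * zpow edge_elt q)%g 0 = line t g0 (scale t * q + 0).
  have := line_scale t (g0 * zpow edge_elt q)%g 0; rewrite mulr0 => ->.
  by rewrite addr0 line_scale base_shift addr0.
have [e1|e1] : j = 0 + (absz j)%:Z \/ j = 0 - (absz j)%:Z by lia.
  by rewrite e1; have [] := main (absz j) 0 h0.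
by rewrite e1; have [] := main (absz j) 0 h0.
Qed.

Definition fiber_letters : seq G := [seq letter_val (a, s) | a <- enum {: option I}, s <- [:: true; false]].
Definition hnn_letters : seq G := [:: T; T^-1%g] ++ fiber_letters.

Lemma mem_fiber_letters l : letter_val l \in fiber_letters.
Proof.
case: l => a s; apply/allpairsP; exists (a, s); split; rewrite ?mem_enum //.
by case: s.
Qed.

Lemma fiber_lettersP x : x \in fiber_letters -> exists l, x = letter_val l.
Proof. by move=> /allpairsP[[a s] /= [_ _ ->]]; exists (a, s). Qed.

Lemma fiber_lettersV x : x \in fiber_letters -> x^-1%g \in fiber_letters.
Proof. by move=> /fiber_lettersP[l ->]; rewrite -letter_val_inv; exact: mem_fiber_letters. Qed.

Lemma sub_fiber_letters x : x \in fiber_letters -> x \in hnn_letters.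
Proof. by rewrite mem_cat => ->; rewrite orbT. Qed.

Lemma hnn_lettersP x : x \in hnn_letters -> [\/ x = T, x = T^-1%g | x \in fiber_letters].
Proof.
rewrite mem_cat !inE => /orP[/orP[/eqP->|/eqP->]|h].
- exact: Or31.
- exact: Or32.
- exact: Or33.
Qed.

Lemma hnn_lettersV x : x \in hnn_letters -> x^-1%g \in hnn_letters.
Proof.
move=> /hnn_lettersP[->|->|/fiber_lettersV/sub_fiber_letters//]; first by rewrite mem_cat !inE eqxx orbT.
by rewrite invgK mem_cat inE eqxx.
Qed.

Hypothesis genAll : forall g, exists k, g \in wball hnn_letters k.
Variables (A : wallAct G) (x0 : pt A) (R : nat).
Hypothesis connN : forall h, essential x0 h -> gconnected hnn_letters (thick x0 hnn_letters R h).

Local Notation N h := (thick x0 hnn_letters R h).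

Definition cut g0 (s : G -> bool) :=
  (forall g, s (g * T)%g = s g (+) `[< exists k, g = (g0 * zpow edge_elt k)%g >]) /\
  forall g a, s (g * letter a)%g = s g.

Lemma cut_fconn g0 s g h : cut g0 s -> fconn g h -> s g = s h.
Proof. by move=> [_ c]; elim=> [x z [a ->]|//|x z _ ->|x z t _ -> _ ->]. Qed.

Lemma cut_fiber_letters g0 s g x : cut g0 s -> x \in fiber_letters -> s (g * x)%g = s g.
Proof.
by move=> c /fiber_lettersP[l ->]; apply/esym/(cut_fconn c)/fadj_fconn/fadj_letter.
Qed.

Lemma cut_flip g0 s k : cut g0 s ->
  s (g0 * zpow edge_elt k * T)%g = ~~ s (g0 * zpow edge_elt k)%g.
Proof. by move=> [c _]; rewrite c asboolT ?addbT //; exists k. Qed.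

Lemma base_fconn t g0 k l : fconn (base t g0 k) (base t g0 l).
Proof. by rewrite -!line_scale; exact: line_conn. Qed.

Lemma cut_base g0 s t k l : cut g0 s -> s (base (~~ t) g0 l) = ~~ s (base t g0 k).
Proof.
move=> c; have -> : s (base (~~ t) g0 l) = s (base (~~ t) g0 k).
  by apply: cut_fconn c _; exact: base_fconn.
have := cut_flip k c; case: t => /=; last by move=> ->.
by move=> ->; rewrite negbK.
Qed.

(** The rungs of the strip with both ends in N(h). A connected N(h) reaching both sides of the edge
    must use one of them. *)
Definition crossings h g0 (k : int) := N h (base false g0 k) /\ N h (base true g0 k).

Lemma crossing_base t h g0 k : crossings h g0 k -> N h (base t g0 k).
Proof. by case: t => -[]. Qed.

Lemma crossingsG g h g0 k : crossings h g0 k -> crossings (gw g h) (g * g0)%g k.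
Proof. by move=> [h1 h2]; split; rewrite base_mul; exact: thick_gw. Qed.

Lemma crossings_shift h g0 q k : crossings h (g0 * zpow edge_elt q)%g k <-> crossings h g0 (q + k).
Proof. by rewrite /crossings !base_shift. Qed.

Lemma crossings_ex h g0 s x u : cut g0 s -> essential x0 h -> N h x -> N h u ->
  s x <> s u -> exists k, crossings h g0 k.
Proof.
move=> c eh Nx Nu sxu; apply: contrapT => no; apply: sxu.
apply: (within_ind_const (Q := fun v => s x = s v) _ (connN eh Nx Nu)) => // g z Ng Ngz zL.
move=> ->; have [ez|ez|zF] := hnn_lettersP zL; last by rewrite (cut_fiber_letters _ c).
  subst z; case: c => -> _; case: asboolP => [[k ek]|]; last by rewrite addbF.
  by case: no; exists k; split; rewrite /base -ek.
subst z; have eg : g = (g * T^-1 * T)%g by rewrite mulgVK.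
rewrite {1}eg; case: c => -> _; case: asboolP => [[k ek]|]; last by rewrite addbF.
by case: no; exists k; split; rewrite /base -ek // mulgVK.
Qed.

(* The edge of the Bass-Serre tree at the coset of x pointing towards u. *)
Lemma sep_exists x u : ~ fconn x u -> exists t g0, fconn x (base t g0 0) /\
  forall s, cut g0 s -> s x <> s u.
Proof.
move=> nxu; have [k] := genAll (u^-1 * x)%g; move eg : (u^-1 * x)%g => g gk.
have ex : x = (u * g)%g by rewrite -eg mulVKg.
pose incident g0 := exists t, fconn x (base t g0 0).
(* Invariant along a walk from u: either the coset of x has not been reached and all its incident
   edges see z on the side of u, or the required edge has been found. That edge is the one by which
   the coset is first entered. *)
pose C z := (~ fconn x z /\ forall g0 s, incident g0 -> cut g0 s -> s z = s u) \/
   exists t g0, fconn x (base t g0 0) /\ forall s, cut g0 s -> s x <> s u.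
have step z l : l \in hnn_letters -> C z -> C (z * l)%g.
  move=> lL [[nz hz]|]; last by right.
  have [fz|nfz] := pselect (fconn x (z * l)%g); last first.
    left; split=> // g0 s inc c; rewrite -(hz g0 s) //.
    have [el|el|lF] := hnn_lettersP lL; last by rewrite (cut_fiber_letters _ c).
      subst l; case: (c) => -> _; case: asboolP => [[j ej]|]; last by rewrite addbF.
      case: inc => t ht; case: t ht => ht.
        by case: nfz; rewrite ej; apply: fconn_trans ht (base_fconn true g0 0 j).
      by case: nz; rewrite ej; apply: fconn_trans ht (base_fconn false g0 0 j).
    subst l; rewrite -{2}(mulgVK T z); case: (c) => -> _.
    case: asboolP => [[j ej]|]; last by rewrite addbF.
    case: inc => t ht; case: t ht => ht.
      case: nz; rewrite -(mulgVK T z) ej; exact: fconn_trans ht (base_fconn true g0 0 j).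
    by case: nfz; rewrite ej; exact: fconn_trans ht (base_fconn false g0 0 j).
  right; have [el|el|lF] := hnn_lettersP lL; last first.
  - by case: nz; apply: fconn_trans fz _; have [l' ->] := fiber_lettersP lF;
      apply: fconn_sym; apply: fadj_fconn; exact: fadj_letter.
  - subst l; exists false, (z * T^-1)%g.
    have inc : fconn x (base false (z * T^-1)%g 0) by rewrite /base mulg1.
    split=> // s c; rewrite (cut_fconn c fz) -(hz _ s _ c); last by exists false.
    by have := cut_flip 0 c; rewrite zpow0 mulg1 mulgVK => ->; case: (s _).
  - subst l; exists true, z.
    have inc : fconn x (base true z 0) by rewrite /base mulg1.
    split=> // s c; rewrite (cut_fconn c fz) -(hz _ s _ c); last by exists true.
    by have := cut_flip 0 c; rewrite zpow0 mulg1 => ->; case: (s z).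
have Cu : C u by left.
have Cx : C x.
  rewrite ex; elim: k g gk {eg ex} => [|k IH] g; first by rewrite inE => /eqP->; rewrite mulg1.
  move=> /ballSP[/IH//|[h [l [/IH Ch lL ->]]]].
  by rewrite mulgA; exact: step.
by case: Cx => // -[[]]; exact: fconn_refl.
Qed.

Lemma unif_bound (B : eqType) (Q : B -> int -> Prop) (l : seq B) :
  (forall a x z, Q a x -> x <= z -> Q a z) ->
  (forall a, a \in l -> exists2 x, 0 <= x & Q a x) ->
  exists2 x, 0 <= x & forall a, a \in l -> Q a x.
Proof.
move=> mono; elim: l => [|a l IH] hl; first by exists 0.
have [x x_ge hx] := hl a (mem_head _ _).
have [|z z_ge hz] := IH; first by move=> c cl; apply: hl; rewrite inE cl orbT.
exists (x + z) => [|c]; first by lia.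
rewrite inE => /orP[/eqP->|/hz h]; first by apply: mono hx _; lia.
by apply: mono h _; lia.
Qed.

(** Up to translation there are finitely many walls. If a power of [edge_elt] fixes h, the rungs are
    periodic and a multiple of the period lies close to k; otherwise all rungs lie in a bounded
    range. *)
Lemma gap_bound : exists2 C : int, 0 <= C & forall h g0 k1 k2 k,
  crossings h g0 k1 -> crossings h g0 k2 -> k1 <= k -> k <= k2 ->
  exists2 s, crossings h g0 s & `|s - k| <= C.
Proof.
pose Q h (C : int) := forall k1 k2 k, crossings h 1%g k1 -> crossings h 1%g k2 ->
  k1 <= k -> k <= k2 -> exists2 s, crossings h 1%g s & `|s - k| <= C.
have [||C C0 hC] := @unif_bound _ Q (walls_at x0 hnn_letters R).
- move=> h C C' hC le k1 k2 k c1 c2 l1 l2.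
  by have [s cs hs] := hC k1 k2 k c1 c2 l1 l2; exists s => //; lia.
- move=> h _; have [[p p0 ep]|np] := pselect (periodic (zpow edge_elt) h).
    exists `|p| => // k1 k2 k c1 _ l1 _.
    have sh j : crossings h 1%g j -> crossings h 1%g (j + p).
      move=> cj; have := crossingsG (zpow edge_elt p) cj; rewrite ep mulg1 -[zpow edge_elt p]mul1g.
      by move=> /crossings_shift; rewrite addrC.
    have shN j : crossings h 1%g j -> crossings h 1%g (j - p).
      have epN : gw (zpow edge_elt (- p)) h = h by rewrite zpowN -{1}ep gwK.
      move=> cj; have := crossingsG (zpow edge_elt (- p)) cj; rewrite epN mulg1 -[zpow edge_elt (- p)]mul1g.
      by move=> /crossings_shift; rewrite addrC.
    have shn (c : nat) : crossings h 1%g (k1 + `|p| * c%:Z).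
      elim: c => [|c IH]; first by rewrite mulr0 addr0.
      have [ee|ee] : `|p| = p \/ `|p| = - p by lia.
        by have := sh _ IH; rewrite ee intS mulrDr mulr1 [p + _]addrC addrA.
      by have := shN _ IH; rewrite ee intS mulrDr mulr1 [- p + _]addrC addrA.
    have pn : `|p| != 0 by rewrite normr_eq0.
    have d0 : 0 <= ((k - k1) %/ `|p|)%Z by rewrite divz_ge0; lia.
    exists (k1 + `|p| * (absz ((k - k1) %/ `|p|)%Z)%:Z); first exact: shn.
    have := divz_eq (k - k1) `|p|; have := ltz_pmod (k - k1) (_ : 0 < `|p|).
    move=> /(_ _); have := modz_ge0 (k - k1) pn; rewrite gez0_abs // mulrC; lia.
  have [K K0 hK] := aperiodic_bound (zpowD edge_elt) (walls_at x0 hnn_letters R) np.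
  exists (K + K) => [|k1 k2 k c1 c2 l1 l2]; first by lia.
  have inK j : crossings h 1%g j -> - K < j < K.
    by move=> [Nj _]; apply: hK; rewrite zpowN; apply: thick_walls; rewrite -[zpow edge_elt j]mul1g.
  by exists k1 => //; have := inK _ c1; have := inK _ c2; lia.
exists C => // h g0 k1 k2 k c1 c2 l1 l2.
pose a := (g0 * zpow edge_elt k1)%g.
have tr j : crossings h g0 j <-> crossings (gw a^-1%g h) 1%g (j - k1).
  split=> cj.
    have := crossingsG a^-1%g cj; rewrite (_ : (a^-1 * g0 = 1 * zpow edge_elt (- k1))%g); last first.
      by rewrite /a invgM mulgVK mul1g zpowN.
    by move=> /crossings_shift; rewrite addrC.
  have := crossingsG a cj; rewrite gwVK mulg1 => /crossings_shift.
  by rewrite addrC subrK.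
have hw : gw a^-1%g h \in walls_at x0 hnn_letters R by apply: thick_walls; case: c1.
have [||||s cs hs] := hC _ hw (k1 - k1) (k2 - k1) (k - k1) _ _ _ _.
- exact/tr.
- exact/tr.
- lia.
- lia.
exists (s + k1); first by apply/tr; rewrite addrK.
lia.
Qed.

Local Notation fball := (wball fiber_letters).

(* Neighbourhoods inside the vertex spaces only. *)
Definition vthick (c : nat) h : set G := [set g | exists2 u, u \in fball c & N h (g * u)%g].

Lemma thick_vthick c h g : N h g -> vthick c h g.
Proof. by move=> Ng; exists 1%g; [exact: ball1|rewrite mulg1]. Qed.

Lemma vthick_leq c c' h g : (c <= c')%N -> vthick c h g -> vthick c' h g.
Proof. by move=> l [u uc Nu]; exists u => //; exact: ball_leq uc. Qed.

Lemma vthick_thick c h g : vthick c h g -> thick x0 hnn_letters (c + R) h g.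
Proof.
move=> [u uc [u' uR bu]]; exists (u * u')%g; last by rewrite mulgA.
apply: ballM uR => //; elim: c u uc {bu} => [|c IH] u //.
move=> /ballSP[/IH/ballS//|[z [l [/IH zc lF ->]]]].
by apply: ball_step => //; exact: sub_fiber_letters.
Qed.

Lemma line_fball t g0 i j : exists2 u, u \in fball (absz (j - i)%R) &
  line t g0 j = (line t g0 i * u)%g.
Proof.
have h (p : nat) k : exists2 u, u \in fball p & line t g0 (k + p%:Z) = (line t g0 k * u)%g.
  elim: p => [|p [u up eu]]; first by exists 1%g; rewrite ?addr0 ?mulg1 ?inE.
  exists (u * letter_val (line_letter t (k + p%:Z)))%g; first by apply: ball_step => //; exact: mem_fiber_letters.
  by rewrite (_ : k + p.+1%:Z = k + p%:Z + 1) ?line_step ?eu ?mulgA //; lia.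
have [le|le] := lerP i j.
  have [u up eu] := h (absz (j - i)%R) i; exists u => //.
  by rewrite -eu; congr (line _ _ _); lia.
have [u up eu] := h (absz (i - j)%R) j; exists u^-1%g.
  by rewrite (_ : absz (j - i)%R = absz (i - j)%R); [exact: (ballV fiber_lettersV up)|lia].
by rewrite (_ : line t g0 i = (line t g0 j * u)%g) ?mulgK // -eu; congr (line _ _ _); lia.
Qed.

Lemma tpath_mono (K K' : set G) a c : (forall g, K g -> K' g) ->
  tpath fadj K a c -> tpath fadj K' a c.
Proof.
move=> sub; elim=> [x z [Kx Kz xz]|x|x z t _ h1 _ h2].
- by apply: rt_step; split=> //; exact: sub.
- exact: rt_refl.
- exact: rt_trans h1 h2.
Qed.

Lemma tpath_sym (K : set G) a c : tpath fadj K a c -> tpath fadj K c a.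
Proof.
elim=> [x z [Kx Kz xz]|x|x z t _ h1 _ h2].
- by apply: rt_step; split=> //; exact: fadj_sym.
- exact: rt_refl.
- exact: rt_trans h2 h1.
Qed.

Lemma tpath_conn (K : set G) a c : tpath fadj K a c -> fconn a c.
Proof.
elim=> [x z [_ _ xz]|x|x z t _ h1 _ h2]; first exact: fadj_fconn.
- exact: fconn_refl.
- exact: fconn_trans h1 h2.
Qed.

Lemma tpath_line (K : set G) t g0 i j : (forall k, i <= k <= j -> K (line t g0 k)) ->
  i <= j -> tpath fadj K (line t g0 i) (line t g0 j).
Proof.
move=> inK ij; have [p ej] : exists p : nat, j = i + p%:Z by exists (absz (j - i)%R); lia.
subst j; elim: p inK ij => [|p IH] inK ij; first by rewrite addr0; exact: rt_refl.
have ep : i + p.+1%:Z = i + p%:Z + 1 by lia.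
apply: rt_trans (IH _ _) _; [by move=> k hk; apply: inK; lia|by lia|].
apply: rt_step; split; [apply: inK; lia|apply: inK; lia|].
by rewrite ep line_step; exact: fadj_letter.
Qed.

(* Excursions of a wall neighbourhood out of a vertex space return through the
   edge by which they left, so that bounded gaps along the edge lines suffice. *)
Lemma vthick_connected0 : exists c0, forall h, essential x0 h ->
  forall a z, N h a -> N h z -> fconn a z -> tpath fadj (vthick c0 h) a z.
Proof.
have [C C0 gap] := gap_bound.
(* A point of the segment is less than one scale unit past a rung position, which has a rung of h
   within C; a unit has length at most n. *)
pose c0 := absz (n%:Z * (C + 1))%R; exists c0 => h eh a z Na Nz.
have scn t : scale t <= n%:Z by case: t => //=; rewrite /scale; have := size_edge_word; lia.
have seg t g0 k1 k2 : crossings h g0 k1 -> crossings h g0 k2 ->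
    tpath fadj (vthick c0 h) (base t g0 k1) (base t g0 k2).
  wlog le : k1 k2 / k1 <= k2.
    move=> H c1 c2; have [le|le] := lerP k1 k2; first exact: H.
    by apply: tpath_sym; apply: H => //; lia.
  move=> c1 c2; rewrite -!line_scale; have s0 := scale_gt0 t.
  apply: tpath_line => [j /andP[j1 j2]|]; last by rewrite ler_pM2l.
  pose k := (j %/ scale t)%Z.
  have dv := divz_eq j (scale t); have mg := @modz_ge0 j (scale t) (lt0r_neq0 s0).
  have ml := ltz_pmod j s0.
  have k1k : k1 <= k by rewrite /k lez_divRL // mulrC.
  have kk2 : k <= k2 by rewrite -(ler_pM2l s0); move: j2; rewrite {1}dv -/k; lia.
  have [s cs hs] := gap h g0 k1 k2 k c1 c2 k1k kk2.
  have [u uc eu] := line_fball t g0 j (scale t * s).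
  exists u; last by rewrite -eu line_scale; exact: crossing_base.
  apply: ball_leq uc; rewrite /c0.
  have st := scn t.
  have b1 : `|scale t * (s - k)| <= n%:Z * C.
    by rewrite normrM ler_pM ?normr_ge0 // gtr0_norm.
  have b2 : `|scale t * s - j| <= n%:Z * (C + 1).
    rewrite mulrDr mulr1 {1}dv -/k.
    have -> : scale t * s - (k * scale t + (j %% scale t)%Z) =
      scale t * (s - k) - (j %% scale t)%Z by lia.
    by lia.
  by lia.
(* Invariant along a walk in N(h) from a: inside the coset the path exists; outside it, the edge of
   departure is remembered with a rung already joined to a. *)
pose Q v := (fconn a v -> tpath fadj (vthick c0 h) a v) /\
  (~ fconn a v -> exists t g0 k, [/\ fconn a (base t g0 0), crossings h g0 k,
      forall s, cut g0 s -> s v <> s a & tpath fadj (vthick c0 h) a (base t g0 k)]).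
suff [] : Q z by [].
apply: (within_ind_const (Q := Q) _ (connN eh Na Nz)); last first.
  by split=> [_|[]]; [exact: rt_refl|exact: fconn_refl].
move=> v l Nv Nvl lL [Q1 Q2].
have [lF|lT] := boolP (l \in fiber_letters).
  have vl : fconn v (v * l)%g by have [l' ->] := fiber_lettersP lF; apply: fadj_fconn; exact: fadj_letter.
  split=> [av|nav].
    apply: rt_trans (Q1 _) _; first by apply: fconn_trans av (fconn_sym vl).
    apply: rt_step; split; [exact: thick_vthick|exact: thick_vthick|].
    by have [l' ->] := fiber_lettersP lF; exact: fadj_letter.
  have [|t [g0 [k [h1 h2 h3 h4]]]] := Q2.
    by move=> av; apply: nav; exact: fconn_trans av vl.
  by exists t, g0, k; split=> // s c; rewrite (cut_fiber_letters _ c lF); exact: h3.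
have [t [g1 [ev1 evl c1]]] : exists t g1, [/\ v = base t g1 0, (v * l)%g = base (~~ t) g1 0 &
    crossings h g1 0].
  have [el|el|lF] := hnn_lettersP lL; last by rewrite lF in lT.
    by subst l; exists false, v; split; rewrite /crossings /base /= ?mulg1.
  subst l; exists true, (v * T^-1)%g.
  by split; rewrite /crossings /base /= ?mulg1 ?mulgVK.
have [av|nav] := pselect (fconn a v).
  have nvl : ~ fconn a (v * l)%g.
    move=> avl; have [s c] := edge_cut g1.
    have := cut_base t 0 0 c; rewrite -ev1 -evl (cut_fconn c (fconn_trans (fconn_sym avl) av)).
    by case: (s v).
  split=> // _; exists t, g1, 0; split=> //.
  - by rewrite -ev1.
  - move=> s c; rewrite (cut_fconn c av) evl (cut_base t 0 0 c) -ev1.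
    by case: (s v).
  - by rewrite -ev1; exact: Q1.
have [t2 [g2 [k [h1 h2 h3 h4]]]] := Q2 nav.
have [s c] := edge_cut g2.
split=> [avl|navl].
  have sv : s v <> s (v * l)%g by rewrite -(cut_fconn c avl); exact: h3.
  have [k' ek'] : exists k', g1 = (g2 * zpow edge_elt k')%g.
    apply: contrapT => no; apply: sv.
    have no' : forall k', g1 <> (g2 * zpow edge_elt k')%g by move=> k' ee; apply: no; exists k'.
    rewrite evl ev1; case: (c) => cT _.
    case: (t) => /=; rewrite /base mulg1 cT asboolF ?addbF //; by move=> [k' /no'].
  have c2 : crossings h g2 k'.
    by move: c1; rewrite ek' => /crossings_shift; rewrite addr0.
  have et : ~~ t = t2.
    apply/eqP; apply: contraT => ne; have ett : t = t2.
      by move: ne; case: (t); case: (t2).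
    case: nav; apply: fconn_trans h1 _; rewrite ev1 ek' base_shift ett.
    exact: base_fconn.
  rewrite evl ek' base_shift addr0 et.
  by apply: rt_trans h4 _; exact: seg.
exists t2, g2, k; split=> // s' c'; suff -> : s' (v * l)%g = s' v by exact: h3.
rewrite evl ev1; case: (c') => cT _.
have no : forall k', g1 <> (g2 * zpow edge_elt k')%g.
  move=> k' ek'; have [ett|ett] : t = t2 \/ ~~ t = t2 by case: (t); case: (t2); [left|right|right|left].
    case: nav; apply: fconn_trans h1 _; rewrite ev1 ek' base_shift ett; exact: base_fconn.
  case: navl; apply: fconn_trans h1 _; rewrite evl ek' base_shift ett; exact: base_fconn.
by case: (t) => /=; rewrite /base mulg1 cT asboolF ?addbF //; move=> [k' /no].
Qed.

Lemma vthick_connected c0 h c v : (forall a z, N h a -> N h z -> fconn a z ->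
    tpath fadj (vthick c0 h) a z) -> (c0 <= c)%N ->
  tconnected fadj (vthick c h `&` fconn v).
Proof.
move=> con lc.
have up a z : fconn v a -> tpath fadj (vthick c h) a z -> tpath fadj (vthick c h `&` fconn v) a z.
  move=> va pa; elim: pa va => [x t [Kx Kt xt]|x|x t u h1 IH1 h2 IH2] va.
  - apply: rt_step; split=> //; split=> //; apply: fconn_trans va _; exact: fadj_fconn.
  - exact: rt_refl.
  - by apply: rt_trans (IH1 va) (IH2 _); apply: fconn_trans va (tpath_conn h1).
have near a : vthick c h a -> exists2 z, N h z & tpath fadj (vthick c h) a z.
  move=> [u uc Nu]; exists (a * u)%g => //; apply: tpath_sym.
  rewrite -{2}[a](mulgK u).
  have : joined_in fiber_letters (vthick c h) (a * u)%g (a * u * u^-1)%g.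
    apply: within_path (ballV fiber_lettersV uc) => x xc; exists x^-1%g; first exact: (ballV fiber_lettersV xc).
    by rewrite mulgK.
  elim=> [x z [Kx Kz [l lF ez]]|x|x z t _ h1 _ h2].
  - subst z; apply: rt_step; split=> //.
    by have [l' ->] := fiber_lettersP lF; exact: fadj_letter.
  - exact: rt_refl.
  - exact: rt_trans h1 h2.
move=> a z [Ka va] [Kz vz]; apply: up => //.
have [a' Na pa] := near a Ka; have [z' Nz pz] := near z Kz.
have az' : fconn a' z'.
  apply: fconn_trans (fconn_sym (tpath_conn pa)) _.
  by apply: fconn_trans (fconn_sym va) _; apply: fconn_trans vz (tpath_conn pz).
apply: rt_trans pa _; apply: rt_trans _ (tpath_sym pz).
by apply: tpath_mono (con a' z' Na Nz az') => g; exact: vthick_leq.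
Qed.

(** Moving the point of the line to 1 leaves finitely many data: the side, a wall near 1 and the
    position modulo the scale. The bound is a maximum over these. *)
Lemma line_bound c0 : exists2 B : int, 0 <= B & forall t h g0 j,
  vthick c0 h (line t g0 j) -> (exists k, crossings h g0 k) ->
  exists2 k, crossings h g0 k & `|j - scale t * k| <= B.
Proof.
pose Q (p : bool * wl A * nat) (B : int) := let: (t, h, i) := p in
  (exists k, crossings h (line t 1%g i%:Z)^-1%g k) ->
  exists2 k, crossings h (line t 1%g i%:Z)^-1%g k & `|i%:Z - scale t * k| <= B.
have [||B B0 hB] := @unif_bound _ Q [seq (th, i) | th <- [seq (t, h) | t <- [:: true; false],
    h <- walls_at x0 hnn_letters (c0 + R)], i <- iota 0 n.+1].
- move=> [[t h] i] B B' hB le ex; have [k ck hk] := hB ex; exists k => //; lia.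
- move=> [[t h] i] _; have [[k ck]|no] := pselect (exists k, crossings h (line t 1%g i%:Z)^-1%g k).
    by exists `|i%:Z - scale t * k| => // _; exists k.
  by exists 0.
exists B => // t h g0 j hx [k0 ck0].
have s0 := scale_gt0 t.
pose q := (j %/ scale t)%Z; pose i := absz (j %% scale t)%Z.
have dv := divz_eq j (scale t); have mg := @modz_ge0 j (scale t) (lt0r_neq0 s0).
have ml := ltz_pmod j s0.
have ei : (j %% scale t)%Z = i%:Z by rewrite /i; lia.
pose x := line t g0 j; pose h' := gw x^-1%g h.
have eg : (x^-1 * (g0 * zpow edge_elt q))%g = (line t 1%g i%:Z)^-1%g.
  apply: (@mulIg _ (line t 1%g i%:Z)); rewrite mulVg -mulgA -line_mul mulg1 line_shift.
  by rewrite -ei mulrC -dv mulVg.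
have tr k : crossings h' (line t 1%g i%:Z)^-1%g k <-> crossings h g0 (q + k).
  rewrite -eg /h'; split=> ck; last by apply: crossingsG; exact/crossings_shift.
  by have := crossingsG x ck; rewrite gwVK mulVKg => /crossings_shift.
have hin : ((t, h'), i) \in [seq (th, i) | th <- [seq (t, h) | t <- [:: true; false],
    h <- walls_at x0 hnn_letters (c0 + R)], i <- iota 0 n.+1].
  apply/allpairsP; exists ((t, h'), i); split=> //.
    apply/allpairsP; exists (t, h'); split=> //; first by case: (t).
    by apply: thick_walls; exact: vthick_thick.
  have : scale t <= n%:Z by case: (t) => //=; rewrite /scale; have := size_edge_word; lia.
  by rewrite /snd mem_iota; lia.
have [|k ck hk] := hB _ hin.
  by exists (k0 - q); apply/tr; rewrite addrC subrK.
exists (q + k); first exact/tr.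
by rewrite mulrDr {1}dv ei; move: hk; rewrite -/q; lia.
Qed.

Lemma line_cross t g0 (s : G -> bool) i j : s (line t g0 i) <> s (line t g0 j) ->
  exists k, s (line t g0 k) <> s (line t g0 (k + 1)).
Proof.
wlog le : i j / i <= j.
  by move=> H ne; have [le|le] := lerP i j; [exact: H ne|apply: (H j i); [lia|exact: nesym]].
have [p ->] : exists p : nat, j = i + p%:Z by exists (absz (j - i)%R); lia.
move=> ne; apply: contrapT => no; apply: ne.
have st k : s (line t g0 k) = s (line t g0 (k + 1)).
  by apply: contrapT => ne; apply: no; exists k.
elim: p => [|p ->]; first by rewrite addr0.
by rewrite st; congr (s (line _ _ _)); lia.
Qed.

Lemma hnn_line_inj t g0 i j : line t g0 i = line t g0 j -> i = j.
Proof.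
move=> h; have lr := line_reduced t g0.
have [/(line_inj vertex_forest lr)//|/(line_inj vertex_forest lr)/nesym//|//] := ltgtP i j.
Qed.

(** * Two walls that meet also meet in each vertex space they share *)

Section FarSide.
Variables (c0 : nat) (B : int).
Hypothesis B0 : 0 <= B.
Hypothesis con0 : forall h, essential x0 h -> forall a z, N h a -> N h z -> fconn a z ->
  tpath fadj (vthick c0 h) a z.
Hypothesis bnd : forall t h g0 j, vthick c0 h (line t g0 j) -> (exists k, crossings h g0 k) ->
  exists2 k, crossings h g0 k & `|j - scale t * k| <= B.

(* If two walls cross the strip over an edge far apart, the segment of the edge
   line between them separates them in the next vertex space, and contains two
   consecutive edges; no other edge line contains these, so the walls do not
   both go further, hence do not meet. *)
Lemma far_side h1 h2 t g0 k1 k2 p : essential x0 h1 -> essential x0 h2 ->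
  crossings h1 g0 k1 -> crossings h2 g0 k2 -> k1 + (2 * B + 2) <= k2 ->
  (forall s, crossings h1 g0 s -> s <= k1) -> (forall s, crossings h2 g0 s -> k2 <= s) ->
  N h1 p -> N h2 p -> ~ (forall s, cut g0 s -> s (base t g0 0) = s p).
Proof.
move=> e1' e2' ck1 ck2 far max1 min2 Np1 Np2 same.
pose v := base t g0 0; pose l := line t g0.
pose X1 : set G := (vthick c0 h1 `&` fconn v)%classic; pose X2 : set G := (vthick c0 h2 `&` fconn v)%classic.
have cX1 : tconnected fadj X1 by apply: vthick_connected (con0 e1') _.
have cX2 : tconnected fadj X2 by apply: vthick_connected (con0 e2') _.
have s0 := scale_gt0 t.
have vl i : fconn v (l i).
  by have -> : v = l (scale t * 0) by [rewrite /v -line_scale]; exact: line_conn.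
(* Positions of X1 on the line are at most j and those of X2 at least j + 2, each being within B of
   a rung; hence the gap 2 * B + 2. The two edges from j to j + 2 separate X1 from X2. *)
pose j := scale t * k1 + B.
have pos1 i : X1 (l i) -> i <= j.
  move=> [X1i _]; have [|s cs hs] := bnd X1i; first by exists k1.
  have := max1 _ cs; rewrite -(ler_pM2l s0) /j; lia.
have pos2 i : X2 (l i) -> j + 2 <= i.
  move=> [X2i _]; have [|s cs hs] := bnd X2i; first by exists k2.
  have h3 := min2 _ cs; have : scale t * (k1 + (2 * B + 2)) <= scale t * s.
    by rewrite ler_pM2l //; lia.
  have : 2 * B + 2 <= scale t * (2 * B + 2) by rewrite ler_peMl //; lia.
  by rewrite mulrDr /j; lia.
have in1 : X1 (l (scale t * k1)).
  by split; [apply: thick_vthick; rewrite /l line_scale; exact: crossing_base|exact: vl].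
have in2 : X2 (l (scale t * k2)).
  by split; [apply: thick_vthick; rewrite /l line_scale; exact: crossing_base|exact: vl].
have lr := line_reduced t g0.
have [sA [cA A1 A2]] := line_cut vertex_forest lr j.
have [sB [cB B1 B2]] := line_cut vertex_forest lr (j + 1).
have e12 : j + 1 + 1 = j + 2 by lia.
have conA1 x : X1 x -> sA x = sA (l j).
  move=> X1x; rewrite -(A1 (scale t * k1)); last by rewrite /j; lia.
  apply: contrapT => ne; have [_ /pos1] := cut_connected cA cX1 X1x in1 ne; lia.
have conB1 x : X1 x -> sB x = sB (l (j + 1)).
  move=> X1x; rewrite -(B1 (scale t * k1)); last by rewrite /j; lia.
  apply: contrapT => ne; have [/pos1] := cut_connected cB cX1 X1x in1 ne; lia.
have far2 := pos2 _ in2.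
have conA2 x : X2 x -> sA x = sA (l (j + 1)).
  move=> X2x; rewrite -(A2 (scale t * k2)); last by lia.
  apply: contrapT => ne; have [/pos2] := cut_connected cA cX2 X2x in2 ne; lia.
have conB2 x : X2 x -> sB x = sB (l (j + 2)).
  move=> X2x; rewrite -e12 -(B2 (scale t * k2)); last by lia.
  apply: contrapT => ne; have [/pos2] := cut_connected cB cX2 X2x in2 ne; lia.
have nA : sA (l j) <> sA (l (j + 1)) by case: cA.
have nB : sB (l (j + 1)) <> sB (l (j + 2)) by rewrite -e12; case: cB.
have [vp|nvp] := pselect (fconn v p).
  have X1p : X1 p by split=> //; exact: thick_vthick.
  have X2p : X2 p by split=> //; exact: thick_vthick.
  by apply: nA; rewrite -(conA1 p) // (conA2 p).
(* The next edge towards p is not g0, because the cuts of g0 leave p on the side of v. Both walls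
   cross its strip, so its line meets X1 and X2 and has to contain both separating edges, which
   [line_det] forbids. *)
have [t2 [g2 [vb sep2]]] := sep_exists nvp.
have ng2 : ~ exists k, g2 = (g0 * zpow edge_elt k)%g.
  move=> [k ek]; have [s c] := edge_cut g0.
  have c' : cut g2 s.
    case: c => cT cl; split=> // g; rewrite cT; congr (_ (+) _).
    apply/asboolP/asboolP => -[k' ->]; rewrite ek.
      by exists (k' - k); rewrite -mulgA -zpowD addrC subrK.
    by exists (k + k'); rewrite -mulgA -zpowD.
  by apply: (sep2 s c'); exact: same.
have [s c] := edge_cut g2; have svp := sep2 s c.
have cr h k : essential x0 h -> crossings h g0 k -> N h p -> exists k', crossings h g2 k'.
  move=> eh ck Np; apply: (crossings_ex c eh (crossing_base t ck) Np).
  by rewrite -(cut_fconn c (base_fconn t g0 0 k)).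
have [a ca] := cr _ _ e1' ck1 Np1; have [d cd] := cr _ _ e2' ck2 Np2.
pose l2 := line t2 g2.
have vl2 i : fconn v (l2 i).
  by apply: fconn_trans vb _; rewrite -line_scale; exact: line_conn.
have in1' : X1 (l2 (scale t2 * a)).
  by split; [apply: thick_vthick; rewrite /l2 line_scale; exact: crossing_base|exact: vl2].
have in2' : X2 (l2 (scale t2 * d)).
  by split; [apply: thick_vthick; rewrite /l2 line_scale; exact: crossing_base|exact: vl2].
have adj2 i : fadj (l2 i) (l2 (i + 1)) by have [] := line_reduced t2 g2 i.
have [i1 hi1] : exists i, sA (l2 i) <> sA (l2 (i + 1)).
  by apply: (@line_cross _ _ _ (scale t2 * a) (scale t2 * d)); rewrite (conA1 _ in1') (conA2 _ in2').
have [i2 hi2] : exists i, sB (l2 i) <> sB (l2 (i + 1)).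
  by apply: (@line_cross _ _ _ (scale t2 * a) (scale t2 * d)); rewrite (conB1 _ in1') (conB2 _ in2').
have [d1 [m1 [hd1 y1 p1]]] : exists d1 m1 : int, [/\ d1 = 1 \/ d1 = -1, l2 m1 = l (j + 1) & l2 (m1 + d1) = l j].
  have [[q1 q2]|[q1 q2]] := (cA.2 _ _ (adj2 i1) hi1).
    by exists (-1), (i1 + 1); split; [right|exact: q2|rewrite addrK].
  by exists 1, i1; split; [left|exact: q1|exact: q2].
have [d2 [m2 [hd2 y2 p2]]] : exists d2 m2 : int, [/\ d2 = 1 \/ d2 = -1, l2 m2 = l (j + 1) & l2 (m2 + d2) = l (j + 2)].
  have [[q1 q2]|[q1 q2]] := (cB.2 _ _ (adj2 i2) hi2); rewrite e12 in q1 q2 *.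
    by exists 1, i2; split; [left|exact: q1|exact: q2].
  by exists (-1), (i2 + 1); split; [right|exact: q2|rewrite addrK].
have em : m1 = m2 by apply: (@hnn_line_inj t2 g2); rewrite -/l2 y1 y2.
subst m2.
have nd : d1 <> d2.
  by move=> ed; have [_] := lr j; rewrite -/l; apply; rewrite -p1 -p2 ed.
have ed : d2 = - d1 by lia.
apply: ng2; apply: (@line_det t t2 g0 g2 j (m1 + d1) d2); first exact: hd2.
- by rewrite -/l -/l2 p1.
- by rewrite -/l -/l2 -y1; congr (l2 _); lia.
- by rewrite -/l -/l2 -p2; congr (l2 _); lia.
Qed.

(** Rungs at most 2 * B + 2 apart are joined along the line within n * (2 * B + 2). So two walls
    that cross one strip without meeting at this thickness have rungs as far apart as [far_side]
    demands. *)
Definition rho0 := (c0 + absz (n%:Z * (2 * B + 2))%R)%N.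

(** Otherwise p lies beyond some edge at the coset of x1, both walls cross its strip with rungs far
    apart, and [far_side] on the other side of the strip denies that they meet at p. *)
Lemma meet_vertex h1 h2 p x1 x2 : essential x0 h1 -> essential x0 h2 ->
  N h1 p -> N h2 p -> N h1 x1 -> N h2 x2 -> fconn x1 x2 ->
  exists z, [/\ fconn x1 z, vthick rho0 h1 z & vthick rho0 h2 z].
Proof.
move=> e1' e2' Np1 Np2 Nx1 Nx2 x12; apply: contrapT => no.
have noz z : fconn x1 z -> vthick rho0 h1 z -> vthick rho0 h2 z -> False.
  by move=> z1 z2 z3; apply: no; exists z.
have lec : (c0 <= rho0)%N by rewrite leq_addr.
have [xp|nxp] := pselect (fconn x1 p).
  by apply: (noz p) => //; exact: thick_vthick.
have [t [g0 [xb sep0]]] := sep_exists nxp; have [s c] := edge_cut g0.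
have [k01 ck01] := crossings_ex c e1' Nx1 Np1 (sep0 s c).
have [k02 ck02] : exists k, crossings h2 g0 k.
  apply: (crossings_ex c e2' Nx2 Np2); rewrite -(cut_fconn c x12); exact: sep0.
have xbk k : fconn x1 (base t g0 k) by apply: fconn_trans xb _; exact: base_fconn.
have far k1 k2 : crossings h1 g0 k1 -> crossings h2 g0 k2 -> 2 * B + 2 < `|k1 - k2|.
  move=> ck1 ck2; rewrite ltNge; apply/negP => le; apply: (noz (base t g0 k1)) => //.
    by apply: thick_vthick; exact: crossing_base.
  have [u uc eu] := line_fball t g0 (scale t * k1) (scale t * k2).
  rewrite -line_scale; exists u; last by rewrite -eu line_scale; exact: crossing_base.
  apply: ball_leq uc; rewrite /rho0.
  have scn : scale t <= n%:Z by case: (t) => //=; rewrite /scale; have := size_edge_word; lia.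
  have b1 : `|scale t * (k2 - k1)| <= n%:Z * (2 * B + 2).
    rewrite normrM gtr0_norm ?scale_gt0 //; apply: ler_pM => //.
      exact: ltW (scale_gt0 t).
    by rewrite distrC.
  by rewrite mulrBr in b1; lia.
have seg h h' k1 k2 k1' : essential x0 h -> essential x0 h' ->
    (forall z, fconn x1 z -> vthick rho0 h z -> vthick rho0 h' z -> False) ->
    crossings h g0 k1 -> crossings h' g0 k2 -> crossings h g0 k1' -> k1 <= k2 -> k2 <= k1' -> False.
  move=> eh eh' nz ck1 ck2 ck1' l1 l2; apply: (nz (base t g0 k2)) => //; last first.
    by apply: thick_vthick; exact: crossing_base.
  have cX : tconnected fadj (vthick c0 h `&` fconn x1)%classic by apply: vthick_connected (con0 eh) _.
  have s0 := scale_gt0 t.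
  have [|||] := line_segment vertex_forest (i := scale t * k1) (j := scale t * k1')
     (m := scale t * k2) (line_reduced t g0) cX.
  - by rewrite line_scale; split; [apply: thick_vthick; exact: crossing_base|exact: xbk].
  - by rewrite line_scale; split; [apply: thick_vthick; exact: crossing_base|exact: xbk].
  - by rewrite !ler_pM2l // l1 l2.
  by rewrite line_scale => hk _; exact: vthick_leq hk.
have side : forall s', cut g0 s' -> s' (base (~~ t) g0 0) = s' p.
  move=> s' c'; rewrite (cut_base t 0 0 c') -(cut_fconn c' xb).
  by have := sep0 s' c'; case: (s' x1); case: (s' p).
(* Rungs of the two walls at minimal distance. A rung beyond them on the inner side would give a
   closer pair, or else enclose a rung of the other wall between two of its own, which [seg]
   excludes. *)
pose P k := `[< exists k1 k2, [/\ crossings h1 g0 k1, crossings h2 g0 k2 & absz (k1 - k2)%R = k] >].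
have exP : exists k, P k.
  by exists (absz (k01 - k02)%R); apply/asboolP; exists k01, k02.
have [k /asboolP[k1 [k2 [ck1 ck2 ek]]] mink] := ex_minnP exP.
have min k1' k2' : crossings h1 g0 k1' -> crossings h2 g0 k2' -> `|k1 - k2| <= `|k1' - k2'|.
  move=> c1 c2; have : P (absz (k1' - k2')%R) by apply/asboolP; exists k1', k2'.
  by move=> /mink; rewrite -ek; lia.
have far12 := far _ _ ck1 ck2.
have [lt12|gt12|eq12] := ltgtP k1 k2; last by rewrite eq12 subrr normr0 in far12; lia.
  apply: (far_side (t := ~~ t) e1' e2' ck1 ck2 _ _ _ Np1 Np2 side); first by lia.
    move=> s' cs'; rewrite leNgt; apply/negP => letter'.
    have [l2|l2] := lerP k2 s'.
      by apply: (seg h1 h2 k1 k2 s') => //; lia.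
    by have := min _ _ cs' ck2; lia.
  move=> s' cs'; rewrite leNgt; apply/negP => letter'.
  have [l2|l2] := lerP s' k1.
    by apply: (seg h2 h1 s' k1 k2) => //; [move=> z z1 z2 z3; exact: noz z3 z2|lia].
  by have := min _ _ ck1 cs'; lia.
apply: (far_side (t := ~~ t) e2' e1' ck2 ck1 _ _ _ Np2 Np1 side); first by lia.
  move=> s' cs'; rewrite leNgt; apply/negP => letter'.
  have [l2|l2] := lerP k1 s'.
    by apply: (seg h2 h1 k2 k1 s') => //; [move=> z z1 z2 z3; exact: noz z3 z2|lia].
  by have := min _ _ ck1 cs'; lia.
move=> s' cs'; rewrite leNgt; apply/negP => letter'.
have [l2|l2] := lerP s' k2.
  by apply: (seg h1 h2 s' k2 k1) => //; lia.
by have := min _ _ cs' ck2; lia.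
Qed.

End FarSide.

Definition coset g : set G := [set h | fconn g h]%classic.

Lemma coset_eq g h : fconn g h -> coset g = coset h.
Proof.
move=> gh; apply/seteqP; split=> x hx; first exact: fconn_trans (fconn_sym gh) hx.
exact: fconn_trans gh hx.
Qed.

Definition cadj (v v' : set G) := exists g,
  (v = coset g /\ v' = coset (g * T)%g) \/ (v = coset (g * T)%g /\ v' = coset g).

Lemma coset_forest : forest cadj.
Proof.
move=> v v' [g0 hg]; have [s c] := edge_cut g0.
pose s' (V : set G) := `[< exists h, V h /\ s h >].
have s'E g : s' (coset g) = s g.
  apply/asboolP/idP => [[h [gh sh]]|sg]; first by rewrite (cut_fconn c gh).
  by exists g; split=> //; exact: fconn_refl.
have main g : s g <> s (g * T)%g -> coset g = coset g0 /\ coset (g * T)%g = coset (g0 * T)%g.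
  case: (c) => -> _; case: asboolP => [[k ek] _|]; last by rewrite addbF.
  split; apply: coset_eq; apply: fconn_sym.
    by have := base_fconn false g0 0 k; rewrite /base mulg1 -ek.
  by have := base_fconn true g0 0 k; rewrite /base mulg1 -ek.
exists s'; split.
  have fl : s (g0 * T)%g = ~~ s g0 by have := cut_flip 0 c; rewrite mulg1.
  by case: hg => -[-> ->]; rewrite !s'E fl; case: (s g0).
move=> V V' [g [[eV eV']|[eV eV']]]; rewrite eV eV' !s'E => ne.
  have [-> ->] := main g ne.
  by case: hg => -[-> ->]; [left|right].
have [-> ->] := main g (nesym ne).
by case: hg => -[-> ->]; [right|left].
Qed.

Lemma fin_crossing_hnn : exists W0, fin_crossing x0 W0.
Proof.
have [c0 con0] := vthick_connected0; have [B B0 bnd] := line_bound c0.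
pose q := rho0 c0 B.
have genL := genAll.
exists (walls_at x0 hnn_letters (q + R)); apply: fin_of_common => -[|h0 F] eF cF; first by exists 1%g.
have meet h k : h \in h0 :: F -> k \in h0 :: F -> exists p, N h p /\ N k p.
  move=> hF kF; have [->|ne] := pselect (h = k).
    by have [a /(bd_thick R)] := essential_bd genL (eF _ kF); exists a; split.
  exact: (cross_meet genL (connN (eF _ hF)) (connN (eF _ kF)) (cF _ _ hF kF ne)).
pose K h : set (set G) := [set V : set G | exists2 g, N h g & V = coset g]%classic.
have [||V hV] := @helly _ cadj coset_forest _ K F h0.
- move=> h hF _ _ [a Na ->] [z Nz ->].
  elim: (connN (eF _ hF) Na Nz) => [x x' [Nx Nx' [l lL ex]]|x|x x' x'' _ h1 _ h2].
  + have [el|el|lF] := hnn_lettersP lL; subst x'.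
    * by apply: rt_step; split; [exists x|exists (x * l)%g|exists x; left; rewrite el].
    * apply: rt_step; split; [by exists x|by exists (x * l)%g|].
      by exists (x * l)%g; right; rewrite el mulgVK.
    * rewrite (_ : coset (x * l)%g = coset x); first exact: rt_refl.
      by apply: coset_eq; apply: fconn_sym; have [l' ->] := fiber_lettersP lF; apply: fadj_fconn; exact: fadj_letter.
  + exact: rt_refl.
  + exact: rt_trans h1 h2.
- move=> h k hF kF; have [p [p1 p2]] := meet h k hF kF.
  by exists (coset p); split; exists p.
have [v Nv eV] := hV h0 (mem_head _ _).
have hv h : h \in h0 :: F -> exists2 g, N h g & fconn v g.
  move=> /hV[g Ng eg]; exists g => //.
  have : coset g g by exact: fconn_refl.
  by rewrite -eg eV.
pose K' h : set G := (vthick q h `&` fconn v)%classic.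
have [||z hz] := @helly _ fadj vertex_forest _ K' F h0.
- move=> h hF; apply: vthick_connected (con0 h (eF _ hF)) _; exact: leq_addr.
- move=> h k hF kF; have [p [p1 p2]] := meet h k hF kF.
  have [g Ng vg] := hv h hF; have [g' Ng' vg'] := hv k kF.
  have [|z [z1 z2 z3]] := meet_vertex B0 con0 bnd (eF _ hF) (eF _ kF) p1 p2 Ng Ng'.
    exact: fconn_trans (fconn_sym vg) vg'.
  by exists z; split; split=> //; apply: fconn_trans vg z1.
by exists z => h hF; have [hz' _] := hz h hF; exact: vthick_thick.
Qed.

End Hnn.

End HnnExtensions.

(** * Surface groups *)

Section RelatorWords.
Import Order.TTheory GRing.Theory Num.Theory.
Local Open Scope ring_scope.

Definition word_linear (G : groupType) (A : wallAct G) (x0 : pt A) :=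
  exists (D : seq G) (C : nat), forall q, exists l : seq G,
    [/\ all (mem D) l, (\prod_(g <- l) g)%g = q & (size l <= C * (size (seps x0 (gp q x0))).+1)%N].

Lemma fin_crossing_linear (G : groupType) (A : wallAct G) (x0 : pt A) :
  (exists W0, fin_crossing x0 W0) -> word_linear x0.
Proof.
move=> [W0 /linear_bound[D hD]]; exists D, 1%N => q.
by have [l] := hD q; exists l; rewrite mul1n.
Qed.

Lemma nth_flatten_const (J T : Type) (d : T) (j0 : J) (blk : J -> seq T) k s p :
  (0 < k)%N -> (forall j, size (blk j) = k) -> (p < size s * k)%N ->
  nth d (flatten [seq blk j | j <- s]) p = nth d (blk (nth j0 s (p %/ k))) (p %% k).
Proof.
move=> k0 hk; elim: s p => [|j s IH] p //= hp; rewrite nth_cat hk; case: ltnP => lp.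
  by rewrite divn_small // modn_small.
rewrite IH; last by move: hp; rewrite mulSn; lia.
have e1 : (p %/ k = (p - k) %/ k + 1)%N by rewrite -{1}(subnK lp) divnDr // divnn k0.
by rewrite e1 addn1 -[in RHS](subnK lp) modnDr addnK.
Qed.

Section CyclicWord.
Variables (I : finType) (r : word I).
Local Notation n := (size (edge_word r)).
Local Notation l0 := (None, false).

Lemma edge_letter_nat (i : int) : exists2 p, (p < n)%N &
  [/\ edge_letter r i = nth l0 (edge_word r) p, edge_letter r (i + 1) = nth l0 (edge_word r) (p.+1 %% n) & (i %% n)%Z = p%:Z].
Proof.
have n0 : (0 < n)%N by rewrite size_cat addn1.
have h1 := @ltz_pmod i n; have h2 := @modz_ge0 i n.
exists (absz (i %% n)%Z); first by lia.
split=> //; last by lia.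
rewrite /edge_letter; congr nth; rewrite -modzDml.
have -> : (i %% n)%Z + 1 = (absz (i %% n)%Z).+1%:Z by lia.
by rewrite modz_nat.
Qed.

End CyclicWord.

Section Orientable.
Variables (g : nat).
Let r := orientable_relator g.+1.
Local Notation n := (size (edge_word r)).
Local Notation l0 := (None, false).

Lemma size_orientable k : size (orientable_relator k) = (k * 4)%N.
Proof.
rewrite size_flatten /shape -map_comp (eq_map (g := fun _ => 4%N)) //.
by rewrite -[k in RHS]size_enum_ord; elim: (enum _) => //= _ s ->; rewrite mulSn.
Qed.

Lemma size_W : n = (g.+1 * 4).+1.
Proof. by rewrite size_cat size_map size_orientable addn1. Qed.

(** Closed form of the letter in position p: block p %/ 4 is a commutator, parity chooses between
    its two generators, its second half is inverted, and the last letter is the extra generator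
    [None]. *)
Definition oletter (p : nat) : option ('I_g.+1 * bool) * bool :=
  if (p < g.+1 * 4)%N then (Some (inord (p %/ 4), odd p), (2 <= p %% 4)%N) else l0.

Lemma nth_W p : nth l0 (edge_word r) p = oletter p.
Proof.
rewrite /edge_word nth_cat size_map size_orientable /oletter; case: ltnP => hp; last first.
  by case: (p - _)%N => [|[|q]].
rewrite (nth_map ((ord0, false), false)) ?size_orientable //.
rewrite (nth_flatten_const _ (k := 4) ord0) ?size_enum_ord //.
have lt4 : (p %/ 4 < g.+1)%N by rewrite ltn_divLR.
have -> : nth ord0 (enum 'I_g.+1) (p %/ 4) = inord (p %/ 4).
  by apply: ord_inj; rewrite nth_enum_ord // inordK.
have -> : odd p = odd (p %% 4) by lia.
by have := @ltn_pmod p 4 isT; case: (p %% 4)%N => [|[|[|[|]]]].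
Qed.

Lemma oletter_inj p q : (p < n)%N -> (q < n)%N -> oletter p = oletter q -> p = q.
Proof.
rewrite size_W /oletter => hp hq.
case: (ltnP p) => lp; case: (ltnP q) => lq //; last by lia.
move=> [/(congr1 val) /=]; rewrite !inordK ?ltn_divLR //; lia.
Qed.

Lemma oletter_inv p q : oletter p = letter_inv (oletter q) ->
  [/\ (p < g.+1 * 4)%N, (q < g.+1 * 4)%N, (p %/ 4 = q %/ 4)%N & p = (q + 2)%N \/ q = (p + 2)%N].
Proof.
rewrite /oletter /letter_inv; case: (ltnP p) => lp; case: (ltnP q) => lq //.
move=> [/(congr1 val) /=]; rewrite !inordK ?ltn_divLR // => h1 h2 h3; split=> //; lia.
Qed.

Lemma orientable_det i j : edge_letter r i = edge_letter r j -> edge_letter r (i + 1) = edge_letter r (j + 1) -> (n %| i - j)%Z.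
Proof.
have [p hp [-> _ ep]] := edge_letter_nat r i; have [q hq [-> _ eq]] := edge_letter_nat r j.
rewrite !nth_W => /(oletter_inj hp hq) e _; subst.
by rewrite -eqz_mod_dvd ep eq.
Qed.

(** Inverse letters are exactly two places apart. The first condition gives p = q + 3 or q - 1, the
    second p = q + 1 or q - 3. Nothing wraps around, as [None] has no inverse in the word. *)
Lemma orientable_noinv i j : edge_letter r i = letter_inv (edge_letter r (j + 1)) -> edge_letter r (i + 1) <> letter_inv (edge_letter r j).
Proof.
have [p hp [-> -> _]] := edge_letter_nat r i; have [q hq [-> -> _]] := edge_letter_nat r j.
rewrite !nth_W => /oletter_inv[a1 a2 a3 a4] /oletter_inv[c1 c2 c3 c4].
move: a1 a2 a3 a4 c1 c2 c3 c4 hp hq; rewrite size_W.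
case: (ltngtP p (g.+1 * 4)%N) => hp; [|lia|]; last first.
  by subst p; lia.
rewrite (@modn_small p.+1) //.
case: (ltngtP q (g.+1 * 4)%N) => hq; [|lia|]; last by lia.
by rewrite (@modn_small q.+1) //; lia.
Qed.

Lemma orientable_red i : edge_letter r (i + 1) <> letter_inv (edge_letter r i).
Proof.
have [p hp [-> -> _]] := edge_letter_nat r i; rewrite !nth_W => /oletter_inv[c1 c2 c3 c4].
move: c1 c2 c3 c4 hp; rewrite size_W => c1 c2.
by rewrite (@modn_small p.+1) //; lia.
Qed.

Lemma orientable_bb i : (edge_letter r i).1 = None -> (edge_letter r (i + 1)).1 <> None.
Proof.
have [p hp [-> -> _]] := edge_letter_nat r i; rewrite !nth_W /oletter size_W.
case: (ltnP p) => // lp _; rewrite (_ : p.+1 = (g.+1 * 4).+1) ?modnn //.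
by move: hp; rewrite size_W; lia.
Qed.

End Orientable.

Section NonOrientable.
Variables (g : nat).
Let r := nonorientable_relator g.+1.
Local Notation n := (size (edge_word r)).
Local Notation l0 := (None, false).

Lemma size_nonorientable k : size (nonorientable_relator k) = (k * 2)%N.
Proof.
rewrite size_flatten /shape -map_comp (eq_map (g := fun _ => 2%N)) //.
by rewrite -[k in RHS]size_enum_ord; elim: (enum _) => //= _ s ->; rewrite mulSn.
Qed.

Lemma nsize_W : n = (g.+1 * 2).+1.
Proof. by rewrite size_cat size_map size_nonorientable addn1. Qed.

Definition nletter (p : nat) : option 'I_g.+1 * bool :=
  if (p < g.+1 * 2)%N then (Some (inord (p %/ 2)), false) else l0.

Lemma nnth_W p : nth l0 (edge_word r) p = nletter p.
Proof.
rewrite /edge_word nth_cat size_map size_nonorientable /nletter; case: ltnP => hp; last first.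
  by case: (p - _)%N => [|[|q]].
rewrite (nth_map (ord0, false)) ?size_nonorientable //.
rewrite (nth_flatten_const _ (k := 2) ord0) ?size_enum_ord //.
have lt2 : (p %/ 2 < g.+1)%N by rewrite ltn_divLR.
have -> : nth ord0 (enum 'I_g.+1) (p %/ 2) = inord (p %/ 2).
  by apply: ord_inj; rewrite nth_enum_ord // inordK.
by have := @ltn_pmod p 2 isT; case: (p %% 2)%N => [|[|]].
Qed.

Lemma nletter_pos p : (nletter p).2 = false.
Proof. by rewrite /nletter; case: ifP. Qed.

Lemma nletter_inj p q : (p < n)%N -> (q < n)%N -> nletter p = nletter q -> (p %/ 2 = q %/ 2)%N.
Proof.
rewrite nsize_W /nletter => hp hq.
case: (ltnP p) => lp; case: (ltnP q) => lq //; last by lia.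
by move=> [/(congr1 val) /=]; rewrite !inordK ?ltn_divLR.
Qed.

Lemma nonorientable_det i j : edge_letter r i = edge_letter r j -> edge_letter r (i + 1) = edge_letter r (j + 1) -> (n %| i - j)%Z.
Proof.
have [p hp [-> -> ep]] := edge_letter_nat r i; have [q hq [-> -> eq]] := edge_letter_nat r j.
have n0 : (0 < n)%N by rewrite nsize_W.
rewrite !nnth_W => /(nletter_inj hp hq) e1 /(nletter_inj (ltn_pmod _ n0) (ltn_pmod _ n0)) e2.
suff e : p = q by rewrite -eqz_mod_dvd ep eq e.
move: hp hq e2; rewrite nsize_W => hp hq.
case: (ltngtP p (g.+1 * 2)%N) => lp; [|lia|]; last first.
  by subst p; lia.
case: (ltngtP q (g.+1 * 2)%N) => lq; [|lia|]; last by lia.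
by rewrite !modn_small //; lia.
Qed.

Lemma nonorientable_inv i j : edge_letter r i <> letter_inv (edge_letter r j).
Proof.
have [p hp [-> _ _]] := edge_letter_nat r i; have [q hq [-> _ _]] := edge_letter_nat r j.
by rewrite !nnth_W => /(congr1 snd) /=; rewrite !nletter_pos.
Qed.

Lemma nonorientable_bb i : (edge_letter r i).1 = None -> (edge_letter r (i + 1)).1 <> None.
Proof.
have [p hp [-> -> _]] := edge_letter_nat r i; rewrite !nnth_W /nletter nsize_W.
case: (ltnP p) => // lp _; rewrite (_ : p.+1 = (g.+1 * 2).+1) ?modnn //.
by move: hp; rewrite nsize_W; lia.
Qed.

End NonOrientable.

End RelatorWords.

(** * Hyperbolic surface groups as HNN extensions *)

Section HyperbolicSurfaces.
Import Order.TTheory GRing.Theory Num.Theory.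
Local Open Scope ring_scope.

Lemma orientable_relatorS g : orientable_relator g.+1 =
  [:: ((ord0, false), false); ((ord0, true), false); ((ord0, false), true); ((ord0, true), true)]
  ++ [seq ((lift ord0 l.1.1, l.1.2), l.2) | l <- orientable_relator g].
Proof.
rewrite /orientable_relator enum_ordSl /=; do 4 congr cons.
by elim: (enum 'I_g) => //= i s ->.
Qed.

Lemma nonorientable_relatorS k : nonorientable_relator k.+1 =
  [:: (ord0, false); (ord0, false)] ++ [seq (lift ord0 l.1, l.2) | l <- nonorientable_relator k].
Proof.
rewrite /nonorientable_relator enum_ordSl /=; do 2 congr cons.
by elim: (enum 'I_k) => //= i s ->.
Qed.

Lemma weval_lift (G : groupType) (I : finType) (y : I -> G) b r :
  weval (letter y b) (lift_word r) = weval y r.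
Proof. by rewrite /lift_word weval_map. Qed.

Lemma wsum_lift (G : groupType) (I : finType) (y : I -> G) b r c (q : G) :
  wsum (letter y b) c q (lift_word r) = wsum y (fun h a => c h (Some a)) q r :> bool.
Proof. by rewrite /lift_word wsum_map. Qed.

Lemma mem_hnn_letters (G : groupType) (I : finType) (y : I -> G) T b :
  [/\ T \in hnn_letters y T b, b \in hnn_letters y T b & forall i, y i \in hnn_letters y T b].
Proof.
have h a : letter y b a \in hnn_letters y T b.
  rewrite /hnn_letters mem_cat; apply/orP; right; apply/flattenP.
  exists [seq letter_val y b (a, s) | s <- [:: true; false]]; last by rewrite /= !inE eqxx orbT.
  by apply/mapP; exists a; rewrite ?mem_enum.
by split; [rewrite inE eqxx|exact: (h None)|move=> i; exact: (h (Some i))].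
Qed.

Section Surface.
Variables (G : groupType) (A : wallAct G) (x0 : pt A).
Hypothesis fg : forall h : wl A, essential x0 h -> fg_stab h.

Lemma presents_gen (B : Type) (f : B -> G) rel (L : seq G) : presents f rel ->
  (forall s, s \in L -> s^-1%g \in L) -> (forall a, exists k, f a \in wball L k) ->
  forall g, exists k, g \in wball L k.
Proof. by move=> pres symL hf g; have [w <-] := pres.1 g; apply: ball_weval. Qed.

(** The first handle provides the splitting: the relator reads b_0 a_0 b_0^-1 = R a_0 with R the
    product of the other commutators. The stable letter is b_0, and a_0 joins the remaining
    generators in the vertex group. *)
Lemma orientable_linear g (f : 'I_g.+2 * bool -> G) :
  presents f [set orientable_relator g.+2]%classic -> exists W0, fin_crossing x0 W0.
Proof.
move=> pres.
pose h (a : 'I_g.+1 * bool) := (lift ord0 a.1, a.2); pose y := f \o h.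
pose a0 := f (ord0, false); pose b0 := f (ord0, true); pose r := orientable_relator g.+1.
have er : orientable_relator g.+2 = [:: ((ord0, false), false); ((ord0, true), false);
   ((ord0, false), true); ((ord0, true), true)] ++ [seq (h l.1, l.2) | l <- r].
  exact: orientable_relatorS.
have rel : (a0 * b0 * a0^-1 * b0^-1 * weval y r = 1)%g.
  rewrite -(relator_eval pres (erefl : [set orientable_relator g.+2]%classic _)) er weval_cat weval_map.
  by rewrite !weval_cons weval_nil /= mulg1 !mulgA.
have ew : edge_elt y a0 r = (weval y r * a0)%g.
  by rewrite /edge_elt weval_cat weval_lift weval_cons weval_nil mulg1.
have eR : weval y r = (b0 * a0 * b0^-1 * a0^-1)%g.
  apply: (mulgI (a0 * b0 * a0^-1 * b0^-1)%g); rewrite rel.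
  by rewrite -!mulgA mulKg mulKg mulVKg mulgV.
have [e [eM ee]] : exists e : G -> int, (forall g h, e (g * h)%g = e g + e h) /\
    forall a, e (f a) = ((a.1 == ord0) && a.2)%:Z.
  apply: (presents_hom (c := fun a => ((a.1 == ord0) && a.2)%:Z)) pres _ => _ ->.
  rewrite er big_cat /= big_map [X in _ + X]big1 ?addr0; last by move=> [[i s] [|]].
  by rewrite !big_cons big_nil.
pose L := hnn_letters y b0 a0; have [bL aL yL] := mem_hnn_letters y b0 a0.
have symL s : s \in L -> s^-1%g \in L by exact: hnn_lettersV.
have genL : forall g, exists k, g \in wball L k.
  apply: (presents_gen pres symL) => -[i s]; exists 1%N; apply: ball_letter.
  have [j ->|->] := unliftP ord0 i; first exact: (yL (j, s)).
  by case: s.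
have [R cR] := thick_connected_all symL genL fg.
apply: (@fin_crossing_hnn G _ y b0 a0 r false e eM _ _ _ _ _ _ _ _ genL A x0 R cR).
- by rewrite ee eqxx.
- by case=> [a|] /=; rewrite ee.
- by rewrite ew eR !mulgVK.
- move=> cT c hc.
  (* Cochains are carried back to the original generators. The closed path of the cell at q' is the
     surface relator started at q, where q' is reached after the first commutator. *)
  pose c' q (a : 'I_g.+2 * bool) : bool := if unlift ord0 a.1 is Some i then c q (Some (i, a.2))
     else if a.2 then cT q else c q None.
  have [_ -> q|s hs] := cocycle_coboundary pres (c := c'); last first.
    exists s; split=> [q|q [[i t]|]].
    + by rewrite hs /c' unlift_none.
    + by rewrite /= hs /c' /= liftK.
    + by rewrite /= hs /c' unlift_none.
  rewrite er wsum_cat wsum_map /= /c' !unlift_none /=.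
  set q' := (q * weval f _)%g.
  have -> : wsum (f \o h) (fun g b => match unlift ord0 (h b).1 with
      | Some i => c g (Some (i, (h b).2)) | None => if (h b).2 then cT g else c g None end) q' r =
      wsum y (fun g a => c g (Some a)) q' r.
    by apply: eq_wsum => k [i t]; rewrite /= liftK.
  have eq' : q' = (q * a0 * b0 * a0^-1 * b0^-1)%g.
    by rewrite /q' !weval_cons weval_nil /= mulg1 !mulgA.
  have := hc q'; rewrite /edge_word wsum_cat wsum_lift weval_lift /= !ew.
  have -> : (q' * bet y b0 a0 r false = q * a0 * b0 * a0^-1)%g.
    by rewrite eq' /bet mulgVK.
  have -> : (q' * weval y r = q)%g by rewrite eq' -[RHS]mulg1 -rel !mulgA.
  rewrite -/a0 -/b0 mulgA (_ : q' * weval y r = q)%g; last by rewrite eq' -[RHS]mulg1 -rel !mulgA.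
  rewrite -eq'; move: (wsum _ _ _ _) => u.
  by case: (cT q'); case: (cT _); case: (c q None); case: (c _ None); case: u.
- exact: orientable_det.
- exact: orientable_noinv.
- exact: orientable_red.
- exact: orientable_bb.
Qed.


(** The substitution a_0 = b T, a_1 = T^-1 turns a_0^2 a_1^2 R = 1 into T b T^-1 = (R b)^-1, an HNN
    extension with inverted exponent. *)
Lemma nonorientable_linear g (f : 'I_g.+3 -> G) :
  presents f [set nonorientable_relator g.+3]%classic -> exists W0, fin_crossing x0 W0.
Proof.
move=> pres.
pose h (i : 'I_g.+1) : 'I_g.+3 := lift ord0 (lift ord0 i); pose y := f \o h.
pose i1 : 'I_g.+3 := lift ord0 ord0.
pose a0 := f ord0; pose a1 := f i1; pose r := nonorientable_relator g.+1.
pose b := (a0 * a1)%g; pose T := (a1^-1)%g.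
have er : nonorientable_relator g.+3 = [:: (ord0, false); (ord0, false); (i1, false); (i1, false)]
    ++ [seq (h l.1, l.2) | l <- r].
  by rewrite (nonorientable_relatorS g.+2) (nonorientable_relatorS g.+1) map_cat /= -map_comp.
have rel : (a0 * a0 * a1 * a1 * weval y r = 1)%g.
  rewrite -(relator_eval pres (erefl : [set nonorientable_relator g.+3]%classic _)) er weval_cat weval_map.
  by rewrite !weval_cons weval_nil /= mulg1 !mulgA.
have ew : edge_elt y b r = (weval y r * b)%g.
  by rewrite /edge_elt weval_cat weval_lift weval_cons weval_nil mulg1.
have eR : weval y r = (a1^-1 * a1^-1 * a0^-1 * a0^-1)%g.
  apply: (mulgI (a0 * a0 * a1 * a1)%g); rewrite rel.
  by rewrite -!mulgA !mulVKg mulgV.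
pose ce (i : 'I_g.+3) : int := if i == ord0 then 1 else if i == i1 then -1 else 0.
have ceh i : ce (h i) = 0 by [].
have [e [eM ee]] : exists e : G -> int, (forall g h, e (g * h)%g = e g + e h) /\
    forall a, e (f a) = ce a.
  apply: (presents_hom (c := ce)) pres _ => _ ->.
  rewrite er big_cat /= big_map [X in _ + X]big1 ?addr0; last by move=> [i [|]].
  by rewrite !big_cons big_nil.
have eT : e T = 1.
  by have := eM a1 T; rewrite mulgV (hom_unit eM) ee /ce /=; lia.
pose L := hnn_letters y T b; have [TL bL yL] := mem_hnn_letters y T b.
have symL s : s \in L -> s^-1%g \in L by exact: hnn_lettersV.
have ea1 : a1 = T^-1%g by rewrite invgK.
have ea0 : a0 = (b * T)%g by rewrite mulgK.
have genL : forall g, exists k, g \in wball L k.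
  apply: (presents_gen pres symL) => i; have [j ->|->] := unliftP ord0 i; last first.
    by exists (1 + 1)%N; rewrite -/a0 ea0; apply: ballM; exact: ball_letter.
  exists 1%N; apply: ball_letter; have [k ->|->] := unliftP ord0 j; first exact: yL.
  by rewrite -/a1 ea1; exact: symL.
have [R cR] := thick_connected_all symL genL fg.
apply: (@fin_crossing_hnn G _ y T b r true e eM eT _ _ _ _ _ _ _ genL A x0 R cR).
- by case=> [a|] /=; rewrite ?ee //; rewrite /b eM !ee.
- by rewrite ew eR /b /T !invgM !invgK -!mulgA mulKg mulgV mulg1.
- move=> cT c hc.
  (* Mod 2 no signs occur: an a_1-edge is the T-edge at its end point reversed, and an a_0-edge is a
     b-edge followed by a T-edge. *)
  pose c' q (i : 'I_g.+3) : bool := if unlift ord0 i is Some j then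
      if unlift ord0 j is Some k then c q (Some k) else cT (q * a1)%g
    else c q None (+) cT (q * b)%g.
  have c'h q k : c' q (h k) = c q (Some k) by rewrite /c' !liftK.
  have c'0 q : c' q ord0 = c q None (+) cT (q * b)%g by rewrite /c' unlift_none.
  have c'1 q : c' q i1 = cT (q * a1)%g by rewrite /c' liftK unlift_none.
  have [_ -> q|s hs] := cocycle_coboundary pres (c := c'); last first.
    have hT q : s (q * T)%g = s q (+) cT q.
      have := hs (q * T)%g i1; rewrite c'1 -/a1 ea1 mulgK => ->.
      by case: (s _); case: (cT _).
    exists s; split=> // q [i|] /=; first by rewrite -[y i]/(f (h i)) hs c'h.
    have := hs q ord0; rewrite c'0 -/a0 ea0 mulgA hT.
    by case: (s _); case: (s _); case: (c _ _); case: (cT _).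
  rewrite er wsum_cat wsum_map /= !c'0 !c'1.
  set q' := (q * weval f _)%g.
  have -> : wsum (f \o h) (fun g b => c' g (h b)) q' r = wsum y (fun g a => c g (Some a)) q' r.
    by apply: eq_wsum => k i; rewrite c'h.
  have eq' : q' = (q * a0 * a0 * a1 * a1)%g.
    by rewrite /q' !weval_cons weval_nil /= mulg1 !mulgA.
  have := hc q'; rewrite /edge_word wsum_cat wsum_lift weval_lift /= !ew.
  have q'R : (q' * weval y r = q)%g by rewrite eq' -[RHS]mulg1 -rel !mulgA.
  rewrite !mulgA q'R -/a0 -/a1 eq'.
  have -> : (q * a0 * a1 * T = q * a0)%g by exact: mulgK.
  move: (wsum _ _ _ _) => u.
  by case: (c _ _); case: (c _ _); case: (cT _); case: (cT _); case: (cT _); case: u.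
- exact: nonorientable_det.
- by move=> i j _; exact: nonorientable_inv.
- by move=> i; exact: nonorientable_inv.
- exact: nonorientable_bb.
Qed.

End Surface.

End HyperbolicSurfaces.

(** * Torus, Klein bottle, sphere and projective plane *)

Section FlatSurfaces.
Import Order.TTheory GRing.Theory Num.Theory.
Local Open Scope ring_scope.

Lemma zpow_conj (G : groupType) (T c d : G) j : (c * T = T * d)%g ->
  (zpow c j * T = T * zpow d j)%g.
Proof.
move=> h; have ed : d = (T^-1 * c * T)%g by rewrite -mulgA h mulKg.
have := @int_const _ (fun j => zpow c j * T * (zpow d j)^-1)%g _ j.
rewrite !zpow0 mul1g invg1 mulg1 => e.
rewrite -[in RHS]e ?mulgVK // => k; rewrite !zpow1S invgM !mulgA; congr (_ * _)%g.
by rewrite -[(_ * c * T)%g]mulgA h mulgA mulgK.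
Qed.

Lemma zpow2 (G : groupType) (T : G) k : zpow (T * T)%g k = zpow T (2 * k).
Proof.
have := @int_const _ (fun j => zpow (T * T)%g j * (zpow T (2 * j))^-1)%g _ k.
rewrite mulr0 !zpow0 invg1 mulg1 => e; apply: (mulIg (zpow T (2 * k))^-1%g); rewrite e ?mulgV //.
move=> j; rewrite (_ : 2 * (j + 1) = 2 * j + 1 + 1) ?zpow1S ?invgM ?mulgA ?mulgK //; lia.
Qed.

Lemma zpowV (G : groupType) (T : G) k : zpow T^-1%g k = zpow T (- k).
Proof.
have := @int_const _ (fun j => zpow T^-1%g j * zpow T j)%g _ k.
rewrite !zpow0 mulg1 zpowN => e; apply: (mulIg (zpow T k)); rewrite e ?mulVg //.
move=> j; rewrite !zpow1S (@zpow_conj _ T T T j erefl).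
by rewrite -mulgA [(_ * (T * _))%g]mulgA mulVg mul1g.
Qed.

Lemma zpow_letters (G : groupType) (x : G) k : exists l,
  [/\ all (mem [:: x; x^-1%g]) l, (\prod_(g <- l) g)%g = zpow x k & size l = absz k].
Proof.
have rep (z : G) n : (\prod_(g <- nseq n z) g)%g = (z ^+ n)%g.
  by elim: n => [|n IH]; rewrite ?big_nil // big_cons IH expgS.
case: k => n; [exists (nseq n x)|exists (nseq n.+1 x^-1%g)].
  by rewrite rep size_nseq; split=> //; apply/allP => z /nseqP[-> _]; rewrite !inE eqxx.
rewrite rep size_nseq expVgn; split=> //; apply/allP => z /nseqP[-> _].
by rewrite !inE eqxx orbT.
Qed.

Section Flat.
Variables (G : groupType) (A : wallAct G) (x0 : pt A).

(* G need not be abelian: the index-two subgroup generated by [T * T] and [x]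
   is what the plane argument applies to. *)
Lemma klein_linear (T x : G) : (x * (T * T) = T * T * x)%g ->
  (forall g, exists i j, g = (zpow T i * zpow x j)%g) ->
  (forall i j, (zpow T (2 * i) * zpow x j)%g = 1%g -> i = 0 /\ j = 0) -> word_linear x0.
Proof.
move=> xTT span indep; pose Phi i j := (zpow T (2 * i) * zpow x j)%g.
have com k j : (zpow x j * zpow T (2 * k) = zpow T (2 * k) * zpow x j)%g.
  by rewrite -zpow2; apply/esym/zpow_conj/esym/zpow_conj.
have PhiD i j k l : Phi (i + k) (j + l) = (Phi i j * Phi k l)%g.
  rewrite /Phi mulrDr !zpowD -!mulgA; congr (_ * _)%g.
  by rewrite [in RHS]mulgA com mulgA.
have [C hC] := plane_linear x0 PhiD indep.
pose t := sdist x0 (gp T x0).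
exists ([:: T; T^-1] ++ [:: x; x^-1])%g, (2 * C * t.+1 + 2)%N => q.
have [i [j ->]] := span q.
have [l1 [a1 p1 s1]] := zpow_letters T i; have [l2 [a2 p2 s2]] := zpow_letters x j.
exists (l1 ++ l2); split.
- rewrite all_cat; apply/andP; split; [apply/allP => z /(allP a1)|apply/allP => z /(allP a2)];
    by rewrite /= !inE => /orP[]/eqP->; rewrite eqxx ?orbT.
- by rewrite big_cat /= p1 p2.
rewrite size_cat s1 s2 -/(sdist _ _).
have [i' [r [ei hr]]] : exists i' r : int, i = r + 2 * i' /\ (r = 0 \/ r = 1).
  by exists (i %/ 2)%Z, (i %% 2)%Z; have := divz_eq i 2; have := @ltz_pmod i 2; have := @modz_ge0 i 2; lia.
have := hC i' j; rewrite -/(Phi _ _).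
have -> : (zpow T i * zpow x j = zpow T r * Phi i' j)%g by rewrite ei zpowD mulgA.
have tr : (sdist x0 (gp (Phi i' j) x0) <= t + sdist x0 (gp (zpow T r * Phi i' j)%g x0))%N.
  rewrite -(sdistG (zpow T r)) -gpM; apply: leq_trans (sdist_triangle x0 _ _) _.
  rewrite leq_add2r sdistC; case: hr => ->; rewrite ?zpow0 ?zpow1 //.
  rewrite gp1 /sdist; case E: (seps x0 x0) => [//|h s].
  by have := mem_seps x0 x0 h; rewrite E mem_head sepxx.
move: tr; set S1 := sdist _ _; set S2 := sdist _ _ => tr h.
have e1 : (absz i + absz j <= 2 * (absz i' + absz j) + 1)%N by lia.
apply: leq_trans e1 _; nia.
Qed.

Lemma torus_linear (f : 'I_1 * bool -> G) :
  presents f [set orientable_relator 1]%classic -> word_linear x0.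
Proof.
move=> pres; pose a := f (ord0, false); pose b := f (ord0, true).
have er : orientable_relator 1 = [:: ((ord0, false), false); ((ord0, true), false);
   ((ord0, false), true); ((ord0, true), true)].
  by rewrite orientable_relatorS /orientable_relator (size0nil (size_enum_ord 0)).
have ab : (a * b = b * a)%g.
  apply: (mulIg a^-1%g); apply: (mulIg b^-1%g); rewrite mulgK mulgV.
  rewrite -(relator_eval pres (erefl : [set orientable_relator 1]%classic _)) er.
  by rewrite !weval_cons weval_nil /= mulg1 !mulgA.
have homs s : exists e : G -> int, (forall g h, e (g * h)%g = e g + e h) /\
    forall u, e (f u) = (u.2 == s)%:Z.
  apply: (presents_hom (c := fun u => (u.2 == s)%:Z)) pres _ => _ ->.
  by rewrite er !big_cons big_nil /=; lia.
apply: (@klein_linear a b).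
- by rewrite mulgA -ab -mulgA -ab mulgA.
- apply: (presents_ind pres); first by exists 0, 0; rewrite !zpow0 mulg1.
  move=> _ [i s] [k [l ->]]; rewrite (ord1 i); case: s; rewrite -/a -/b.
    split; first by exists k, (l + 1); rewrite zpow1S mulgA.
    by exists k, (l - 1); rewrite zpowD zpowN zpow1 mulgA.
  have h : (b * a^-1 = a^-1 * b)%g by apply: (mulgI a); rewrite mulVKg mulgA ab mulgK.
  split; first by exists (k + 1), l; rewrite zpow1S -!mulgA; congr (_ * _)%g; exact: zpow_conj.
  exists (k - 1), l; rewrite zpowD zpowN zpow1 -!mulgA; congr (_ * _)%g; exact: zpow_conj.
- move=> i j h; have [e1 [m1 v1]] := homs false; have [e2 [m2 v2]] := homs true.
  have := congr1 e1 h; have := congr1 e2 h; rewrite m1 m2 (hom_unit m1) (hom_unit m2) !hom_zpow // !v1 !v2 /=.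
  by split; lia.
Qed.

Lemma klein_bottle_linear (f : 'I_2 -> G) :
  presents f [set nonorientable_relator 2]%classic -> word_linear x0.
Proof.
move=> pres; pose i1 : 'I_2 := lift ord0 ord0; pose a0 := f ord0; pose a1 := f i1.
pose x := (a0 * a1)%g; pose T := (a1^-1)%g.
have er : nonorientable_relator 2 = [:: (ord0, false); (ord0, false); (i1, false); (i1, false)].
  rewrite (nonorientable_relatorS 1) (nonorientable_relatorS 0) /nonorientable_relator.
  by rewrite (size0nil (size_enum_ord 0)).
have rel : (a0 * a0 * a1 * a1 = 1)%g.
  rewrite -(relator_eval pres (erefl : [set nonorientable_relator 2]%classic _)) er.
  by rewrite !weval_cons weval_nil /= mulg1 !mulgA.
have ea0 : a0 = (x * T)%g by rewrite mulgK.
have ea1 : a1 = T^-1%g by rewrite invgK.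
have xT : (x * T = T * x^-1)%g.
  by rewrite -ea0 /T /x -invgM -!mulgA; apply: (mulIg (a0 * (a1 * a1))%g); rewrite mulVg !mulgA.
have xTV : (x * T^-1 = T^-1 * x^-1)%g.
  by have := congr1 (fun z => z^-1%g) xT; rewrite (invgM x) (invgM T) (invgK x) => ->.
have [e [eM ee]] : exists e : G -> int, (forall g h, e (g * h)%g = e g + e h) /\
    forall i, e (f i) = (if i == ord0 then 1 else -1).
  apply: (presents_hom (c := fun i : 'I_2 => if i == ord0 then 1 else -1)) pres _ => _ ->.
  by rewrite er !big_cons big_nil.
have z := hom_unit eM.
have eT : e T = 1 by have := eM a1 T; rewrite mulgV z ee /=; lia.
have ex : e x = 0 by rewrite eM !ee.
have TT : (x * (T * T) = T * T * x)%g.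
  have h : (x^-1 * T = T * x)%g.
    by have := @zpow_conj _ T x x^-1%g (-1) xT; rewrite !zpowN !zpow1 invgK.
  by rewrite mulgA xT -mulgA h mulgA.
apply: (@klein_linear T x) => //.
- apply: (presents_ind pres); first by exists 0, 0; rewrite !zpow0 mulg1.
  have st g : (exists i j, g = (zpow T i * zpow x j)%g) ->
     [/\ exists i j, (g * x)%g = (zpow T i * zpow x j)%g,
         exists i j, (g * x^-1)%g = (zpow T i * zpow x j)%g,
         exists i j, (g * T)%g = (zpow T i * zpow x j)%g &
         exists i j, (g * T^-1)%g = (zpow T i * zpow x j)%g].
    move=> [i [j ->]]; split.
    + by exists i, (j + 1); rewrite zpow1S -mulgA.
    + by exists i, (j - 1); rewrite zpowD zpowN zpow1 -mulgA.
    + by exists (i + 1), (- j); rewrite zpow1S -2!mulgA (zpow_conj _ xT) zpowV.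
    + by exists (i - 1), (- j); rewrite zpowD (zpowN _ 1) zpow1 -2!mulgA (zpow_conj _ xTV) zpowV.
  move=> g i /st[h1 h2 h3 h4]; have [j ->|->] := unliftP ord0 i.
    rewrite (ord1 j); split; last exact: h3.
    by rewrite -/i1 -/a1 ea1.
  rewrite -/a0; split.
    by rewrite (_ : g * a0 = g * x * T)%g; [have [] := st _ h1|rewrite ea0 mulgA].
  by rewrite (_ : g * a0^-1 = g * T^-1 * x^-1)%g; [have [] := st _ h4|rewrite ea0 (invgM x) mulgA].
- move=> i j h; have i0 : i = 0.
    by have := congr1 e h; rewrite eM !hom_zpow // eT ex z; lia.
  split=> //; move: h; rewrite i0 mulr0 zpow0 mul1g => xj.
  (* x is torsion in the abelianization, so no homomorphism to the integers detects its infinite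
     order. The sign given by the parity of [e] twists the cochain: the two a_0-edges of the relator
     cancel, while along powers of x the sign stays positive. *)
  pose c g (k : 'I_2) : int := if k == ord0 then (if odd (absz (e g)) then -1 else 1) else 0.
  have [_ -> g|s hs] := cocycle_coboundary pres (c := c).
    by rewrite er /= /c /= eM ee /=; case: ifP; case: ifP; lia.
  have := @int_const _ (fun k => s (zpow x k) - k) _ j.
  rewrite xj zpow0 => h; suff : s 1%g - j = s 1%g - 0 by lia.
  have sx g : s (g * x)%g = s g + c g ord0 by rewrite /x mulgA hs hs /c addr0.
  by apply: h => k; rewrite zpow1S sx /c /= (hom_zpow eM) ex mul0r /=; lia.
Qed.

Lemma sphere_linear (f : 'I_0 * bool -> G) rel : presents f rel -> word_linear x0.
Proof.
move=> pres; exists [::], 0%N => q; exists [::]; split=> //; rewrite big_nil.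
by have [w <-] := pres.1 q; case: w => [|[[[]]]]; rewrite ?weval_nil.
Qed.

Lemma projective_linear (f : 'I_1 -> G) :
  presents f [set nonorientable_relator 1]%classic -> word_linear x0.
Proof.
move=> pres; pose a := f ord0; exists [:: a], 1%N.
have aa : (a * a = 1)%g.
  rewrite -(relator_eval pres (erefl : [set nonorientable_relator 1]%classic _)).
  rewrite nonorientable_relatorS /nonorientable_relator (size0nil (size_enum_ord 0)).
  by rewrite !weval_cons weval_nil /= mulg1.
have q1a q : q = 1%g \/ q = a.
  move: q; apply: (presents_ind pres); first by left.
  have aV : (a^-1 = a)%g by apply: (mulgI a); rewrite mulgV aa.
  by move=> g i [->|->]; rewrite (ord1 i) -/a aV ?mul1g ?aa; split; [right|right|left|left].
move=> q; case: (q1a q) => ->; [exists [::]|exists [:: a]]; split=> //.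
  by rewrite big_nil.
by rewrite big_seq1.
Qed.

Lemma surface_linear : (forall h : wl A, essential x0 h -> fg_stab h) ->
  surface_group G -> word_linear x0.
Proof.
move=> fg [[[|[|g]] [f pres]]|[[|[|[|k]]] [f [//= _ pres]]]].
- exact: sphere_linear pres.
- exact: torus_linear pres.
- exact: fin_crossing_linear (orientable_linear fg pres).
- exact: projective_linear pres.
- exact: klein_bottle_linear pres.
- exact: fin_crossing_linear (nonorientable_linear fg pres).
Qed.

End Flat.

End FlatSurfaces.

(** * The square complex of a cube complex *)

Definition flip n (u : corner n) (i : 'I_n) : corner n := [ffun j => u j (+) (j == i)].

Lemma flipK n i : involutive (@flip n ^~ i).
Proof. by move=> u; apply/ffunP => j; rewrite !ffunE -addbA addbb addbF. Qed.

Lemma flipC n (u : corner n) i j : flip (flip u i) j = flip (flip u j) i.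
Proof. by apply/ffunP => k; rewrite !ffunE -!addbA (addbC (k == i)). Qed.

Lemma axis_flip n i : axis i = flip (origin n) i.
Proof. by apply/ffunP => j; rewrite !ffunE. Qed.

Lemma antipode1 : antipode 1 = flip (origin 1) ord0.
Proof. by apply/ffunP => j; rewrite !ffunE (ord1 j). Qed.

Lemma ord2 (i : 'I_2) : i = ord0 \/ i = ord_max.
Proof. by case: i => [[|[|]]] // p; [left|right]; apply: val_inj. Qed.

Lemma antipode2 : antipode 2 = flip (flip (origin 2) ord0) ord_max.
Proof. by apply/ffunP => j; rewrite !ffunE; case: (ord2 j) => ->. Qed.

Lemma antipode2' : antipode 2 = flip (flip (origin 2) ord_max) ord0.
Proof. by rewrite antipode2 flipC. Qed.

Lemma face_map_flip m n (b : corner n) (s : 'I_m -> 'I_n) x j : injective s ->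
  face_map b s (flip x j) = flip (face_map b s x) (s j).
Proof.
move=> si; apply/ffunP => i; rewrite !ffunE -addbA; congr (_ (+) _).
have [[k ek]|no] := pselect (exists k, s k = i).
  have h y : [exists j, (s j == i) && y j] = y k.
    apply/existsP/idP => [[j' /andP[/eqP]]|yk]; last by exists k; rewrite ek eqxx.
    by rewrite -ek => /si ->.
  by rewrite !h ffunE -ek (inj_eq si).
rewrite (_ : (i == s j) = false); last by apply/eqP => e; apply: no; exists j.
have h y : [exists j, (s j == i) && y j] = false.
  by apply/existsP => -[j' /andP[/eqP e _]]; apply: no; exists j'.
by rewrite !h.
Qed.

Lemma face_map_origin m n (b : corner n) (s : 'I_m -> 'I_n) :
  face_map b s (origin m) = b.
Proof.
apply/ffunP => i; rewrite !ffunE (_ : [exists _, _] = false) ?addbF //.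
by apply/existsP => -[j]; rewrite ffunE andbF.
Qed.

Lemma face_mapP m n (b : corner n) (s : 'I_m -> 'I_n) x : injective s ->
  (exists z, x = face_map b s z) <-> (forall i, (forall j, s j <> i) -> x i = b i).
Proof.
move=> si; split=> [[z ->] i no|h].
  rewrite ffunE (_ : [exists _, _] = false) ?addbF //.
  by apply/existsP => -[j /andP[/eqP /no]].
exists [ffun j => x (s j) (+) b (s j)]; apply/ffunP => i; rewrite ffunE.
have [[k ek]|no] := pselect (exists k, s k = i).
  rewrite (_ : [exists _, _] = x i (+) b i); first by case: (x i); case: (b i).
  apply/existsP/idP => [[j' /andP[/eqP <-]]|yk]; first by rewrite ffunE.
  by exists k; rewrite ffunE ek eqxx.
rewrite h => [|j e]; last by apply: no; exists j.
rewrite (_ : [exists _, _] = false) ?addbF //.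
by apply/existsP => -[j /andP[/eqP e _]]; apply: no; exists j.
Qed.

Section Squares.
Variable X : cubeComplex.
Implicit Types a b c d : X.

Definition xadj a b := edge (a, b).

Definition xsq a b c d := exists2 k : corner 2 -> X, cube k &
  [/\ k (origin 2) = a, k (flip (origin 2) ord0) = b,
      k (antipode 2) = c & k (flip (origin 2) ord_max) = d].

Lemma cube_xadj n (k : corner n -> X) u i : cube k -> xadj (k u) (k (flip u i)).
Proof.
move=> ck; have si : injective (fun _ : 'I_1 => i) by move=> x y _; rewrite (ord1 x) (ord1 y).
exists (k \o face_map u (fun _ : 'I_1 => i)); first by apply: cube_face ck _; exists u, (fun=> i).
by rewrite /= antipode1 face_map_flip // face_map_origin.
Qed.

Definition pair_dir n (i j : 'I_n) (l : 'I_2) := if l == ord0 then i else j.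

Lemma pair_dir_inj n (i j : 'I_n) : i != j -> injective (pair_dir i j).
Proof.
move=> /eqP ij x y; case: (ord2 x) => ->; case: (ord2 y) => ->; rewrite /pair_dir //=.
by move=> e; case: ij.
Qed.

Lemma cube_xsq n (k : corner n -> X) u i j : i != j -> cube k ->
  xsq (k u) (k (flip u i)) (k (flip (flip u i) j)) (k (flip u j)).
Proof.
move=> ij ck; have si := pair_dir_inj ij.
exists (k \o face_map u (pair_dir i j)).
  by apply: cube_face ck _; exists u, (pair_dir i j).
by rewrite /= antipode2 !face_map_flip // face_map_origin.
Qed.

Lemma xadjC a b : xadj a b -> xadj b a.
Proof.
move=> [k ck [-> ->]]; have := cube_xadj (flip (origin 1) ord0) ord0 ck.
by rewrite flipK antipode1.
Qed.

Lemma xsq_rot a b c d : xsq a b c d -> xsq b c d a.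
Proof.
move=> [k ck [<- <- <- <-]].
have := cube_xsq (flip (origin 2) ord0) (isT : ord_max != ord0 :> 'I_2) ck.
by rewrite -antipode2 antipode2' !flipK.
Qed.

Lemma xsq_flip a b c d : xsq a b c d -> xsq a d c b.
Proof.
move=> [k ck [<- <- <- <-]].
have := cube_xsq (origin 2) (isT : ord_max != ord0 :> 'I_2) ck.
by rewrite -antipode2'.
Qed.

Lemma xsq_adj a b c d : xsq a b c d -> xadj a b.
Proof. by move=> [k ck [<- <- _ _]]; exact: cube_xadj. Qed.

Lemma xsq_neq a b c d : xsq a b c d -> a <> c.
Proof. by move=> [k ck [<- _ <- _]] /(cube_inj ck) /ffunP /(_ ord0); rewrite !ffunE. Qed.

(** The two squares meet in one common face, and a face of a square containing three of its corners
    is the whole square. *)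
Lemma xsq_uniq a b c d d' : xsq a b c d -> xsq a b c d' -> d = d'.
Proof.
move=> [k ck [ea eb ec ed]] [k' ck' [ea' eb' ec' ed']].
have [|m [phi [phi' [[b1 [s1 [i1 e1]]] _ ekk meet]]]] := cube_meet ck ck'.
  by exists (origin 2), (origin 2); rewrite ea ea'.
have [z0 [h0 _]] := meet _ _ (etrans ea (esym ea')).
have [z1 [h1 _]] := meet _ _ (etrans eb (esym eb')).
have [z2 [h2 _]] := meet _ _ (etrans ec (esym ec')).
have [z hz] : exists z, flip (origin 2) ord_max = phi z.
  rewrite e1; apply/face_mapP => // i no; exfalso.
  have g0 := (face_mapP b1 (origin 2) i1).1 (ex_intro _ z0 (etrans h0 (congr1 (@^~ z0) e1))) i no.
  have g1 := (face_mapP b1 _ i1).1 (ex_intro _ z1 (etrans h1 (congr1 (@^~ z1) e1))) i no.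
  have g2 := (face_mapP b1 _ i1).1 (ex_intro _ z2 (etrans h2 (congr1 (@^~ z2) e1))) i no.
  move: g0 g1 g2; case: (ord2 i) => ->; rewrite !ffunE /=; first by move=> <-.
  by move=> <- _.
have ekz : k (phi z) = k' (phi' z) by have := congr1 (@^~ z) ekk.
move: ekz; rewrite -hz ed; have inj := cube_inj ck.
have cases (x : corner 2) : [\/ x = origin 2, x = flip (origin 2) ord0, x = antipode 2 | x = flip (origin 2) ord_max].
  have ext (y : corner 2) : x ord0 = y ord0 -> x ord_max = y ord_max -> x = y.
    by move=> p q; apply/ffunP => i; case: (ord2 i) => ->.
  by case E0: (x ord0); case E1: (x ord_max); [apply: Or43|apply: Or42|apply: Or44|apply: Or41];
    apply: ext; rewrite ?E0 ?E1 !ffunE.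
have no x y (i : 'I_2) : k x = k y -> x i = y i by move=> /inj ->.
case: (cases (phi' z)) => ->.
- by rewrite ea' -ea -ed => /(no _ _ ord_max); rewrite !ffunE.
- by rewrite eb' -eb -ed => /(no _ _ ord_max); rewrite !ffunE.
- by rewrite ec' -ec -ed => /(no _ _ ord0); rewrite !ffunE.
- by rewrite ed'.
Qed.

Hypothesis flag : flag_links X.

Lemma link1 v a : xadj v a -> link_simplex v (fun _ : 'I_1 => a).
Proof.
move=> [k ck [ev ea]]; exists k; split=> // i.
by rewrite axis_flip (ord1 i) -antipode1.
Qed.

Lemma link2 v a b c : xsq v a c b -> link_simplex v (fun l : 'I_2 => if l == ord0 then a else b).
Proof.
move=> [k ck [ev ea _ eb]]; exists k; split=> // i.
by rewrite axis_flip; case: (ord2 i) => ->.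
Qed.

Lemma flag_cube v n (u : 'I_n -> X) : (forall i, xadj v (u i)) ->
  (forall i j, i != j -> exists c, xsq v (u i) c (u j)) -> link_simplex v u.
Proof.
move=> h1 h2; apply: flag => [i|i j ij]; first exact: link1.
by have [c] := h2 i j ij; exact: link2.
Qed.

(** The three squares make the neighbours of x pairwise adjacent in its link. The flag condition
    fills them by a 3-cube, and [xsq_uniq] identifies its faces at x with the given squares. *)
Lemma xsq_cube x y y' w p q z : xsq x y p w -> xsq x y' q w -> xsq x y z y' ->
  exists t, [/\ xsq w p t q, xsq y p t z & xsq y' q t z].
Proof.
move=> s1 s2 s3; pose i0 : 'I_3 := ord0; pose i1 : 'I_3 := lift ord0 ord0; pose i2 : 'I_3 := ord_max.
have c3 (i : 'I_3) : [\/ i = i0, i = i1 | i = i2].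
  by case: i => [[|[|[|]]]] // h; [apply: Or31|apply: Or32|apply: Or33]; apply: val_inj.
pose u (i : 'I_3) := if i == i0 then y else if i == i1 then y' else w.
have [||k [ck kx ku]] := @flag_cube x 3 u.
- move=> i; case: (c3 i) => ->; rewrite /u /=; first exact: xsq_adj s1.
    exact: xsq_adj s2.
  exact: xsq_adj (xsq_flip s1).
- move=> i j; case: (c3 i) => ->; case: (c3 j) => -> //= _; rewrite /u /=.
  + by exists z.
  + by exists p.
  + by exists z; exact: xsq_flip.
  + by exists q.
  + by exists p; exact: xsq_flip.
  + by exists q; exact: xsq_flip.
pose o := origin 3.
have ku' i : k (flip o i) = u i by rewrite -axis_flip ku.
have ez : z = k (flip (flip o i0) i1).
  apply: (xsq_uniq (a := y) (b := x) (c := y')); first exact: xsq_rot (xsq_rot (xsq_rot (xsq_flip s3))).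
  have := cube_xsq o (isT : i0 != i1) ck; rewrite kx !ku' => s.
  exact: xsq_rot (xsq_rot (xsq_rot (xsq_flip s))).
have ep : p = k (flip (flip o i0) i2).
  apply: (xsq_uniq (a := y) (b := x) (c := w)); first exact: xsq_rot (xsq_rot (xsq_rot (xsq_flip s1))).
  have := cube_xsq o (isT : i0 != i2) ck; rewrite kx !ku' => s.
  exact: xsq_rot (xsq_rot (xsq_rot (xsq_flip s))).
have eq : q = k (flip (flip o i1) i2).
  apply: (xsq_uniq (a := y') (b := x) (c := w)); first exact: xsq_rot (xsq_rot (xsq_rot (xsq_flip s2))).
  have := cube_xsq o (isT : i1 != i2) ck; rewrite kx !ku' => s.
  exact: xsq_rot (xsq_rot (xsq_rot (xsq_flip s))).
exists (k (flip (flip (flip o i0) i1) i2)); split.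
- rewrite ep eq -[w]/(u i2) -ku' (flipC (flip o i0) i1) !(flipC _ _ i2).
  exact: cube_xsq.
- rewrite ep ez -[y]/(u i0) -ku' (flipC (flip o i0) i1 i2).
  exact: cube_xsq.
- rewrite eq ez -[y']/(u i1) -ku' (flipC (flip o i0) i1 i2) (flipC o i0 i2) (flipC o i0 i1).
  rewrite (flipC (flip o i2) i0 i1) (flipC o i2 i1); exact: cube_xsq.
Qed.

Definition square_complex : sqComplex :=
  @SqComplex X xadj xsq xadjC xsq_rot xsq_flip xsq_adj xsq_neq xsq_uniq xsq_cube.

End Squares.

(** * Open stars and paths in the realization *)

Section Realization.
Import Order.TTheory GRing.Theory Num.Theory.
Import numFieldNormedType.Exports.
Local Open Scope classical_set_scope.
Local Open Scope ring_scope.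

Section Stars.
Variables (R : realType) (X : cubeComplex).
Local Notation rX := (realization R X).
Implicit Types (p : rX) (v w : X).

Definition star v : set rX := [set p | 0 < sval p v].

Lemma bary_continuous n (c : corner n -> X) v : continuous (fun t : 'rV[R]_n => bary c t v).
Proof.
apply: (@continuous_big R _ +%R 0 (fun e : corner n => c e == v)) => [|e _].
  exact: add_continuous.
apply: (@continuous_big R _ *%R 1 xpredT) => [|i _]; first exact: mul_continuous.
case: (e i) => /=; first exact: coord_continuous.
move=> t; apply: (@continuousB R R^o _ (fun=> 1) (fun s : 'rV[R]_n => s ord0 i)).
  exact: cst_continuous.
exact: coord_continuous.
Qed.

Lemma star_open v : open (star v).
Proof.
move=> n c cc; apply/open_subspaceP.
exists [set t | 0 < bary c t v].
  have /continuousP h := @bary_continuous n c v.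
  by apply: (h [set x | 0 < x]); exact: open_gt.
apply/seteqP; split=> t [h1 ht]; split=> //.
  have hp : is_point (bary c t) by exists n, c, t.
  by exists (exist _ _ hp).
by case: h1 => p sp ep; rewrite /= -ep.
Qed.

Lemma bary_gt0 n (c : corner n -> X) (t : 'rV[R]_n) v : 0 < bary c t v ->
  exists e, c e = v.
Proof.
move=> h; have [[e ee]|no] := pselect (exists e, c e = v); first by exists e.
move: h; rewrite /bary big1 ?ltxx // => e /eqP ee.
by case: no; exists e.
Qed.

Lemma star_ex p : exists v, star v p.
Proof.
have [n [c [t [cc ht e]]]] := svalP p.
pose x : corner n := [ffun i => 0 < t ord0 i].
exists (c x); rewrite /star /= e /bary (bigD1 x) //=.
apply: ltr_pwDl.
  apply: prodr_gt0 => i _; rewrite ffunE; case: (ltrP 0 (t ord0 i)) => // h.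
  by rewrite /= subr_gt0; apply: le_lt_trans h _.
apply: sumr_ge0 => y _; apply: prodr_ge0 => i _.
by case/andP: (ht i) => h0 h1; case: ifP; rewrite // subr_ge0.
Qed.

Lemma star_cube p : exists n (c : corner n -> X), cube c /\
  forall v, star v p -> exists e, c e = v.
Proof.
have [n [c [t [cc ht e]]]] := svalP p.
by exists n, c; split=> // v; rewrite /star /= e => /bary_gt0.
Qed.

Lemma pt_is_point v : is_point (bary (fun _ : corner 0 => v) (0 : 'rV[R]_0)).
Proof. by exists 0%N, (fun _ => v), 0; split=> //; [exact: cube_vertex|case]. Qed.

Definition vpt v : rX := exist _ _ (pt_is_point v).

Lemma star_pt v w : star w (vpt v) -> w = v.
Proof. by rewrite /star /= => h; have [e <-] := bary_gt0 h. Qed.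

(** A Lebesgue number for the cover by open stars: compactness is used as a near covering along the
    filter of small positive radii. *)
Lemma lebesgue (T : pseudoMetricType R) (K : set T) (F : T -> rX) : compact K ->
  {within K, continuous F} ->
  exists d : R, 0 < d /\ forall x, K x -> exists v, forall y, K y -> ball x d y -> star v (F y).
Proof.
move=> /compact_near_coveringP cov /subspace_continuousP cF.
have := cov R (at_right 0) (fun d x => exists v, forall y, K y -> ball x d y -> star v (F y)) _.
case=> [x Kx|d0 d00 hd].
- have [v sv] := star_ex (F x).
  have nv : nbhs (F x) (star v) by apply: open_nbhs_nbhs; split=> //; exact: star_open.
  have := cF x Kx _ nv; rewrite nbhs_filterE /= => /nbhs_ballP[e e0 be].
  have e20 : 0 < e / 2 by rewrite divr_gt0.
  exists (ball x (e / 2), [set d | 0 < d <= e / 2]).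
    split=> /=; first exact: nbhsx_ballx.
    near=> d; apply/andP; split; near: d; first exact: nbhs_right_gt.
    exact: nbhs_right_le.
  move=> [y d] [/= by_ /andP[dp de]]; exists v => z Kz bz; apply: be => //.
  rewrite (splitr e); apply: ball_triangle by_ _; exact: le_ball bz.
exists (d0 / 2); split; first by rewrite divr_gt0.
move=> x Kx; apply: hd Kx; rewrite /ball_ /= ?sub0r ?normrN ?gtr0_norm ?divr_gt0 //.
by rewrite ltr_pdivrMr // mulr_natr mulr2n ltrDl.
Unshelve. all: by end_near.
Qed.


Definition corner_row n (e : corner n) : 'rV[R]_n := \row_i (e i)%:R.

Lemma bary_corner n (c : corner n -> X) e v : bary c (corner_row e) v = (c e == v)%:R.
Proof.
have pe (e' : corner n) : \prod_(i < n) (if e' i then corner_row e ord0 i else 1 - corner_row e ord0 i)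
    = (e' == e)%:R :> R.
  case: eqVneq => [->|/eqP ne]; first by apply: big1 => i _; rewrite mxE; case: (e i); rewrite ?subr0.
  have [i /eqP ni] : exists i, e' i <> e i.
    by apply: contrapT => h; apply: ne; apply/ffunP => i; apply: contrapT => h'; apply: h; exists i.
  rewrite (bigD1 i) //= mxE; case: (e' i) ni; case: (e i) => //= _; first by rewrite mul0r.
  by rewrite subrr mul0r.
rewrite /bary (eq_bigr _ (fun e' _ => pe e')).
have [ev|ne] := eqVneq (c e) v.
  rewrite (bigD1 e) ?ev //= eqxx big1 ?addr0 // => e' /andP[_ /negbTE ->//].
by apply: big1 => e' /eqP ee; rewrite (_ : e' == e = false) //; apply/eqP => h; rewrite -ee h eqxx in ne.
Qed.

Lemma pt_corner n (c : corner n -> X) e : sval (vpt (c e)) = bary c (corner_row e).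
Proof.
apply/funext => v; rewrite /= bary_corner -(bary_corner (fun=> c e) (origin 0)).
by congr bary; apply/rowP => -[].
Qed.

Lemma ptE v w : sval (vpt v) w = (v == w)%:R.
Proof. by have := pt_corner (fun _ : corner 0 => v) (origin 0) => ->; rewrite bary_corner. Qed.

Definition chart n (c : corner n -> X) (cc : cube c) (t : 'rV[R]_n) : rX :=
  match pselect (unit_cube t) with
  | left h => exist (@is_point R X) (bary c t) (ex_intro _ n (ex_intro _ c (ex_intro _ t (And3 cc h erefl))))
  | right _ => vpt (c (origin n))
  end.

Lemma chartE n (c : corner n -> X) (cc : cube c) t : unit_cube t -> sval (chart cc t) = bary c t.
Proof. by move=> h; rewrite /chart; case: pselect. Qed.

Lemma chart_continuous n (c : corner n -> X) (cc : cube c) :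
  {within @unit_cube R n, continuous (chart cc)}.
Proof.
apply/continuousP => U oU; apply/open_subspaceP.
have /open_subspaceP[V oV e] := oU n c cc; exists V => //; rewrite e.
apply/seteqP; split=> t [h ht]; split=> //.
  case: h => p Up ep; suff e' : chart cc t = p by move: Up; rewrite -e'.
  by apply: sval_inj_realization; rewrite chartE.
by exists (chart cc t); rewrite ?chartE.
Qed.

Lemma const_mx_continuous (a : R) : continuous (fun x : R => const_mx (x - a) : 'rV[R]_1).
Proof.
move=> x; apply/cvg_ballP => e e0; near=> z; split=> // i j; rewrite !mxE.
rewrite /ball /= opprB addrA subrK; near: z.
exact: (@nbhsx_ballx _ _ x e e0).
Unshelve. all: by end_near.
Qed.

Lemma edge_path (k : corner 1 -> X) (ck : cube k) (a : R) :
  {within `[a, a + 1], continuous (fun x => chart ck (const_mx (x - a)))}.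
Proof.
apply/subspace_continuousP => x ax N nN.
have ix y : `[a, a + 1]%classic y -> unit_cube (const_mx (y - a) : 'rV[R]_1).
  by rewrite /= in_itv /= => /andP[h1 h2] i; rewrite mxE subr_ge0 h1 lerBlDl.
have /subspace_continuousP h := @chart_continuous 1 k ck.
have /= := h _ (ix x ax) N nN; rewrite /= nbhs_simpl /= => h1.
have := @const_mx_continuous a x _ h1; rewrite /= nbhs_simpl /= => h2.
by apply: filterS h2 => y /= h3 /ix.
Qed.

(** Unit speed along the edges. The last clause feeds the grid argument: over an edge the path meets
    only the stars of its ends. *)
Lemma walk_path (A : nat -> X) L : (forall i, (i < L)%N -> edge (A i, A i.+1)) ->
  exists f : R -> rX, [/\ {within `[0, L%:R], continuous f},
    forall i, (i <= L)%N -> f i%:R = vpt (A i) &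
    forall i x v, (i < L)%N -> i%:R <= x <= i.+1%:R -> star v (f x) -> v = A i \/ v = A i.+1].
Proof.
elim: L => [|L IH] hA.
  exists (fun=> vpt (A 0%N)); split=> // [|i]; last by rewrite leqn0 => /eqP->.
  by apply: continuous_subspaceT => x; exact: cst_continuous.
have [|f [cf fA fs]] := IH; first by move=> i iL; apply: hA; apply: ltnW.
have [k ck [k0 k1]] := hA L (ltnSn L).
pose g x := chart ck (const_mx (x - L%:R)).
have u0 : unit_cube (const_mx 0 : 'rV[R]_1) by move=> i; rewrite mxE lexx ler01.
have u1 : unit_cube (const_mx 1 : 'rV[R]_1) by move=> i; rewrite mxE lexx ler01.
have g0 : g L%:R = vpt (A L).
  apply: sval_inj_realization; rewrite /g subrr chartE // k0 pt_corner; congr bary.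
  by apply/rowP => i; rewrite !mxE ffunE.
have g1 : g L.+1%:R = vpt (A L.+1).
  apply: sval_inj_realization; rewrite /g -natrB // subSnn chartE // k1 pt_corner; congr bary.
  by apply/rowP => i; rewrite !mxE ffunE.
exists (fun x => if x <= L%:R then f x else g x); split.
- rewrite (_ : `[0, L.+1%:R]%classic = `[0, L%:R]%classic `|` `[L%:R, L%:R + 1]%classic); last first.
    apply/seteqP; split=> x /=; rewrite !in_itv /= -natr1.
      move=> /andP[h1 h2]; have [h|/ltW h] := lerP x L%:R; first by left; rewrite h1.
      by right; rewrite h h2.
    case=> /andP[h1 h2]; apply/andP; split=> //; first by apply: le_trans h2 _; rewrite lerDl.
    by apply: le_trans h1.
  apply: withinU_continuous; [exact: itv_closed|exact: itv_closed| |].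
    apply: subspace_eq_continuous cf => x; rewrite inE /= in_itv /= => /andP[_ h].
    by rewrite /from_subspace h.
  apply: subspace_eq_continuous (@edge_path k ck L%:R) => x; rewrite inE /= in_itv /= => /andP[h _].
  rewrite /from_subspace; case: ifP => // h'; have -> : x = L%:R by apply/eqP; rewrite eq_le h h'.
  by rewrite fA // -g0.
- move=> i; rewrite leq_eqVlt ltnS ler_nat => /orP[/eqP->|h]; first by rewrite ltnn g1.
  by rewrite h fA.
- move=> i x v; rewrite ltnS leq_eqVlt => /orP[/eqP->|iL] /andP[h1 h2].
    case: ifP => [h|_].
      have -> : x = L%:R by apply/eqP; rewrite eq_le h1 h.
      by rewrite fA // => /star_pt ->; left.
    rewrite /star /= /g chartE => [/bary_gt0[e <-]|j].
      have [h|h] : e = origin 1 \/ e = antipode 1.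
      + by case E: (e ord0); [right|left]; apply/ffunP => j; rewrite (ord1 j) E ffunE.
      + by left; rewrite h k0.
      + by right; rewrite h k1.
    by rewrite mxE subr_ge0 h1 lerBlDl natr1 h2.
  rewrite ifT; first by apply: fs => //; rewrite h1.
  by apply: le_trans h2 _; rewrite ler_nat.
Qed.

End Stars.

End Realization.

(** * Combinatorial homotopies inside cubes *)

Section Homotopy.
Variable Q : sqComplex.
Local Notation "p ~~> q" := (@homotopic Q p q) (at level 70).
Implicit Types (u v : Q) (p q s : seq Q).

Lemma hom_refl p : p ~~> p. Proof. exact: rst_refl. Qed.
Lemma hom_sym p q : p ~~> q -> q ~~> p. Proof. exact: rst_sym. Qed.
Lemma hom_trans q p s : p ~~> q -> q ~~> s -> p ~~> s. Proof. exact: rst_trans. Qed.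

Lemma hom_cat s p q : p ~~> q -> s ++ p ~~> s ++ q.
Proof.
move=> h; elim: s => //= x s IH; elim: IH => [{h}p' q' h|p'|p' q' _ h'|p' q' r _ h1 _ h2].
- by apply: rst_step; exact: hstep_cons.
- exact: hom_refl.
- exact: hom_sym.
- exact: hom_trans h1 h2.
Qed.

Lemma rev_walk u x v q q1 p : walk x v q -> q = v :: q1 -> walk u v p -> walk u x (rev q1 ++ p).
Proof.
move=> wq; elim: wq q1 p => [|z w q' wq' IH zw] q1 p [<-] wp //.
have [q1' eq'] := walk_nnil wq'; rewrite eq' rev_cons cat_rcons.
by apply: IH eq' _; apply: walkS wp _; exact: adjC.
Qed.

Lemma rev_walk_cancel x v q q1 : walk x v q -> q = v :: q1 -> exists q0, q = rcons q0 x /\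
  forall s, homotopic (q0 ++ rev q1 ++ v :: s) (v :: s).
Proof.
move=> wq; elim: wq q1 => [|z w q' wq' IH zw] q1 [<-].
  by exists [::]; split=> // s; exact: rst_refl.
have [q1' eq'] := walk_nnil wq'; have [q0 [e0 h0]] := IH _ eq'.
exists (w :: q0); split=> [|s]; first by rewrite e0.
rewrite eq' rev_cons cat_rcons /=; apply: (rst_trans _ _ _ [:: w, z, w & s]).
  exact: (@hom_cat [:: w] _ _ (h0 _)).
by apply: rst_step; apply: hstep_back; exact: adjC.
Qed.

End Homotopy.

Section Traces.
Variables (X : cubeComplex) (flag : flag_links X).
Local Notation Q := (square_complex flag).
Local Notation "p ~~> q" := (@homotopic Q p q) (at level 70).
Implicit Types (p q s : seq X).

Section OneCube.
Variables (n : nat) (c : corner n -> X).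
Hypothesis cc : cube c.
Implicit Types (x : corner n) (w : seq 'I_n).

(* Words of directions are read from the right, as walks are. *)
Definition fl x w : corner n := foldr (fun d y => flip y d) x w.

Fixpoint tr x w : seq X := if w is d :: w' then c (flip (fl x w') d) :: tr x w' else [::].

Lemma flE x w i : fl x w i = x i (+) odd (count_mem i w).
Proof.
elim: w => [|d w IH] /=; first by rewrite addbF.
by rewrite ffunE IH oddD -addbA; congr (_ (+) _); rewrite addbC eq_sym oddb.
Qed.

Lemma fl_ex x y : exists w, fl x w = y.
Proof.
exists [seq i <- enum 'I_n | x i != y i]; apply/ffunP => i; rewrite flE.
rewrite count_uniq_mem; last by rewrite filter_uniq ?enum_uniq.
rewrite mem_filter mem_enum andbT oddb.
by case: (x i); case: (y i).
Qed.

Lemma fl_cat x w w' : fl x (w ++ w') = fl (fl x w') w.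
Proof. exact: foldr_cat. Qed.

Lemma tr_cat x w w' : tr x (w ++ w') = tr (fl x w') w ++ tr x w'.
Proof. by elim: w => //= d w ->; rewrite fl_cat. Qed.

Lemma tr_head x w p : exists s, tr x w ++ c x :: p = c (fl x w) :: s.
Proof. by case: w => [|d w] /=; [exists p|exists (tr x w ++ c x :: p)]. Qed.

Lemma tr_front x w d p : d \in w -> exists w', [/\ size w = (size w').+1,
  fl x w = fl x (d :: w') & tr x w ++ c x :: p ~~> tr x (d :: w') ++ c x :: p].
Proof.
elim: w => // e w IH; rewrite inE; have [-> _|ne] := eqVneq d e.
  by exists w; split=> //; exact: hom_refl.
move=> /= /IH[w' [sz ef h]]; exists (e :: w'); split=> /=; first by rewrite sz.
  by rewrite ef /= flipC.
apply: hom_trans (@hom_cat Q [:: _] _ _ h) _; rewrite /= ef /=.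
have [s ->] := tr_head x w' p; apply: rst_step; rewrite (flipC _ d e).
apply: hstep_sq; apply: (@sq_rot Q); apply: (@sq_rot Q).
by rewrite eq_sym in ne; exact: (cube_xsq (fl x w') ne cc).
Qed.

Lemma tr_shorten x w d p : d \in w -> exists w', [/\ (size w' < (size w).+1)%N,
  fl x (d :: w) = fl x w' & tr x (d :: w) ++ c x :: p ~~> tr x w' ++ c x :: p].
Proof.
move=> /(tr_front x p)[w' [sz ef h]]; exists w'; split=> /=; first by lia.
  by rewrite ef /= flipK.
apply: hom_trans (@hom_cat Q [:: _] _ _ h) _; rewrite /= ef /= flipK.
have [s ->] := tr_head x w' p; apply: rst_step.
by apply: hstep_back; exact: cube_xadj.
Qed.

(** The first direction of one word occurs again in that word or occurs in the other. Squares of the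
    cube bring that occurrence next to it or to the front, where it cancels or matches, and the
    words get shorter. *)
Lemma tr_hom x w w' p : fl x w = fl x w' -> tr x w ++ c x :: p ~~> tr x w' ++ c x :: p.
Proof.
have [N] := ubnP (size w + size w'); elim: N => // N IH in w w' *; rewrite ltnS => sz ef.
case: w sz ef => [|d w] sz ef.
  case: w' sz ef => [|d w'] sz ef; first exact: hom_refl.
  have dw : d \in w'.
    apply: contraT => nd; have /ffunP/(_ d) := ef.
    by rewrite /= ffunE flE (count_memPn nd) eqxx addbF; case: (x d).
  have [v [s1 e1 h1]] := tr_shorten x p dw.
  apply: hom_trans _ (hom_sym h1); apply: IH; first by move: sz s1 => /=; lia.
  by rewrite ef e1.
have [dw|nd] := boolP (d \in w).
  have [v [s1 e1 h1]] := tr_shorten x p dw.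
  apply: hom_trans h1 _; apply: IH; first by move: sz s1 => /=; lia.
  by rewrite -e1.
have dw' : d \in w'.
  apply: contraT => nd'; have /ffunP/(_ d) := ef.
  by rewrite /= ffunE !flE (count_memPn nd) (count_memPn nd') eqxx !addbF; case: (x d).
have [v [s1 e1 h1]] := tr_front x p dw'.
apply: hom_trans _ (hom_sym h1).
have ef' : fl x w = fl x v by move: ef; rewrite e1 /= => /(congr1 (fun y => flip y d)); rewrite !flipK.
rewrite /= ef'; apply: (@hom_cat Q [:: _]); apply: IH => //.
by move: sz s1 => /=; lia.
Qed.

End OneCube.

Lemma fl_face m n (b : corner n) (s : 'I_m -> 'I_n) z w : injective s ->
  fl (face_map b s z) (map s w) = face_map b s (fl z w).
Proof. by move=> si; elim: w => //= d w ->; rewrite face_map_flip. Qed.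

Lemma tr_face m n (c : corner n -> X) (b : corner n) (s : 'I_m -> 'I_n) z w :
  injective s -> tr c (face_map b s z) (map s w) = tr (c \o face_map b s) z w.
Proof. by move=> si; elim: w => //= d w ->; rewrite fl_face // face_map_flip. Qed.

Definition incube n (c : corner n -> X) v := exists x, c x = v.

Definition trace u v s := exists n (c : corner n -> X) x w,
  [/\ cube c, c x = u, c (fl x w) = v & s = tr c x w].

Lemma trace_cube n (c : corner n -> X) u v : cube c -> incube c u -> incube c v ->
  exists s, trace u v s.
Proof.
move=> cc [x ex] [y ey]; have [w ew] := fl_ex x y.
by exists (tr c x w), n, c, x, w; rewrite ew.
Qed.

Lemma trace_refl u : trace u u [::].
Proof. by exists 0, (fun _ => u), (origin 0), [::]; split=> //; exact: cube_vertex. Qed.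

Lemma trace_edge u v : xadj u v -> trace u v [:: v].
Proof.
move=> [c cc [-> ->]]; exists 1, c, (origin 1), [:: ord0]; split=> //=.
  by rewrite -antipode1.
by rewrite -antipode1.
Qed.

Lemma trace_head u v s p : trace u v s -> exists s', s ++ u :: p = v :: s'.
Proof. by move=> [n [c [x [w [_ <- <- ->]]]]]; exact: tr_head. Qed.

(* Two cubes containing [u] and [v] share a face containing both. *)
Lemma trace_hom u v s s' p : trace u v s -> trace u v s' -> s ++ u :: p ~~> s' ++ u :: p.
Proof.
move=> [n [c [x [w [cc eu ev ->]]]]] [n' [c' [x' [w' [cc' eu' ev' ->]]]]].
have [|m [phi [phi' [[b [sd [si e]]] [b' [sd' [si' e']]] ekk meet]]]] := cube_meet cc cc'.
  by exists x, x'; rewrite eu eu'.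
have [z0 [x0 x0']] := meet x x' (etrans eu (esym eu')).
have [z1 [x1 x1']] := meet _ _ (etrans ev (esym ev')).
have [w0 ew0] := fl_ex z0 z1.
apply: (@hom_trans Q (tr c x (map sd w0) ++ u :: p)).
  rewrite -eu; apply: tr_hom => //.
  by rewrite x1 x0 e fl_face // ew0.
have -> : tr c x (map sd w0) = tr c' x' (map sd' w0).
  by rewrite x0 x0' e e' !tr_face // -e -e' ekk.
rewrite -eu'; apply: tr_hom => //.
by rewrite x1' x0' e' fl_face // ew0.
Qed.

Lemma trace_triangle n (c : corner n -> X) u v t s1 s2 s3 p : cube c ->
  incube c u -> incube c v -> incube c t -> trace u v s1 -> trace v t s2 -> trace u t s3 ->
  s2 ++ s1 ++ u :: p ~~> s3 ++ u :: p.
Proof.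
move=> cc [x eu] [y ev] [z et] t1 t2 t3.
have [w1 e1] := fl_ex x y; have [w2 e2] := fl_ex y z.
have t1' : trace u v (tr c x w1) by exists n, c, x, w1; rewrite e1.
have t2' : trace v t (tr c y w2) by exists n, c, y, w2; rewrite e2.
have [s' es] := trace_head p t1.
apply: (@hom_trans Q (tr c y w2 ++ s1 ++ u :: p)); first by rewrite es; exact: trace_hom t2 t2'.
apply: (hom_trans (hom_cat _ (trace_hom p t1 t1'))).
rewrite catA -e1 -tr_cat; apply: trace_hom t3.
by exists n, c, x, (w2 ++ w1); rewrite fl_cat e1 e2.
Qed.

Lemma trace_walk u v s u0 p : trace u v s -> @walk Q u0 u p -> @walk Q u0 v (s ++ p).
Proof.
move=> [n [c [x [w [cc <- <- ->]]]]] wp.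
elim: w => //= d w IH; apply: (@walkS Q _ _ _ _ IH); exact: cube_xadj.
Qed.

Definition joined u v := exists n (c : corner n -> X), [/\ cube c, incube c u & incube c v].

Lemma cp_ex u v : exists s, joined u v -> trace u v s.
Proof.
have [[n [c [cc iu iv]]]|no] := pselect (joined u v); last by exists [::].
by have [s hs] := trace_cube cc iu iv; exists s.
Qed.

Definition cp u v := projT1 (cid (cp_ex u v)).

Lemma cpP u v : joined u v -> trace u v (cp u v).
Proof. exact: projT2 (cid (cp_ex u v)). Qed.

Lemma cp_cube n (c : corner n -> X) u v : cube c -> incube c u -> incube c v -> trace u v (cp u v).
Proof. by move=> cc iu iv; apply: cpP; exists n, c. Qed.

Fixpoint row_path (V : nat -> X) m : seq X :=
  if m is m'.+1 then cp (V m') (V m) ++ row_path V m' else [:: V 0].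

Lemma row_path_walk V m : (forall i, (i < m)%N -> joined (V i) (V i.+1)) ->
  @walk Q (V 0) (V m) (row_path V m).
Proof.
elim: m => [|m IH] h; first exact: walk0.
apply: trace_walk (cpP (h m (ltnSn m))) (IH _) => i im.
by apply: h; rewrite ltnS ltnW.
Qed.

Lemma row_path_head V m : (forall i, (i < m)%N -> joined (V i) (V i.+1)) ->
  exists s, row_path V m = V m :: s.
Proof. by move=> /row_path_walk; case; [exists [::]|move=> x w p _ _; exists p]. Qed.

Lemma cpxx_hom u p : cp u u ++ u :: p ~~> u :: p.
Proof.
apply: trace_hom _ (trace_refl u); apply: cpP.
exists 0, (fun _ => u); split; [exact: cube_vertex|by exists (origin 0)|by exists (origin 0)].
Qed.

Lemma row_path_hom V V' N : V 0 = V' 0 ->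
  (forall i, (i < N)%N -> exists n (c : corner n -> X),
    [/\ cube c, incube c (V i), incube c (V i.+1), incube c (V' i) & incube c (V' i.+1)]) ->
  cp (V N) (V' N) ++ row_path V N ~~> row_path V' N.
Proof.
move=> e0; elim: N => [|N IH] h; first by rewrite /= e0; exact: cpxx_hom.
have hN i : (i < N)%N -> (i < N.+1)%N by move=> iN; rewrite ltnS ltnW.
have [n [c [cc c1 c2 c3 c4]]] := h N (ltnSn N).
have [|s es] := @row_path_head V N.
  by move=> i /hN /h[n' [c' [? ? ? ? ?]]]; exists n', c'.
rewrite /= es; apply: (@hom_trans Q (cp (V N) (V' N.+1) ++ V N :: s)).
  by apply: (trace_triangle s cc c1 c2 c4); exact: cp_cube cc _ _.
apply: (@hom_trans Q (cp (V' N) (V' N.+1) ++ cp (V N) (V' N) ++ V N :: s)).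
  by apply: hom_sym; apply: (trace_triangle s cc c1 c3 c4); exact: cp_cube cc _ _.
by apply: hom_cat; rewrite -es; apply: IH => i /hN; exact: h.
Qed.

Lemma row_path_const u N V : (forall i, (i <= N)%N -> V i = u) -> row_path V N ~~> [:: u].
Proof.
elim: N => [|N IH] h; first by rewrite /= h //; exact: hom_refl.
have h' := IH (fun i iN => h i (leqW iN)).
rewrite /= !h //; apply: hom_trans (hom_cat _ h') _; exact: cpxx_hom.
Qed.

(** Sweep row by row: the four labels of each cell lie in a common cube, where all traces between
    two vertices are homotopic. The sides are constant and the top row is trivial. *)
Lemma grid_hom u N (V : nat -> nat -> X) :
  (forall i j, (i < N)%N -> (j < N)%N -> exists n (c : corner n -> X),
    [/\ cube c, incube c (V i j), incube c (V i.+1 j), incube c (V i j.+1) & incube c (V i.+1 j.+1)]) ->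
  (forall j, (j <= N)%N -> V 0 j = u /\ V N j = u) -> (forall i, (i <= N)%N -> V i N = u) ->
  row_path (V^~ 0) N ~~> [:: u].
Proof.
move=> cell sides top; suff h j : (j <= N)%N -> row_path (V^~ 0) N ~~> row_path (V^~ j) N.
  by apply: hom_trans (h N (leqnn N)) _; exact: row_path_const.
elim: j => [|j IH] jN; first exact: hom_refl.
have cellj i : (i < N)%N -> exists n (c : corner n -> X),
    [/\ cube c, incube c (V i j), incube c (V i.+1 j), incube c (V i j.+1) & incube c (V i.+1 j.+1)].
  by move=> iN; exact: cell.
apply: hom_trans (IH (ltnW jN)) _.
have [s1 s2] := sides j (ltnW jN); have [s3 s4] := sides j.+1 jN.
apply: hom_trans _ (@row_path_hom (V^~ j) (V^~ j.+1) N _ cellj); last by rewrite s1 s3.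
have [|s es] := @row_path_head (V^~ j) N.
  by move=> i /cellj[n [c [? ? ? ? ?]]]; exists n, c.
by rewrite es s2 s4; apply: hom_sym; exact: cpxx_hom.
Qed.

Fixpoint edge_walk (A : nat -> X) L : seq X := if L is L'.+1 then A L :: edge_walk A L' else [:: A 0].

Lemma edge_walk_head A L : exists s, edge_walk A L = A L :: s.
Proof. by case: L => [|L]; [exists [::]|exists (edge_walk A L)]. Qed.

(** The M samples on an edge take only its two ends as values, so their traces compose to the
    edge. *)
Lemma row_path_edges V A L M : (forall k, (k < L)%N -> xadj (A k) (A k.+1)) ->
  (forall k, (k <= L)%N -> V (k * M) = A k) ->
  (forall k i, (k < L)%N -> (k * M <= i <= k.+1 * M)%N -> V i = A k \/ V i = A k.+1) ->
  row_path V (L * M) ~~> edge_walk A L.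
Proof.
elim: L => [|L IH] adjA VA Vin.
  by rewrite mul0n /= -(VA 0) // mul0n; exact: hom_refl.
have := IH (fun k h => adjA k (leqW h)) (fun k h => VA k (leqW h)) (fun k i h => Vin k i (leqW h)).
move=> hL; have [c cc [c0 c1]] := adjA L (ltnSn L).
have in0 : incube c (A L) by exists (origin 1).
have in1 : incube c (A L.+1) by exists (antipode 1).
have inV i : (i <= M)%N -> incube c (V (L * M + i)).
  move=> iM; have [||->|->] := Vin L (L * M + i) => //; rewrite leq_addr mulSn addnC leq_add2r iM //.
have [s es] := edge_walk_head A L.
have sub i : (i <= M)%N -> row_path V (L * M + i) ~~> cp (A L) (V (L * M + i)) ++ A L :: s.
  elim: i => [_|i IHi iM].
    by rewrite addn0 VA //; apply: hom_trans hL _; rewrite es; apply: hom_sym; exact: cpxx_hom.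
  rewrite addnS /=; apply: hom_trans (hom_cat _ (IHi (ltnW iM))) _.
  have i1 := inV i (ltnW iM); have i2 := inV i.+1 iM; rewrite addnS in i2.
  by apply: (trace_triangle s cc in0 i1 i2); exact: cp_cube cc _ _.
rewrite mulSn addnC; apply: hom_trans (sub M (leqnn M)) _.
rewrite -mulSnr VA // /= es; apply: (@trace_hom _ _ _ [:: A L.+1]).
  exact: cp_cube cc _ _.
by apply: trace_edge; exact: adjA.
Qed.

End Traces.

(** * Topological connectivity implies combinatorial connectivity *)

Section Homotopies.
Import Order.TTheory GRing.Theory Num.Theory.
Import numFieldNormedType.Exports.
Local Open Scope classical_set_scope.
Local Open Scope ring_scope.

Section TopologicalToCombinatorial.
Variables (R : realType) (X : cubeComplex) (cat0 : CAT0 R X).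
Let flag : flag_links X := cat0.2.
Local Notation Q := (square_complex flag).

Lemma walk_edges (u v : Q) p : walk u v p -> exists (A : nat -> X) L,
  [/\ p = edge_walk A L, A 0%N = u, A L = v & forall k, (k < L)%N -> xadj (A k) (A k.+1)].
Proof.
elim=> [|x w q _ [A [L [eq A0 AL hA]]] xw]; first by exists (fun _ => u), 0%N.
pose A' k := if (k <= L)%N then A k else w.
have eA k : (k <= L)%N -> A' k = A k by rewrite /A' => ->.
exists A', L.+1; split=> [||| k].
- rewrite /= {1}/A' ltnn eq; congr cons.
  suff h k : (k <= L)%N -> edge_walk A k = edge_walk A' k by exact: h.
  by elim: k => [|k IH] kL /=; rewrite eA // IH // ltnW.
- by rewrite eA.
- by rewrite /A' ltnn.
- rewrite ltnS leq_eqVlt => /orP[/eqP->|kL]; last by rewrite (eA k (ltnW kL)) (eA _ kL); exact: hA.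
  by rewrite eA // /A' ltnn AL.
Qed.

Let x_ (N i : nat) : R := i%:R / N%:R.

Lemma grid_itv N i : (0 < N)%N -> (i <= N)%N -> `[0, 1]%classic (x_ N i).
Proof.
move=> N0 iN; have N0' : (0 : R) < N%:R by rewrite ltr0n.
rewrite /= in_itv /= /x_ divr_ge0 ?ler0n //= ler_pdivrMr // mul1r ler_nat //.
Qed.

Lemma grid_ball N i d : (0 < N)%N -> N%:R^-1 < d -> ball (x_ N i) d (x_ N i.+1) /\ ball (x_ N i.+1) d (x_ N i) /\ ball (x_ N i) d (x_ N i).
Proof.
move=> N0 Nd; have N0' : (0 : R) < N%:R^-1 by rewrite invr_gt0 ltr0n.
have h : ball (x_ N i) d (x_ N i.+1).
  rewrite /ball /= /x_ -mulrBl -natr1 opprD addrA subrr sub0r mulN1r normrN gtr0_norm //.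
by split=> //; split; [exact: ball_sym|apply: ballxx; exact: lt_trans Nd].
Qed.

Lemma grid_mesh (d : R) L : 0 < d -> (0 < L)%N -> exists M, (0 < M)%N /\ (L * M)%:R^-1 < d.
Proof.
move=> d0 L0; pose M := (Num.trunc d^-1).+1; exists M; split=> //.
rewrite invf_plt ?posrE ?ltr0n ?muln_gt0 ?L0 //.
have h : d^-1 < M%:R by apply: truncnS_gt; rewrite invr_ge0 ltW.
by apply: lt_le_trans h _; rewrite ler_nat leq_pmull.
Qed.

(** In a fine subdivision the point of index i lies in the stars of V i and of V (i+1), so the cube
    carrying it contains both vertices. *)
Lemma CAT0_conn (u v : Q) : exists p, walk u v p.
Proof.
have [[_ pc _] _] := cat0; have [f [cf f0 f1]] := pc (vpt R u) (vpt R v).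
have [d [d0 hd]] := lebesgue (@segment_compact R 0 1) cf.
have [N [N0 Nd]] := grid_mesh d0 (ltnSn 0); rewrite mul1n in Nd.
have /choice[V hV] : forall i, exists w, (i <= N)%N ->
    forall z, `[0, 1]%classic z -> ball (x_ N i) d z -> star w (f z).
  move=> i; have [iN|] := leqP i N; last by exists u.
  by have [w hw] := hd _ (grid_itv N0 iN); exists w.
have at0 : x_ N 0 = 0 by rewrite /x_ mul0r.
have at1 : x_ N N = 1 by rewrite /x_ divff // pnatr_eq0 -lt0n.
have V0 : V 0%N = u.
  apply: (@star_pt R); rewrite -f0 -at0; apply: hV => //; first exact: grid_itv.
  exact: (grid_ball 0 N0 Nd).2.2.
have VN : V N = v.
  apply: (@star_pt R); rewrite -f1 -at1; apply: hV => //; first exact: grid_itv.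
  exact: (grid_ball N N0 Nd).2.2.
have := @row_path_walk X flag V N; rewrite V0 VN => h; exists (row_path V N); apply: h => i iN.
have [n [c [cc hc]]] := star_cube (f (x_ N i)).
have ii := grid_itv N0 (ltnW iN); have [b1 [b2 b3]] := grid_ball i N0 Nd.
exists n, c; split=> //; apply: hc; first by apply: hV => //; exact: ltnW.
by apply: hV.
Qed.

Lemma CAT0_closed A L u : (forall k, (k < L)%N -> xadj (A k) (A k.+1)) ->
  A 0%N = u -> A L = u -> @homotopic Q (edge_walk A L) [:: u].
Proof.
move=> hA A0 AL; case: (posnP L) => [eL|L0]; first by rewrite eL /= A0; exact: hom_refl.
have L0' : (0 : R) < L%:R by rewrite ltr0n.
have [f [cf fA fs]] := walk_path R hA.
pose f' s := f (s * L%:R).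
have itvL (s : R) : `[0, 1]%classic s -> `[0, L%:R]%classic (s * L%:R).
  by rewrite /= !in_itv /= => /andP[h1 h2]; rewrite mulr_ge0 ?ler0n //= ler_piMl ?ler0n.
have cf' : {within `[0, 1], continuous f'}.
  apply/subspace_continuousP => s hs U nU; move/subspace_continuousP: cf => cf.
  have := cf _ (itvL s hs) U nU; rewrite /= nbhs_simpl /= => h1.
  have := @mulrr_continuous R L%:R s _ h1; rewrite /= nbhs_simpl /= => h2.
  by apply: filterS h2 => z /= h3 /itvL.
have [[_ _ lnh] _] := cat0.
have f'0 : f' 0 = vpt R u by have := fA 0%N isT; rewrite A0 => <-; rewrite /f' mul0r.
have f'1 : f' 1 = vpt R u by rewrite /f' mul1r fA ?AL.
have [|F [cF F0 F1 Fs]] := lnh f' cf'; first by rewrite f'0 f'1.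
have cK : compact (`[0, 1]%classic `*` `[0, 1]%classic : set (R * R)).
  by apply: compact_setX; exact: segment_compact.
have [d [d0 hd]] := lebesgue cK cF.
(* The mesh is a multiple of L, so that the vertices of the loop are grid points of the bottom
   side. *)
have [M [M0 Nd]] := grid_mesh d0 L0; set N := (L * M)%N in Nd.
have N0 : (0 < N)%N by rewrite muln_gt0 L0.
have /choice[W hW] : forall ij : nat * nat, exists w, (ij.1 <= N)%N -> (ij.2 <= N)%N ->
    forall z, (`[0, 1]%classic `*` `[0, 1]%classic) z -> ball (x_ N ij.1, x_ N ij.2) d z -> star w (F z).
  move=> [i j] /=; have [iN|] := leqP i N; last by exists u.
  have [jN|] := leqP j N; last by exists u.
  have [|w hw] := hd (x_ N i, x_ N j); first by split; exact: grid_itv.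
  by exists w.
pose V i j := W (i, j).
have hV i j i' j' : (i <= N)%N -> (j <= N)%N -> (i' <= N)%N -> (j' <= N)%N ->
    ball (x_ N i) d (x_ N i') -> ball (x_ N j) d (x_ N j') -> star (V i j) (F (x_ N i', x_ N j')).
  by move=> h1 h2 h3 h4 h5 h6; apply: (hW (i, j)) => //; split; apply: grid_itv.
have bb i : ball (x_ N i) d (x_ N i) by exact: (grid_ball i N0 Nd).2.2.
have hV0 i j : (i <= N)%N -> (j <= N)%N -> star (V i j) (F (x_ N i, x_ N j)).
  by move=> h1 h2; apply: hV.
have at0 : x_ N 0 = 0 by rewrite /x_ mul0r.
have at1 : x_ N N = 1 by rewrite /x_ divff // pnatr_eq0 -lt0n.
have memI i : (i <= N)%N -> x_ N i \in `[0, 1] by move=> iN; have := grid_itv N0 iN.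
have grid : @homotopic Q (row_path (V^~ 0%N) N) [:: u].
  apply: grid_hom => [i j iN jN|j jN|i iN].
  - have [n [c [cc hc]]] := star_cube (F (x_ N i, x_ N j)).
    have [b1 [b2 _]] := grid_ball i N0 Nd; have [b3 [b4 _]] := grid_ball j N0 Nd.
    have iN' := ltnW iN; have jN' := ltnW jN.
    by exists n, c; split=> //; apply: hc; apply: hV.
  - have [e1 e2] := Fs _ (memI j jN); split; apply: (@star_pt R); rewrite -f'0.
      by rewrite -e1 -at0; apply: hV0.
    by rewrite -e2 -at1; apply: hV0.
  - by apply: (@star_pt R); rewrite -f'0 -(F1 _ (memI i iN)) -at1; apply: hV0.
have bot i : (i <= N)%N -> star (V i 0%N) (f (i%:R / M%:R)).
  move=> iN; have := hV0 i 0%N iN (leq0n _); rewrite at0 F0 ?memI //.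
  rewrite /f' /x_ (_ : i%:R / N%:R * L%:R = i%:R / M%:R) // /N natrM.
  by field; rewrite !pnatr_eq0 -!lt0n L0 M0.
have M0' : (0 : R) < M%:R by rewrite ltr0n.
apply: hom_trans (hom_sym _) grid; rewrite /N; apply: row_path_edges hA _ _ => [k kL|k i kL /andP[k1 k2]].
  apply: (@star_pt R); rewrite -(fA k kL).
  have := bot (k * M)%N; rewrite natrM mulfK ?gt_eqF // => h; apply: h.
  by rewrite leq_mul2r kL orbT.
apply: (fs k (i%:R / M%:R)) => //.
  by rewrite ler_pdivlMr // ler_pdivrMr // -!natrM !ler_nat k1 k2.
by apply: bot; apply: leq_trans k2 _; rewrite leq_mul2r kL orbT.
Qed.

Lemma CAT0_sc (u v : Q) p q : walk u v p -> walk u v q -> homotopic p q.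
Proof.
move=> wp wq; have [q1 eq] := walk_nnil wq; have [s es] := walk_nnil wp.
have [A [L [eA A0 AL hA]]] := walk_edges (rev_walk wq eq wp).
have := CAT0_closed hA A0 AL; rewrite -eA => h.
have [q0 [e0 hq]] := rev_walk_cancel wq eq.
apply: (@hom_trans _ (q0 ++ rev q1 ++ p)); first by rewrite es; apply: hom_sym; exact: hq.
by rewrite e0 -cats1; exact: hom_cat.
Qed.

Definition cubed_complex : cubed := Cubed CAT0_conn CAT0_sc.

End TopologicalToCombinatorial.

End Homotopies.

(** * The action on hyperplanes *)

Section CubicalActions.
Import Order.TTheory GRing.Theory Num.Theory.
Local Open Scope classical_set_scope.
Local Open Scope ring_scope.

Section L1Basics.
Variables (R : realType) (X : cubeComplex).
Implicit Types (p q r : realization R X).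

Lemma l1_string_ge0 p q (L : R) : l1_string p q L -> 0 <= L.
Proof. by elim=> // *; rewrite addr_ge0 // sumr_ge0. Qed.

Lemma l1_has_lb p q : has_lbound [set L : R | l1_string p q L].
Proof. by exists 0 => L /l1_string_ge0. Qed.

Lemma l1_dist_le p q (L : R) : l1_string p q L -> l1_dist p q <= L.
Proof. by move=> h; apply: ge_inf => //; exact: l1_has_lb. Qed.

Lemma l1_distxx p : l1_dist p p <= 0.
Proof. exact: l1_dist_le (string_nil p). Qed.

End L1Basics.

Section Action.
Variables (R : realType) (X : cubeComplex) (cat0 : CAT0 R X).
Variables (G : groupType) (a : cubicalAction G X).
Hypothesis proper : proper_action R a.
Local Notation C := (cubed_complex cat0).
Implicit Types (g h : G) (u v : C) (H K : set (X * X)).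

Lemma actK g : cancel (a g) (a g^-1%g).
Proof. by move=> u; rewrite -actM mulVg act1. Qed.

Lemma act_adj g u v : adj u v -> adj (a g u : C) (a g v).
Proof. by move=> [c cc [-> ->]]; exists (a g \o c) => //; exact: act_cube. Qed.

Lemma act_sq g (x y z w : C) : sq x y z w -> sq (a g x : C) (a g y) (a g z) (a g w).
Proof.
by move=> [c cc [<- <- <- <-]]; exists (a g \o c) => //; exact: act_cube.
Qed.

Lemma act_walk g u v p : walk u v p -> walk (a g u : C) (a g v) (map (a g) p).
Proof.
by elim=> [|x w q _ IH xw] /=; [exact: walk0|apply: walkS IH _; exact: act_adj].
Qed.

Lemma act_dist g u v : dist (a g u : C) (a g v) = dist u v.
Proof.
have h k (x y : C) : (dist (a k x : C) (a k y) <= dist x y)%N.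
  have [p [wp _ e]] := geodesic_ex x y.
  by have := dist_walk (act_walk k wp); rewrite size_map e ltnS.
by apply/eqP; rewrite eqn_leq h; have := h g^-1%g (a g u) (a g v); rewrite !actK => ->.
Qed.

Definition act2 g (e : X * X) := (a g e.1, a g e.2).
Definition actw g H := [set act2 g e | e in H].

Lemma actw1 H : actw 1%g H = H.
Proof.
have h e : act2 1%g e = e by case: e => x y; rewrite /act2 !act1.
by apply/seteqP; split=> [_ [e He <-]|e He]; rewrite ?h //; exists e; rewrite ?h.
Qed.

Lemma actwM g h H : actw (g * h)%g H = actw g (actw h H).
Proof.
have E e : act2 (g * h)%g e = act2 g (act2 h e) by rewrite /act2 !actM.
apply/seteqP; split=> [_ [e He <-]|_ [_ [e He <-] <-]]; last by exists e; rewrite ?E.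
by exists (act2 h e); rewrite ?E //; exists e.
Qed.

Lemma act_parallel g e f : @parallel C e f -> @parallel C (act2 g e) (act2 g f).
Proof.
elim=> [x y h|x|x y _ h|x y z _ h1 _ h2].
- apply: rst_step; case: h => [->|h]; [by left|right]; exact: act_sq.
- exact: rst_refl.
- exact: rst_sym.
- exact: rst_trans h1 h2.
Qed.

Lemma act_hyper g e : hyper (X := C) (act2 g e) = actw g (hyper (X := C) e).
Proof.
apply/seteqP; split=> [f h|_ [f h <-]]; last exact: act_parallel.
exists (act2 g^-1%g f); last by case: f {h} => x y; rewrite /act2 -!actM mulgV !act1.
by have := act_parallel g^-1%g h; rewrite /act2 /= !actK; case: e {h}.
Qed.

Lemma act_hsep g H u v : hsep (X := C) (actw g H) (a g u) (a g v) = hsep (X := C) H u v.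
Proof.
have h k K (x y : C) : hsep (X := C) K x y -> hsep (X := C) (actw k K) (a k x) (a k y).
  move=> /asboolP[e [ae -> se]]; rewrite -act_hyper hsepE; last exact: act_adj.
  by move: se; rewrite /esep /= !act_dist.
apply/idP/idP => [s|]; last exact: h.
by have := h g^-1%g _ _ _ s; rewrite -actwM mulVg actw1 !actK.
Qed.

Lemma stab_finite u : exists s : seq G, forall g, a g u = u -> g \in s.
Proof.
have [r r0 /finite_seqP[s es]] := proper (vpt R u).
exists s => g gu; have : [set` s] g; last by [].
rewrite -es; exists (vpt R u).
have b : l1_ball (vpt R u) r (vpt R u) by apply: le_lt_trans (l1_distxx _) r0.
split=> //; exists (vpt R u) => //; apply: sval_inj_realization; apply/funext => v.
rewrite -[LHS]/(sval (vpt R u) (a g^-1%g v)) !ptE; congr (nat_of_bool _)%:R.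
apply/eqP/eqP => [e|<-]; last by rewrite -{2}gu actK.
by rewrite -gu e -actM mulgV act1.
Qed.

Lemma hsep_eq u v : (forall H, hsep (X := C) H u v = false) -> u = v.
Proof.
move=> h; apply: (@dist_eq0 C); rewrite -size_hseps; case E: (hseps _ _) => [//|H s].
by have := h H; rewrite -mem_hseps E mem_head.
Qed.

Definition hyperplane_action : wallAct G := @WallAct G X (set (X * X)) (fun g v => a g v) actw
  (hsep (X := C)) (hseps (X := C)) (act1 a) (actM a) actw1 actwM
  (@mem_hseps C) (@uniq_hseps C) (@hsepA C) act_hsep
  hsep_eq
  (@realize C) stab_finite.

End Action.

End CubicalActions.

(** * The L1 metric and the combinatorial distance *)

Section L1Metric.
Import Order.TTheory GRing.Theory Num.Theory.
Local Open Scope ring_scope.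

Section Multilinear.
Variables (R : realType) (n : nat).
Implicit Types (e : corner n) (t s : 'rV[R]_n) (F : corner n -> R).

Definition weight t e := \prod_(i < n) (if e i then t ord0 i else 1 - t ord0 i).
Definition mlin F t := \sum_e weight t e * F e.
Definition upd t (i : 'I_n) z : 'rV[R]_n := \row_j if j == i then z else t ord0 j.

Lemma weight_ge0 t e : unit_cube t -> 0 <= weight t e.
Proof.
move=> ht; apply: prodr_ge0 => i _.
by case/andP: (ht i) => h0 h1; case: ifP; rewrite // subr_ge0.
Qed.

Lemma weight_sum t : \sum_e weight t e = 1.
Proof.
have := bigA_distr_bigA (fun (i : 'I_n) (b : bool) => if b then t ord0 i else 1 - t ord0 i).
rewrite /weight => <-; apply: big1 => i _; rewrite big_bool /=; ring.
Qed.

Lemma weight_upd t i z e : weight (upd t i z) e =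
  (if e i then z else 1 - z) * \prod_(j < n | j != i) (if e j then t ord0 j else 1 - t ord0 j).
Proof.
rewrite /weight (bigD1 i) //= !mxE eqxx; congr (_ * _); apply: eq_bigr => j /negbTE ne.
by rewrite !mxE ne.
Qed.

Lemma mlin_upd F t i z : mlin F (upd t i z) =
  mlin F (upd t i 0) + z * (mlin F (upd t i 1) - mlin F (upd t i 0)).
Proof.
rewrite /mlin mulrBr !mulr_sumr -sumrB -big_split; apply: eq_bigr => e _ /=.
by rewrite !weight_upd; case: (e i); ring.
Qed.

Lemma upd_unit t i z : unit_cube t -> 0 <= z <= 1 -> unit_cube (upd t i z).
Proof. by move=> ht hz j; rewrite mxE; case: eqP. Qed.

Lemma mlin_slope F t i : unit_cube t -> (forall e, `|F (flip e i) - F e| <= 1) ->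
  `|mlin F (upd t i 1) - mlin F (upd t i 0)| <= 1.
Proof.
move=> ht hF; have u0 : unit_cube (upd t i 0) by apply: upd_unit; rewrite // lexx ler01.
have -> : mlin F (upd t i 1) = \sum_e weight (upd t i 0) e * F (flip e i).
  rewrite /mlin (reindex_inj (inv_inj (flipK i))); apply: eq_bigr => e _; congr (_ * _).
  rewrite !weight_upd ffunE eqxx addbT; congr (_ * _); first by case: (e i) => /=; ring.
  by apply: eq_bigr => j /negbTE ne; rewrite ffunE ne addbF.
rewrite /mlin -sumrB; apply: le_trans (ler_norm_sum _ _ _) _.
rewrite -[leRHS](weight_sum (upd t i 0)); apply: ler_sum => e _.
rewrite -mulrBr normrM ger0_norm ?weight_ge0 //.
by rewrite ler_piMr ?weight_ge0.
Qed.

(** Change one coordinate at a time through the hybrid points [hyb]; in each coordinate the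
    extension is affine of slope at most 1. *)
Lemma mlin_lip F t s : unit_cube t -> unit_cube s ->
  (forall e i, `|F (flip e i) - F e| <= 1) ->
  `|mlin F t - mlin F s| <= \sum_(i < n) `|t ord0 i - s ord0 i|.
Proof.
move=> ht hs hF; pose hyb k : 'rV[R]_n := \row_j if (j < k)%N then s ord0 j else t ord0 j.
have hh k : unit_cube (hyb k) by move=> j; rewrite mxE; case: ifP.
have e0 : hyb 0%N = t by apply/rowP => j; rewrite mxE.
have en : hyb n = s by apply/rowP => j; rewrite mxE (ltn_ord j).
suff main k : (k <= n)%N ->
    `|mlin F t - mlin F (hyb k)| <= \sum_(i < n | (i < k)%N) `|t ord0 i - s ord0 i|.
  have := main n (leqnn n); rewrite en => h; apply: le_trans h _.
  by rewrite (eq_bigl xpredT) // => i; exact: ltn_ord.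
elim: k => [_|k IH kn]; first by rewrite e0 subrr normr0 sumr_ge0.
pose i := Ordinal kn.
have -> : \sum_(j < n | (j < k.+1)%N) `|t ord0 j - s ord0 j| =
    `|t ord0 i - s ord0 i| + \sum_(j < n | (j < k)%N) `|t ord0 j - s ord0 j|.
  rewrite (bigD1 i) /= ?ltnSn //; congr (_ + _); apply: eq_bigl => j.
  by rewrite -val_eqE /=; lia.
have h1 : hyb k = upd (hyb k) i (t ord0 i).
  by apply/rowP => j; rewrite !mxE; case: eqP => [->|//]; rewrite /= ltnn.
have h2 : hyb k.+1 = upd (hyb k) i (s ord0 i).
  apply/rowP => j; rewrite !mxE; case: eqP => [->|/eqP ne]; first by rewrite /= ltnSn.
  by congr (if _ then _ else _); move: ne; rewrite -val_eqE /=; lia.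
have h3 : `|mlin F (hyb k) - mlin F (hyb k.+1)| <= `|t ord0 i - s ord0 i|.
  rewrite h2 {1}h1 [mlin F (upd _ _ (t _ _))]mlin_upd [mlin F (upd _ _ (s _ _))]mlin_upd.
  have -> (x y z w : R) : x + z * y - (x + w * y) = (z - w) * y by ring.
  by rewrite normrM ler_piMr ?mlin_slope.
rewrite [leRHS]addrC; apply: le_trans (lerD (IH (ltnW kn)) h3).
exact: ler_distD.
Qed.

End Multilinear.

Section L1.
Variables (R : realType) (X : cubeComplex) (cat0 : CAT0 R X).
Local Notation C := (cubed_complex cat0).
Implicit Types (p q r : realization R X).

Lemma mlin_bary n (c : corner n -> X) t (F : X -> R) (l : seq X) : uniq l ->
  (forall e, c e \in l) -> mlin (F \o c) t = \sum_(v <- l) bary c t v * F v.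
Proof.
move=> ul hl; rewrite (eq_bigr (fun v => \sum_(e | c e == v) weight t e * F v)); last first.
  by move=> v _; rewrite mulr_suml.
rewrite (exchange_big_dep xpredT) //=; apply: eq_bigr => e _.
rewrite big_mkcond (bigD1_seq (c e)) //= eqxx big1_seq ?addr0 // => v /andP[/negbTE ne _].
by rewrite eq_sym ne.
Qed.

(** The extension depends on a point only through its vertex weights, so values computed in
    different cubes agree. *)
Lemma mlin_indep n n' (c : corner n -> X) (c' : corner n' -> X) t t' (F : X -> R) :
  bary c t = bary c' t' -> mlin (F \o c) t = mlin (F \o c') t'.
Proof.
move=> e; pose l := undup (codom c ++ codom c').
have hl e1 : c e1 \in l by rewrite mem_undup mem_cat codom_f.
have hl' e1 : c' e1 \in l by rewrite mem_undup mem_cat codom_f orbT.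
by rewrite !(@mlin_bary _ _ _ _ l) ?undup_uniq // e.
Qed.

Lemma string_lip (F : X -> R) p q L : (forall u v : X, edge (u, v) -> `|F u - F v| <= 1) ->
  l1_string p q L -> forall n n' (c : corner n -> X) (c' : corner n' -> X) t t',
  sval p = bary c t -> sval q = bary c' t' -> `|mlin (F \o c) t - mlin (F \o c') t'| <= L.
Proof.
move=> hF; elim=> [{}p|m d t0 s0 {}p q' {}q {}L cd ht hs ep eq' _ IH] n n' c c' t t' e e'.
  by rewrite (mlin_indep F (etrans (esym e) e')) subrr normr0.
rewrite (mlin_indep F (etrans (esym e) ep)).
have h1 := IH _ _ _ _ _ _ eq' e'.
have h2 := @mlin_lip R m (F \o d) t0 s0 ht hs
   (fun e i => hF _ _ (xadjC (cube_xadj e i cd))).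
by apply: le_trans (lerD h2 h1); exact: ler_distD.
Qed.

Lemma mlin_corner n (F : corner n -> R) e : mlin F (corner_row R e) = F e.
Proof.
rewrite /mlin (bigD1 e) //= big1 ?addr0 => [|e' ne].
  have -> : weight (corner_row R e) e = 1.
    by apply: big1 => i _; rewrite mxE; case: (e i); rewrite ?subr0.
  by rewrite mul1r.
have [i ni] : exists i, e' i != e i.
  by apply/existsP; rewrite -negb_forall; apply: contra ne => /forallP h; apply/eqP/ffunP => i; apply/eqP.
by rewrite /weight (bigD1 i) //= mxE; case: (e' i) ni; case: (e i) => //= _; rewrite ?subrr !mul0r.
Qed.

Lemma unit_corner n (e : corner n) : unit_cube (corner_row R e).
Proof. by move=> i; rewrite mxE; case: (e i); rewrite ?lexx ?ler01. Qed.

Lemma cube_diam n (t s : 'rV[R]_n) : unit_cube t -> unit_cube s ->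
  \sum_(i < n) `|t ord0 i - s ord0 i| <= n%:R.
Proof.
move=> ht hs; rewrite -[n in leRHS]card_ord -sumr_const; apply: ler_sum => i _.
have := ht i; have := hs i; rewrite ler_norml; lra.
Qed.

(** The test function is the distance from c e, extended multilinearly. It is 1-Lipschitz along
    strings, and moving from the point with coordinates t to the corner e costs at most n at each
    end. *)
Lemma l1_string_lower n (c c' : corner n -> X) t e p q L : cube c -> cube c' -> unit_cube t ->
  sval p = bary c t -> sval q = bary c' t -> l1_string p q L ->
  (dist (c e : C) (c' e))%:R - (n%:R *+ 2) <= L.
Proof.
move=> cc cc' ht ep eq st; pose F (v : X) : R := (dist (c e : C) v)%:R.
have hF (u v : X) : edge (u, v) -> `|F u - F v| <= 1.
  move=> uv; rewrite /F; have [->|->] := @dist_adj C (c e) u v uv; rewrite -natr1.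
    by rewrite opprD addrA subrr add0r normrN normr1.
  by rewrite addrAC subrr add0r normr1.
have h1 := string_lip hF st ep eq.
have lip (d : corner n -> X) (cd : cube d) : `|mlin (F \o d) t - F (d e)| <= n%:R.
  rewrite -[F (d e)]/((F \o d) e) -(mlin_corner (F \o d) e); apply: le_trans (cube_diam ht (unit_corner e)).
  apply: mlin_lip => //; first exact: unit_corner.
  by move=> e' i; apply: hF; apply: xadjC; exact: cube_xadj.
have h2 := lip _ cc; have h3 := lip _ cc'.
have F0 : F (c e) = 0 by rewrite /F distxx.
rewrite F0 in h2; rewrite -[(dist _ _)%:R]/(F (c' e)).
move: h1 h2 h3; rewrite !ler_norml => /andP[? ?] /andP[? ?] /andP[? ?]; lra.
Qed.

Lemma walk_string (u v : C) w : walk u v w -> forall q L, l1_string (vpt R v) q L ->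
  l1_string (vpt R u) q ((size w).-1%:R + L).
Proof.
elim=> [|x z w' wx IH [k ck [ex ez]]] q L st; first by rewrite add0r.
have [w1 e1] := walk_nnil wx.
have := IH q (1 + L) _; rewrite addrA natr1 e1 /=; apply.
rewrite (_ : 1 = \sum_(i < 1) `|(corner_row R (origin 1)) ord0 i - (corner_row R (antipode 1)) ord0 i|).
  apply: (string_cons ck) st; [exact: unit_corner|exact: unit_corner| |].
    by rewrite ex pt_corner.
  by rewrite ez pt_corner.
by rewrite big_ord1 !mxE !ffunE sub0r normrN normr1.
Qed.

Lemma l1_string_upper n (c c' : corner n -> X) t e p q : cube c -> cube c' -> unit_cube t ->
  sval p = bary c t -> sval q = bary c' t ->
  exists2 L, l1_string p q L & L <= (dist (c e : C) (c' e))%:R + (n%:R *+ 2).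
Proof.
move=> cc cc' ht ep eq; have [w [ww _ sw]] := @geodesic_ex C (c e) (c' e).
have u1 := unit_corner e.
have s3 := string_cons cc' u1 ht (pt_corner R c' e) eq (string_nil q).
have s2 := walk_string ww s3.
have s1 := string_cons cc ht u1 ep (pt_corner R c e) s2.
eexists; first exact: s1.
rewrite sw /= addr0 mulr2n.
apply: le_trans (lerD (cube_diam ht u1) (lerD (lexx _) (cube_diam u1 ht))) _; lra.
Qed.

Lemma l1_dist_bounds n (c c' : corner n -> X) t e p q : cube c -> cube c' -> unit_cube t ->
  sval p = bary c t -> sval q = bary c' t ->
  (dist (c e : C) (c' e))%:R - (n%:R *+ 2) <= l1_dist p q <= (dist (c e : C) (c' e))%:R + (n%:R *+ 2).
Proof.
move=> cc cc' ht ep eq; have [L st hL] := l1_string_upper e cc cc' ht ep eq.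
rewrite (le_trans (l1_dist_le st) hL) andbT; apply: lb_le_inf; first by exists L.
by move=> L' /=; exact: l1_string_lower.
Qed.

End L1.

End L1Metric.

(** * Stabilizers and crossings of hyperplanes *)

Section CrossingHyperplanes.
Import Order.TTheory GRing.Theory Num.Theory.
Local Open Scope classical_set_scope.
Local Open Scope ring_scope.

Section Final.
Variables (R : realType) (X : cubeComplex) (cat0 : CAT0 R X).
Variables (G : groupType) (a : cubicalAction G X).
Hypothesis proper : proper_action R a.
Local Notation C := (cubed_complex cat0).
Local Notation A := (hyperplane_action cat0 proper).

Lemma parallel_stepE (e f : X * X) : parallel_step e f <-> pstep (X := C) e f.
Proof.
split=> -[->|h]; [by left|right|by left|right].
  by case: h => k ck [-> ->] /=; exists k; rewrite -?axis_flip.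
case: h => k ck [h1 h2 h3 h4]; exists k => //.
by rewrite !axis_flip h1 h2 h3 h4; case: e {h1 h2} => ? ?; case: f {h3 h4}.
Qed.

Lemma hyper_hyperplane (e : X * X) : edge e -> hyperplane (hyper (X := C) e).
Proof.
move=> ee; exists e => //; apply/seteqP; split=> f h.
  elim: h => [x y /parallel_stepE|x|x y _|x y z _ h1 _ h2]; first exact: rst_step.
  - exact: rst_refl.
  - exact: rst_sym.
  - exact: rst_trans h1 h2.
elim: h => [x y /parallel_stepE|x|x y _|x y z _ h1 _ h2]; first exact: rst_step.
- exact: rst_refl.
- exact: rst_sym.
- exact: rst_trans h1 h2.
Qed.

Lemma essential_fg (x0 : pt A) :
  (forall H, hyperplane H -> finitely_generated (hyperplane_stabilizer a H)) ->
  forall H : wl A, essential x0 H -> fg_stab H.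
Proof.
move=> fg H [g [g' /hsep_hyper[e ae eH]]].
have [|S gS] := fg H; first by rewrite eH; apply: hyper_hyperplane; case: e ae {eH}.
have stab g0 : @gw _ A g0 H = H <-> exists w, spelled S g0 w.
  by have /predeqP/(_ g0) := gS.
exists (S ++ [seq s^-1%g | s <- S]); split=> [t|g0 /stab[w [wS <-]]].
  have fixS s : s \in S -> @gw _ A s H = H.
    move=> sS; apply/stab; exists [:: (s, false)]; split; first by rewrite /= sS.
    by rewrite weval_cons weval_nil mulg1.
  rewrite mem_cat => /orP[/fixS//|/mapP[s sS ->]].
  by rewrite -{1}(fixS s sS) gwK.
exists [seq if l.2 then l.1^-1%g else l.1 | l <- w]; split; last by rewrite /weval big_map.
apply/allP => _ /mapP[[s b] lw ->] /=; have /= sS := allP wS _ lw; rewrite mem_cat.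
by case: b {lw}; rewrite ?sS // map_f ?orbT.
Qed.

Lemma wcross_hcross (x0 : pt A) (H K : wl A) : wcross x0 H K -> hcross (X := C) H K.
Proof.
move=> cr u s t.
have [g [h1 h2]] := cr 1%g (s (+) hsep (X := C) H u x0) (t (+) hsep (X := C) K u x0).
exists (a g x0); rewrite (hsepA (X := C) H u x0) (hsepA (X := C) K u x0).
move: h1 h2; rewrite /= act1 => -> ->.
by rewrite addbC -addbA addbb addbF addbC -addbA addbb addbF.
Qed.

(** Three pairwise crossing hyperplanes have a common corner, their edges there pairwise span
    squares, and the flag condition produces a 3-cube. *)
Lemma dim2_crossing (x0 : pt A) (H K L : wl A) : dim_le X 2 ->
  wcross x0 H K -> wcross x0 H L -> wcross x0 K L -> False.
Proof.
move=> dim HK HL KL.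
pose i1 : 'I_3 := lift ord0 ord0.
have c3 (i : 'I_3) : [\/ i = ord0, i = i1 | i = ord_max].
  by case: i => [[|[|[|]]]] // h; [apply: Or31|apply: Or32|apply: Or33]; apply: val_inj.
pose F (i : 'I_3) : set (X * X) := if i == ord0 then H else if i == i1 then K else L.
have hyp (M N : set (X * X)) : wcross (A := A) x0 M N -> is_hyper (X := C) M.
  by move=> /(_ 1%g true true)[g [/hsep_hyper]].
have crF i j : i != j -> hcross (X := C) (F i) (F j).
  case: (c3 i) => ->; case: (c3 j) => -> //= _; rewrite /F /=; 
    first [exact: (wcross_hcross HK)|exact: (wcross_hcross HL)|exact: (wcross_hcross KL)
          |exact: (hcrossC (wcross_hcross HK))|exact: (hcrossC (wcross_hcross HL))
          |exact: (hcrossC (wcross_hcross KL))].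
have [|u [b hb]] := @crossing_corner C 3 F x0 _ crF.
  by move=> i; case: (c3 i) => ->; [exact: hyp HK|exact: hyp KL|apply: hyp (wcrossC HL)].
have [||k [ck _ _]] := @flag_cube X cat0.2 u 3 b; last by have := dim _ _ ck.
  by move=> i; exact: (hb i).1.
move=> i j ij; have [ui ei] := hb i; have [uj ej] := hb j.
by apply: (@corner_square C u) => //; rewrite -ei -ej; exact: crF.
Qed.

End Final.

End CrossingHyperplanes.

Import Order.TTheory GRing.Theory Num.Theory.
Local Open Scope classical_set_scope.
Local Open Scope ring_scope.

(** * Word length against the number of separating walls *)

Section WordMetric.
Variables (G : groupType) (S : seq G).
Hypothesis genS : generates S [set: G].

Lemma spelled_ex g : exists w, spelled S g w.
Proof. by have : [set: G] g by []; rewrite genS. Qed.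

Lemma spelled_letters : exists L : seq G, (forall s, s \in L -> s^-1%g \in L) /\
  forall g, exists k, g \in wball L k.
Proof.
exists (letters id [seq (s, false) | s <- S]); split=> [s|g]; first exact: lettersV.
have [w [wS <-]] := spelled_ex g; exists (size w); apply: letters_weval => s.
move=> /flattenP[_ /mapP[l lw ->] sl]; apply/flattenP; exists [:: l.1; (l.1)^-1%g] => //.
by rewrite -map_comp; apply/mapP; exists l.1; first exact: (allP wS).
Qed.

Lemma spelled_prod (D : seq G) : exists m, forall l, all (mem D) l ->
  exists2 w, spelled S (\prod_(g <- l) g)%g w & (size w <= m * size l)%N.
Proof.
have [sp hsp] := choice spelled_ex; exists (\max_(d <- D) size (sp d)) => l lD.
exists (flatten (map sp l)).
  split; elim: l {lD} => [|d l IH]; rewrite /= ?big_nil ?weval_nil //.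
    by rewrite all_cat IH (hsp d).1.
  by rewrite big_cons weval_cat (hsp d).2 IH.
elim: l lD => [|d l IH] //= /andP[dD lD]; rewrite size_cat mulnS leq_add ?IH //.
exact: (@leq_bigmax_seq _ _ xpredT (fun d => size (sp d)) d dD).
Qed.

Variables (A : wallAct G) (x0 : pt A).

Lemma spelled_sdist : exists M, forall g w, spelled S g w -> (sdist x0 (gp g x0) <= M * size w)%N.
Proof.
pose M := \max_(s <- S) sdist x0 (gp s x0).
have hM s : s \in S -> (sdist x0 (gp s x0) <= M)%N.
  by move=> sS; exact: (@leq_bigmax_seq _ _ xpredT (fun s => sdist x0 (gp s x0)) s sS).
exists M => g w [wS <-]; rewrite /weval -(size_map (fun l => if l.2 then l.1^-1%g else l.1)).
rewrite -(big_map (fun l => if l.2 then l.1^-1%g else l.1) xpredT id); apply: sdist_prod.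
move=> _ /mapP[[s b] lw ->] /=; have /= sS := allP wS _ lw; case: b {lw}; last exact: hM.
by rewrite -(sdistG s) gpVK sdistC; exact: hM.
Qed.

Variable R : realType.

Lemma word_dist_bounds : word_linear x0 -> exists K : nat, (0 < K)%N /\ forall g h,
  word_dist R S g h <= K%:R * ((sdist (gp g x0) (gp h x0))%:R + 1) /\
  (sdist (gp g x0) (gp h x0))%:R <= K%:R * word_dist R S g h.
Proof.
move=> [D [k lin]]; have [m hm] := spelled_prod D; have [M hM] := spelled_sdist.
(* m letters of S per element of D, k elements of D per unit of the wall count, and M for the
   displacement of x0 by one letter. *)
exists (m * k + M).+1; split=> // g h; set q := (g^-1 * h)%g.
have ed : sdist (gp g x0) (gp h x0) = sdist x0 (gp q x0).
  by rewrite -(sdistG g x0) -gpM /q mulVKg.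
rewrite ed; split.
  have [l [lD lq sl]] := lin q; have [w sw lw] := hm l lD.
  apply: (@le_trans _ _ (size w)%:R).
    apply: ge_inf; first by exists 0 => _ [w' _ <-]; exact: ler0n.
    by exists w => //; rewrite -/q -lq.
  rewrite natr1 -natrM ler_nat; apply: leq_trans lw _; apply: leq_trans (leq_mul (leqnn m) sl) _.
  by rewrite mulnA leq_mul // (leq_trans (leq_addr M _)).
rewrite -ler_pdivrMl ?ltr0n //; apply: lb_le_inf => [|_ [w sw <-]].
  by have [w hw] := spelled_ex q; exists (size w)%:R; exists w.
rewrite ler_pdivrMl ?ltr0n // -natrM ler_nat; apply: leq_trans (hM _ _ sw) _.
by rewrite leq_mul // (leq_trans (leq_addl (m * k) _)).
Qed.

End WordMetric.

Theorem theorem1p2 (R : realType) (G : groupType) (X : cubeComplex)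
    (a : cubicalAction G X)
    (hfp : finitely_presented G)
    (hcat : CAT0 R X)
    (hdim : finite_dimensional X)
    (hproper : proper_action R a)
    (hstab : forall H, hyperplane H -> finitely_generated (hyperplane_stabilizer a H))
    (hcases : (surface_group G \/ free_group G) \/ dimension X 2)
    (S : seq G) (hS : generates S [set: G]%classic)
    (x : realization R X) :
  quasi_isometric_embedding (word_dist R S) (@l1_dist R X) (orbit_map a x).
Proof.
(* x may be interior to a cube; the corner c e replaces it, and both ends together cost 2n in the L1
   distance. *)
have [n [c [t [cc ht ex]]]] := svalP x; pose e := origin n.
pose A := hyperplane_action hcat hproper; pose x0 : pt A := c e.
have fg := @essential_fg R X hcat G a hproper x0 hstab.
have lin : word_linear x0.
  case: hcases => [[sg|fr]|[d2 _]].
  - exact: surface_linear fg sg.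
  - apply: fin_crossing_linear; exact: fin_crossing_free hfp fr fg.
  - have [L [symL genL]] := spelled_letters hS.
    apply: fin_crossing_linear; apply: (fin_crossing_dim2 symL genL fg).
    by move=> H K M; exact: dim2_crossing.
have [K [K0 hK]] := word_dist_bounds hS R lin.
have bnd g h : (sdist (@gp _ A g x0) (gp h x0))%:R - n%:R *+ 2 <= l1_dist (orbit_map a x g) (orbit_map a x h)
    <= (sdist (gp g x0) (gp h x0))%:R + n%:R *+ 2.
  have ea k : sval (orbit_map a x k) = bary (a k \o c) t.
    apply/funext => v; rewrite /= ex; apply: eq_bigl => e'; apply/eqP/eqP => /= [->|<-].
      by rewrite -actM mulgV act1.
    by rewrite -actM mulVg act1.
  rewrite -[sdist _ _]/(size (hseps (X := cubed_complex hcat) (a g (c e)) (a h (c e)))) size_hseps.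
  exact: (l1_dist_bounds hcat e (act_cube a g cc) (act_cube a h cc) ht (ea g) (ea h)).
(* 2n from the change of base point, and 1 from the additive term in the linear bound on word
   length. *)
exists K%:R, (n%:R *+ 2 + 1); split; first by rewrite ler1n.
  by rewrite addr_ge0 ?mulrn_wge0.
move=> g h; have [h1 h2] := hK g h; have /andP[h3 h4] := bnd g h.
have K0' : (0 : R) < K%:R by rewrite ltr0n.
apply/andP; split.
  have : K%:R^-1 * word_dist R S g h <= (sdist (@gp _ A g x0) (gp h x0))%:R + 1.
    by rewrite ler_pdivrMl.
  by move: h3; rewrite mulr2n; lra.
by move: h4 h2; rewrite mulr2n; lra.
Qed.
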